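(* Let $\star$ be one of classical convolution $\ast$, additive free convolution $\boxplus$ or additive Boolean convolution $\uplus$, and let $\{\mu^{\star t}\}_{t\ge0}$ be a weakly continuous $\star$-convolution semigroup of probability measures on $\mathbb{R}$ such that $\mu^{\star0}=\delta_0$. If there exist functions $a\colon(0,\infty)\to(0,\infty)$ and $b\colon(0,\infty)\to\mathbb{R}$ such that $\mathbf{D}_{a(t)}(\mu^{\star t})\star\delta_{b(t)}$ converges weakly to a non-degenerate distribution $\nu$ as $t\downarrow0$ or as $t\to\infty$, then $\nu$ is $\star$-stable. If $b(t)\equiv0$, then $\nu$ is strictly $\star$-stable.
   Context: $\mathbf{D}_s(\mu)$ is the push-forward of $\mu$ by $x\mapsto sx$. With $G_\mu(z)=\int\frac{\mu(dx)}{z-x}$ and $F_\mu=1/G_\mu$: the free convolution $\boxplus$ is characterized by $\varphi_{\mu\boxplus\nu}=\varphi_\mu+\varphi_\nu$ where $\varphi_\mu(z)=F_\mu^{-1}(z)-z$ on truncated cones in the upper half-plane; the Boolean convolution $\uplus$ is characterized by $\eta_{\mu\uplus\nu}=\eta_\mu+\eta_\nu$ on the lower half-plane, where $\eta_\mu(z)=1-zF_\mu(1/z)$. A $\star$-convolution semigroup satisfies $\mu^{\star s}\star\mu^{\star t}=\mu^{\star(s+t)}$ for $s,t\ge0$. A probability measure is non-degenerate if it is not a point mass. A non-degenerate $\nu$ is $\star$-stable if for every $a,b>0$ there exist $c>0$, $d\in\mathbb{R}$ with $\mathbf{D}_a(\nu)\star\mathbf{D}_b(\nu)=\mathbf{D}_c(\nu)\star\delta_d$;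 it is strictly $\star$-stable if one can always take $d=0$. *)

(* Defs.v *)
From HB Require Import structures.
From mathcomp Require Export all_boot all_order all_algebra.
From mathcomp Require Export all_classical all_reals all_analysis measurable_realfun.
From mathcomp Require Export complex.

Set Implicit Arguments.
Unset Strict Implicit.
Unset Printing Implicit Defensive.

Import Order.TTheory GRing.Theory Num.Theory.
Import numFieldNormedType.Exports.

Local Open Scope classical_set_scope.
Local Open Scope ring_scope.
Local Open Scope complex_scope.

Notation prob R := (probability (measurableTypeR R) R).

(* Measures are functions on all subsets of R and only their values on Borel
   sets are meaningful, hence this comparison instead of Leibniz equality. *)
Definition same_law (R : realType) (mu nu : prob R) : Prop :=
  forall A : set (measurableTypeR R), measurable A -> mu A = nu A.

Definition point_mass (R : realType) (x : R) : prob R :=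
  @dirac _ (measurableTypeR R) x R.

Definition nondegenerate (R : realType) (mu : prob R) : Prop :=
  ~ exists x : R, same_law mu (point_mass x).

Definition scale_by (R : realType) (s : R) :
    measurableTypeR R -> measurableTypeR R :=
  fun x => s * x.

Lemma measurable_scale_by (R : realType) (s : R) :
  measurable_fun [set: measurableTypeR R] (scale_by s).
Proof. exact: mulrl_measurable. Qed.

HB.instance Definition _ (R : realType) (s : R) :=
  isMeasurableFun.Build _ _ _ _ (scale_by s) (@measurable_scale_by R s).

Definition dilation (R : realType) (s : R) (mu : prob R) : prob R :=
  distribution mu (scale_by s).

Definition weak_cvg (R : realType) (I : Type) (F : set_system I)
    (m : I -> prob R) (l : prob R) : Prop :=
  forall f : R -> R, continuous f -> bounded_fun f ->
    (\int[m i]_x f x) @[i --> F] --> \int[l]_x f x.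

Definition weakly_continuous (R : realType) (mu : R -> prob R) : Prop :=
  forall t : R, 0 <= t -> weak_cvg (within `[0, +oo[ (nbhs t)) mu (mu t).

(* Each convolution is given by its graph: [X_conv mu nu rho] says that [rho]
   is the convolution of [mu] and [nu]. *)

Definition classical_conv (R : realType) (mu nu rho : prob R) : Prop :=
  forall A : set (measurableTypeR R), measurable A ->
    rho A = pushforward (mu \x nu)%E
      (fun p : measurableTypeR R * measurableTypeR R =>
         (p.1 + p.2 : measurableTypeR R)) A.

(* The integral of a complex-valued function is taken componentwise. *)
Definition cauchy_transform (R : realType) (mu : prob R) (z : R[i]) : R[i] :=
  (\int[mu]_x complex.Re (z - x%:C)^-1) +i*
  (\int[mu]_x complex.Im (z - x%:C)^-1).

Definition recip_cauchy (R : realType) (mu : prob R) (z : R[i]) : R[i] :=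
  (cauchy_transform mu z)^-1.

Definition truncated_cone (R : realType) (alpha beta : R) : set R[i] :=
  [set z | beta < complex.Im z /\ `|complex.Re z| < alpha * complex.Im z].

(* [g] is, on the truncated cone [D], the inverse of [F_mu].  The branch is
   fixed by asking that [g] take its values in some truncated cone on which
   [F_mu] is injective: since [F_mu z ~ z] as [z] tends to infinity in a
   truncated cone, the values of [g] on [D] do not depend on which one. *)
Definition recip_cauchy_inverse (R : realType) (mu : prob R) (D : set R[i])
    (g : R[i] -> R[i]) : Prop :=
  exists alpha beta : R, [/\ 0 < alpha, 0 < beta,
    {in truncated_cone alpha beta &, injective (recip_cauchy mu)} &
    forall z, D z ->
      truncated_cone alpha beta (g z) /\ recip_cauchy mu (g z) = z].

Definition voiculescu_transform (R : realType) (mu : prob R) (D : set R[i])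
    (phi : R[i] -> R[i]) : Prop :=
  exists2 g, recip_cauchy_inverse mu D g & forall z, D z -> phi z = g z - z.

Definition free_conv (R : realType) (mu nu rho : prob R) : Prop :=
  exists alpha beta : R, exists phi_mu phi_nu phi_rho : R[i] -> R[i],
    let D := truncated_cone alpha beta in
    [/\ 0 < alpha /\ 0 < beta,
        voiculescu_transform mu D phi_mu,
        voiculescu_transform nu D phi_nu,
        voiculescu_transform rho D phi_rho &
        forall z, D z -> phi_rho z = phi_mu z + phi_nu z].

Definition eta_transform (R : realType) (mu : prob R) (z : R[i]) : R[i] :=
  1 - z * recip_cauchy mu (z^-1).

Definition boolean_conv (R : realType) (mu nu rho : prob R) : Prop :=
  forall z : R[i], complex.Im z < 0 ->
    eta_transform rho z = eta_transform mu z + eta_transform nu z.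

Inductive convolution := Classical | Free | Boolean.

Definition is_conv (R : realType) (star : convolution) :
    prob R -> prob R -> prob R -> Prop :=
  match star with
  | Classical => @classical_conv R
  | Free => @free_conv R
  | Boolean => @boolean_conv R
  end.

Definition conv_semigroup (R : realType) (star : convolution)
    (mu : R -> prob R) : Prop :=
  forall s t : R, 0 <= s -> 0 <= t -> is_conv star (mu s) (mu t) (mu (s + t)).

(* mu1 * nu1 = mu2 * nu2 *)
Definition same_conv (R : realType) (star : convolution)
    (mu1 nu1 mu2 nu2 : prob R) : Prop :=
  exists2 rho : prob R, is_conv star mu1 nu1 rho & is_conv star mu2 nu2 rho.

Definition stable (R : realType) (star : convolution) (nu : prob R) : Prop :=
  nondegenerate nu /\
  forall a b : R, 0 < a -> 0 < b -> exists c d : R, 0 < c /\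
    same_conv star (dilation a nu) (dilation b nu)
                   (dilation c nu) (point_mass d).

Definition strictly_stable (R : realType) (star : convolution)
    (nu : prob R) : Prop :=
  nondegenerate nu /\
  forall a b : R, 0 < a -> 0 < b -> exists c : R, 0 < c /\
    same_conv star (dilation a nu) (dilation b nu)
                   (dilation c nu) (point_mass 0).

(* Main.v *)
(* Each convolution becomes addition under a transform T: the characteristic
   function (multiplicatively), the Voiculescu transform, or z - F(z).
   Dilations act on transforms by rescaling, and point masses contribute only
   trivial shifts.  If X_t is the transform of the normalized law at time t,
   the semigroup property makes n X_t a dilate of X_(nt) up to a shift; both
   converge to T(nu), so convergence of types gives n T(nu) = l_n . T(nu) up to
   a shift.  Non-degeneracy forces l_n -> oo and l_(n+1) / l_n -> 1, hence the
   ratios l_m / l_q are dense in (0, oo), and since the relation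
   A . T(nu) + B . T(nu) = C . T(nu) is closed, it is solvable in C for all A
   and B.

   Returning from transforms to measures requires the convolution of a dilate
   of nu with a point mass to exist.  In the Boolean case it is the spectral
   measure of a rank-one perturbation of multiplication by the variable in
   L^2(nu), obtained as a limit of finite matrices by Helly's theorem. *)
From HB Require Import structures.
From mathcomp Require Import ring lra spectral sesquilinear.
Require Import Defs.
Set Implicit Arguments.
Unset Strict Implicit.
Unset Printing Implicit Defensive.
Import Order.TTheory GRing.Theory Num.Theory.
Import numFieldNormedType.Exports.
Import Normc.
Local Open Scope classical_set_scope.
Local Open Scope ring_scope.
Local Open Scope complex_scope.

(** * Complex modulus and limits of complex sequences *)

(** The abstract argument runs in one structure of sums and rescalings, whose axioms are verified
    twice: for characteristic functions, and for functions on truncated cones, which serve the free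
    and the Boolean case alike. A proposition [S] under which all shifts must vanish is carried
    along: [S := False] yields stability, [S := True] strict stability.

    The obstacle on the cone side is that a relation between two transforms is known only on some
    cone, which may change with the index of a sequence, so it cannot be passed to a limit as it
    stands. An identity theorem first moves all relations to one cone fixed by tightness. It has to
    apply to functions given by integrals and to their inverses, hence the second-order expansions
    and the tail estimates with explicit constants.

    Limits of types are obtained by bounding the scales away from zero and infinity and extracting a
    convergent subsequence; the abstract argument asks for no more than a cluster point of the
    scales. The resulting self-similarities are rigid: a non-degenerate element equivalent to its
    own dilate by [c] has [c = 1], since otherwise the powers of [c] or of its inverse would tend to
    0 while having a positive cluster point. *)

Section Modulus.
Variable R : realType.
Implicit Types (z w : R[i]) (x : R).

Lemma normcR x : normc x%:C = `|x|.
Proof. by rewrite /= expr0n /= addr0 sqrtr_sqr. Qed.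

Lemma normc_ge0 z : 0 <= normc z.
Proof. by case: z => a b /=; rewrite sqrtr_ge0. Qed.

Lemma sqr_normcE z : normc z ^+ 2 = complex.Re z ^+ 2 + complex.Im z ^+ 2.
Proof. by case: z => a b /=; rewrite sqr_sqrtr ?addr_ge0 ?sqr_ge0. Qed.

Lemma Re_le_normc z : `|complex.Re z| <= normc z.
Proof.
rewrite -(ler_pXn2r (n := 2)) ?nnegrE ?normc_ge0 ?normr_ge0 //.
by rewrite sqr_normcE real_normK ?num_real // lerDl sqr_ge0.
Qed.

Lemma Im_le_normc z : `|complex.Im z| <= normc z.
Proof.
rewrite -(ler_pXn2r (n := 2)) ?nnegrE ?normc_ge0 ?normr_ge0 //.
by rewrite sqr_normcE real_normK ?num_real // lerDr sqr_ge0.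
Qed.

Lemma normc_leD z w : normc (z + w) <= normc z + normc w.
Proof. exact: (@le_normcD R z w). Qed.

Lemma normc_opp z : normc (- z) = normc z.
Proof. exact: (@normcN R z). Qed.

Lemma normc_leB z w : normc (z - w) <= normc z + normc w.
Proof. by rewrite -(normc_opp w) normc_leD. Qed.

Lemma normc_distC z w : normc (z - w) = normc (w - z).
Proof. by rewrite -normc_opp opprB. Qed.

Lemma normc_geB z w : normc z - normc w <= normc (z - w).
Proof. by rewrite lerBlDr (le_trans _ (normc_leD _ _)) // subrK. Qed.

Lemma normc_eq0 z : (normc z == 0) = (z == 0).
Proof. by apply/eqP/eqP => [/eq0_normc//|->]; exact: normc0. Qed.

Lemma normc_gt0 z : (0 < normc z) = (z != 0).
Proof. by rewrite lt_def normc_ge0 andbT normc_eq0. Qed.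

Lemma normcX z n : normc (z ^+ n) = normc z ^+ n.
Proof. by elim: n => [|n IH]; rewrite ?normc1 // !exprS normcM IH. Qed.

Lemma normc_le_ReIm z : normc z <= `|complex.Re z| + `|complex.Im z|.
Proof.
rewrite -(ler_pXn2r (n := 2)) ?nnegrE ?normc_ge0 ?addr_ge0 //.
rewrite sqr_normcE sqrrD !real_normK ?num_real // -addrA lerD2l lerDr.
by rewrite mulrn_wge0 // mulr_ge0.
Qed.

Lemma cReD z w : complex.Re (z + w) = complex.Re z + complex.Re w.
Proof. by case: z; case: w. Qed.
Lemma cImD z w : complex.Im (z + w) = complex.Im z + complex.Im w.
Proof. by case: z; case: w. Qed.
Lemma cReN z : complex.Re (- z) = - complex.Re z.
Proof. by case: z. Qed.
Lemma cImN z : complex.Im (- z) = - complex.Im z.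
Proof. by case: z. Qed.
Lemma cReB z w : complex.Re (z - w) = complex.Re z - complex.Re w.
Proof. by rewrite cReD cReN. Qed.
Lemma cImB z w : complex.Im (z - w) = complex.Im z - complex.Im w.
Proof. by rewrite cImD cImN. Qed.
Lemma cReM z w : complex.Re (z * w) =
  complex.Re z * complex.Re w - complex.Im z * complex.Im w.
Proof. by case: z; case: w. Qed.
Lemma cImM z w : complex.Im (z * w) =
  complex.Re z * complex.Im w + complex.Im z * complex.Re w.
Proof. by case: z; case: w. Qed.
Lemma cReV z : complex.Re z^-1 = complex.Re z / (complex.Re z ^+ 2 + complex.Im z ^+ 2).
Proof. by case: z. Qed.
Lemma cImV z : complex.Im z^-1 = - complex.Im z / (complex.Re z ^+ 2 + complex.Im z ^+ 2).
Proof. by case: z => a b /=; rewrite mulNr. Qed.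
Lemma cReZ x z : complex.Re (x%:C * z) = x * complex.Re z.
Proof. by rewrite cReM /= mul0r subr0. Qed.
Lemma cImZ x z : complex.Im (x%:C * z) = x * complex.Im z.
Proof. by rewrite cImM /= mul0r addr0. Qed.
Lemma realCV x : (x^-1)%:C = (x%:C)^-1 :> R[i].
Proof. by rewrite fmorphV. Qed.
Lemma cReVZ x z : complex.Re (z / x%:C) = complex.Re z / x.
Proof. by rewrite -realCV mulrC cReZ mulrC. Qed.
Lemma cImVZ x z : complex.Im (z / x%:C) = complex.Im z / x.
Proof. by rewrite -realCV mulrC cImZ mulrC. Qed.
Lemma complex_ext z w :
  complex.Re z = complex.Re w -> complex.Im z = complex.Im w -> z = w.
Proof. by case: z w => [a b] [c d] /= -> ->. Qed.

Lemma realC_eq0 x : (x%:C == 0 :> R[i]) = (x == 0).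
Proof. by rewrite fmorph_eq0. Qed.

Lemma Im_neq0 z : complex.Im z != 0 -> z != 0.
Proof. by apply: contraNneq => ->. Qed.
End Modulus.

Section ComplexSequences.
Variable R : realType.
Implicit Types (u v : nat -> R[i]) (l m : R[i]).

Definition ccvg u l := complex.Re (u n) @[n --> \oo] --> complex.Re l /\
  complex.Im (u n) @[n --> \oo] --> complex.Im l.

Lemma ccvg_cst l : ccvg (fun=> l) l.
Proof. by split; exact: cvg_cst. Qed.

Lemma ccvgD u v l m : ccvg u l -> ccvg v m -> ccvg (fun n => u n + v n) (l + m).
Proof.
move=> [ul1 ul2] [vm1 vm2]; split; rewrite ?cReD ?cImD.
- under eq_fun do rewrite cReD; exact: cvgD.
- under eq_fun do rewrite cImD; exact: cvgD.
Qed.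

Lemma ccvgN u l : ccvg u l -> ccvg (fun n => - u n) (- l).
Proof.
move=> [ul1 ul2]; split; rewrite ?cReN ?cImN.
- under eq_fun do rewrite cReN; exact: cvgN.
- under eq_fun do rewrite cImN; exact: cvgN.
Qed.

Lemma ccvgB u v l m : ccvg u l -> ccvg v m -> ccvg (fun n => u n - v n) (l - m).
Proof. by move=> ul /ccvgN; exact: ccvgD. Qed.

Lemma ccvgM u v l m : ccvg u l -> ccvg v m -> ccvg (fun n => u n * v n) (l * m).
Proof.
move=> [ul1 ul2] [vm1 vm2]; split; rewrite ?cReM ?cImM.
- under eq_fun do rewrite cReM; apply: cvgB; exact: cvgM.
- under eq_fun do rewrite cImM; apply: cvgD; exact: cvgM.
Qed.

Lemma ccvgV u l : l != 0 -> ccvg u l -> ccvg (fun n => (u n)^-1) l^-1.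
Proof.
move=> l0 [ul1 ul2].
have d : (complex.Re (u n) ^+ 2 + complex.Im (u n) ^+ 2)^-1 @[n --> \oo]
    --> (complex.Re l ^+ 2 + complex.Im l ^+ 2)^-1.
  apply: cvgV; first by rewrite -sqr_normcE sqrf_eq0 normc_eq0.
  by apply: cvgD; under eq_fun do rewrite expr2; rewrite expr2; exact: cvgM.
split; rewrite ?cReV ?cImV.
- under eq_fun do rewrite cReV; exact: cvgM.
- under eq_fun do rewrite cImV; apply: cvgM => //; exact: cvgN.
Qed.

Lemma ccvgR (a : nat -> R) (b : R) : a n @[n --> \oo] --> b -> ccvg (fun n => (a n)%:C) b%:C.
Proof. by move=> ab; split => //=; exact: cvg_cst. Qed.

Lemma ccvg_unique u l m : ccvg u l -> ccvg u m -> l = m.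
Proof.
move=> [ul1 ul2] [um1 um2]; apply: complex_ext.
- exact: (cvg_unique _ ul1 um1).
- exact: (cvg_unique _ ul2 um2).
Qed.

Lemma ccvg_eq u v l : (\forall n \near \oo, u n = v n) -> ccvg u l -> ccvg v l.
Proof.
move=> uv [ul1 ul2]; split.
- apply: cvg_trans ul1; apply: near_eq_cvg.
  by apply: filterS uv => n ->.
- apply: cvg_trans ul2; apply: near_eq_cvg.
  by apply: filterS uv => n ->.
Qed.

Lemma cvg_normc u l : ccvg u l -> normc (u n) @[n --> \oo] --> normc l.
Proof.
move=> [ul1 ul2].
have -> : normc l = Num.sqrt (complex.Re l ^+ 2 + complex.Im l ^+ 2) by case: l {ul1 ul2}.
have -> : (fun n => normc (u n)) =
  fun n => Num.sqrt (complex.Re (u n) ^+ 2 + complex.Im (u n) ^+ 2).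
  by apply/funext => n; case: (u n).
apply: continuous_cvg; first exact: sqrt_continuous.
by apply: cvgD; under eq_fun do rewrite expr2; rewrite expr2; exact: cvgM.
Qed.

Lemma ccvg_normc0 u l : normc (u n - l) @[n --> \oo] --> 0 -> ccvg u l.
Proof.
move=> ul.
have H (p : R[i] -> R) : (forall z w, p (z - w) = p z - p w) ->
    (forall z, `|p z| <= normc z) -> p (u n) @[n --> \oo] --> p l.
  move=> pB pn; apply/subr_cvg0; apply: norm_cvg0.
  apply: (squeeze_cvgr _ (cvg_cst 0) ul).
  by apply: nearW => n; rewrite normr_ge0 /= -pB pn.
by split; apply: H => *; rewrite ?cReB ?cImB ?Re_le_normc ?Im_le_normc.
Qed.

Lemma ccvg_squeeze u l (a : nat -> R) :
  (\forall n \near \oo, normc (u n - l) <= a n) ->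
  a n @[n --> \oo] --> 0 -> ccvg u l.
Proof.
move=> ua a0; apply: ccvg_normc0; apply: (squeeze_cvgr _ (cvg_cst 0) a0).
by apply: filterS ua => n ->; rewrite normc_ge0.
Qed.

Lemma ccvg_dist u l : ccvg u l -> normc (u n - l) @[n --> \oo] --> 0.
Proof.
move=> ul; rewrite -[0](@normc0 R) -(subrr l).
by apply: cvg_normc; apply: ccvgB => //; exact: ccvg_cst.
Qed.

Lemma ccvg_sub u l (f : nat -> nat) :
  (f n @[n --> \oo] --> \oo) -> ccvg u l -> ccvg (fun n => u (f n)) l.
Proof.
move=> foo [ul1 ul2]; split.
- by apply: (cvg_comp f (fun n => complex.Re (u n))); [exact: foo|exact: ul1].
- by apply: (cvg_comp f (fun n => complex.Im (u n))); [exact: foo|exact: ul2].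
Qed.

End ComplexSequences.

(** * Integrals of bounded continuous functions *)
Section BoundedContinuous.
Variable R : realType.
Implicit Types (f g : R -> R) (mu : prob R).

Definition cb f := continuous f /\ exists M, forall x, `|f x| <= M.

Lemma cb_cst c : cb (fun=> c).
Proof. by split; [move=> x; exact: cvg_cst|exists `|c|]. Qed.

Lemma cbD f g : cb f -> cb g -> cb (fun x => f x + g x).
Proof.
move=> [cf [M fM]] [cg [N gN]]; split.
  by move=> x; apply: cvgD; [exact: cf|exact: cg].
by exists (M + N) => x; rewrite (le_trans (ler_normD _ _)) // lerD.
Qed.

Lemma cbM f g : cb f -> cb g -> cb (fun x => f x * g x).
Proof.
move=> [cf [M fM]] [cg [N gN]]; split.
  by move=> x; apply: cvgM; [exact: cf|exact: cg].
by exists (M * N) => x; rewrite normrM ler_pM.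
Qed.

Lemma cbN f : cb f -> cb (fun x => - f x).
Proof.
move=> [cf [M fM]]; split; first by move=> x; apply: cvgN; exact: cf.
by exists M => x; rewrite normrN.
Qed.

Lemma cbB f g : cb f -> cb g -> cb (fun x => f x - g x).
Proof. by move=> cf /cbN; exact: cbD. Qed.

Lemma cbZ c f : cb f -> cb (fun x => c * f x).
Proof. exact: cbM (cb_cst c). Qed.

Lemma cb_bounded f : cb f -> bounded_fun f.
Proof.
move=> [_ [M fM]]; exists M; split=> [|y My x _]; first exact: num_real.
exact: le_trans (ltW My).
Qed.

Lemma cb_measurable f : cb f -> measurable_fun [set: measurableTypeR R] f.
Proof. by move=> [cf _]; exact: continuous_measurable_fun. Qed.

Lemma bounded_integrable mu (f : measurableTypeR R -> R) M :
  measurable_fun setT f -> (forall x, `|f x| <= M) ->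
  mu.-integrable setT (EFin \o f).
Proof.
move=> mf fM; apply: measurable_bounded_integrable => //.
  by rewrite (le_lt_trans (probability_le1 _ _)) // ltry.
exists M; split=> [|y My x _]; first exact: num_real.
exact: le_trans (ltW My).
Qed.

Lemma cb_integrable mu f : cb f -> mu.-integrable setT (EFin \o f).
Proof.
by move=> cf; case: (cf) => _ [M fM]; apply: bounded_integrable (cb_measurable cf) fM.
Qed.

Lemma EcD mu f g : cb f -> cb g ->
  \int[mu]_x (f x + g x) = \int[mu]_x f x + \int[mu]_x g x.
Proof. by move=> cf cg; rewrite RintegralD //; exact: cb_integrable. Qed.

Lemma EcB mu f g : cb f -> cb g ->
  \int[mu]_x (f x - g x) = \int[mu]_x f x - \int[mu]_x g x.
Proof. by move=> cf cg; rewrite RintegralB //; exact: cb_integrable. Qed.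

Lemma EcZ mu c f : cb f -> \int[mu]_x (c * f x) = c * \int[mu]_x f x.
Proof. by move=> cf; rewrite RintegralZl //; exact: cb_integrable. Qed.

Lemma Ec_cst mu c : \int[mu]_x c = c :> R.
Proof.
rewrite Rintegral_cst // -[RHS]mulr1; congr (_ * _).
exact: (congr1 fine (probability_setT mu)).
Qed.

Lemma Ec_le mu f g : cb f -> cb g -> (forall x, f x <= g x) ->
  \int[mu]_x f x <= \int[mu]_x g x.
Proof. by move=> cf cg fg; apply: le_Rintegral => //; exact: cb_integrable. Qed.

Lemma Ec_ge0 mu f : (forall x, 0 <= f x) -> 0 <= \int[mu]_x f x.
Proof. by move=> f0; apply: Rintegral_ge0. Qed.

(** A zero integral would make [f] vanish off a null set; as [f] is positive everywhere, that null
    set would be the whole line, which has mass 1. *)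
Lemma Ec_gt0 mu f : cb f -> (forall x, 0 < f x) -> 0 < \int[mu]_x f x.
Proof.
move=> cf f0; rewrite lt_def Ec_ge0 ?andbT => [|x]; last exact: ltW.
apply/eqP => If0.
have : (\int[mu]_x `|(f x)%:E| = 0)%E.
  under eq_integral => x _ do rewrite gee0_abs ?lee_fin ?ltW //.
  rewrite -[LHS]fineK; first by rewrite -/(Rintegral mu setT f) If0.
  by apply: integrable_fin_num => //; exact: cb_integrable.
have mf : measurable_fun [set: measurableTypeR R] (EFin \o f).
  by apply/measurable_EFinP; exact: cb_measurable.
move/(ae_eq_integral_abs mu measurableT mf) => [N [mN N0 fN]].
have NT : N = setT.
  apply/seteqP; split => // x _; apply: fN => /=; apply/not_implyP; split => //.
  by case=> fx; have := f0 x; rewrite fx ltxx.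
by have := probability_setT mu; rewrite -NT N0 => /eqP; rewrite eq_sym onee_eq0.
Qed.
Lemma Ec_dct mu (f_ : nat -> R -> R) f M :
  (forall n, measurable_fun [set: measurableTypeR R] (f_ n)) ->
  (forall n x, `|f_ n x| <= M) ->
  (forall x, f_ n x @[n --> \oo] --> f x) ->
  \int[mu]_x f_ n x @[n --> \oo] --> \int[mu]_x f x.
Proof.
move=> mf fM ff.
have fM' x : `|f x| <= M.
  by apply: (ler_cvg_to (cvg_norm (ff x)) (cvg_cst M)); exact: nearW.
have mf' : measurable_fun [set: measurableTypeR R] f.
  by apply: (measurable_fun_cvg (h := f_)).
have H := @dominated_cvg _ _ _ mu setT measurableT (fun n => EFin \o f_ n)
  (EFin \o f) (EFin \o cst M).
apply: fine_cvg.
rewrite fineK; last first.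
  apply: integrable_fin_num => //; exact: bounded_integrable mf' fM'.
apply: H => //.
- by move=> n; apply/measurable_EFinP.
- by move=> x _; apply: cvg_EFin; [exact: nearW|exact: ff].
- exact: finite_measure_integrable_cst.
- by move=> n x _; rewrite lee_fin.
Qed.

Lemma Ec_dilation mu s f : cb f ->
  \int[dilation s mu]_x f x = \int[mu]_x f (s * x).
Proof.
move=> cf; rewrite /Rintegral; congr fine.
rewrite integral_distribution //.
  by apply/measurable_EFinP; exact: cb_measurable.
apply: (@cb_integrable mu (fun x => f (s * x))).
case: cf => cf [M fM]; split; last by exists M.
move=> x; apply: continuous_comp; last exact: cf.
by apply: cvgM; [exact: cvg_cst|exact: cvg_id].
Qed.

Lemma Ec_point_mass a f : cb f -> \int[point_mass a]_x f x = f a.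
Proof.
move=> cf; rewrite /Rintegral integral_dirac // ?diracT ?mul1e //.
by apply/measurable_EFinP; exact: cb_measurable.
Qed.
End BoundedContinuous.

(** * Integrals of bounded continuous complex functions *)

Section ComplexIntegral.
Variable R : realType.
Implicit Types (f g : R -> R[i]) (mu : prob R).

Definition ccb f := cb (fun x => complex.Re (f x)) /\ cb (fun x => complex.Im (f x)).

Definition cE mu f : R[i] :=
  (\int[mu]_x complex.Re (f x)) +i* (\int[mu]_x complex.Im (f x)).

Lemma ccb_cst c : ccb (fun=> c).
Proof. by split; exact: cb_cst. Qed.

Lemma ccbD f g : ccb f -> ccb g -> ccb (fun x => f x + g x).
Proof.
move=> [f1 f2] [g1 g2]; split.
- by under eq_fun do rewrite cReD; exact: cbD.
- by under eq_fun do rewrite cImD; exact: cbD.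
Qed.

Lemma ccbM f g : ccb f -> ccb g -> ccb (fun x => f x * g x).
Proof.
move=> [f1 f2] [g1 g2]; split.
- by under eq_fun do rewrite cReM; apply: cbB; exact: cbM.
- by under eq_fun do rewrite cImM; apply: cbD; exact: cbM.
Qed.

Lemma ccbB f g : ccb f -> ccb g -> ccb (fun x => f x - g x).
Proof.
move=> [f1 f2] [g1 g2]; split.
- by under eq_fun do rewrite cReB; exact: cbB.
- by under eq_fun do rewrite cImB; exact: cbB.
Qed.

Lemma ccbZ c f : ccb f -> ccb (fun x => c * f x).
Proof. exact: ccbM (ccb_cst c). Qed.

Lemma cb_sqr_normc f : ccb f -> cb (fun x => normc (f x) ^+ 2).
Proof.
move=> [f1 f2]; under eq_fun do rewrite sqr_normcE !expr2.
by apply: cbD; exact: cbM.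
Qed.

Lemma eq_cE mu f g : f =1 g -> cE mu f = cE mu g.
Proof. by move=> /funext ->. Qed.

Lemma cEB mu f g : ccb f -> ccb g -> cE mu (fun x => f x - g x) = cE mu f - cE mu g.
Proof.
move=> [f1 f2] [g1 g2]; apply: complex_ext; rewrite ?cReB ?cImB /=.
- by under eq_Rintegral do rewrite cReB; rewrite EcB.
- by under eq_Rintegral do rewrite cImB; rewrite EcB.
Qed.

Lemma cEZ mu c f : ccb f -> cE mu (fun x => c * f x) = c * cE mu f.
Proof.
move=> [f1 f2]; apply: complex_ext; rewrite ?cReM ?cImM /=.
- under eq_Rintegral do rewrite cReM.
  by rewrite EcB ?EcZ //; exact: cbZ.
- under eq_Rintegral do rewrite cImM.
  by rewrite EcD ?EcZ //; exact: cbZ.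
Qed.

Lemma cE_cst mu c : cE mu (fun=> c) = c.
Proof. by apply: complex_ext => /=; rewrite Ec_cst. Qed.

(* Rotating by the conjugate of the integral reduces to real parts. *)
Lemma normc_cE_le mu f (h : R -> R) : ccb f -> cb h ->
  (forall x, normc (f x) <= h x) -> normc (cE mu f) <= \int[mu]_x h x.
Proof.
move=> cf ch fh; set I := cE mu f.
have h0 x : 0 <= h x := le_trans (normc_ge0 _) (fh x).
have [I0|I0] := eqVneq I 0; first by rewrite I0 normc0 Ec_ge0.
have nI : 0 < normc I by rewrite normc_gt0.
have cfI := ccbZ (I^*) cf.
have nJ : normc (I^*) = normc I by case: (I) => a b /=; rewrite sqrrN.
have : normc I ^+ 2 = \int[mu]_x complex.Re (I^* * f x).
  transitivity (complex.Re (I^* * I)).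
    by rewrite sqr_normcE cReM; case: (I) => a b /=; ring.
  by rewrite /I -(cEZ _ _ cf) /=.
move=> eI; rewrite -(ler_pM2l nI) -expr2 eI -EcZ //.
apply: Ec_le; [exact: cfI.1|exact: cbZ|] => x.
by rewrite (le_trans (ler_norm _)) // (le_trans (Re_le_normc _)) // normcM nJ ler_wpM2l // ltW.
Qed.

Lemma normc_cE_bound mu f M : ccb f -> (forall x, normc (f x) <= M) -> normc (cE mu f) <= M.
Proof.
move=> cf fM; rewrite -(Ec_cst mu M); apply: normc_cE_le => //; exact: cb_cst.
Qed.

Lemma cE_dilation mu s f : ccb f -> cE (dilation s mu) f = cE mu (fun x => f (s * x)).
Proof. by move=> [f1 f2]; apply: complex_ext => /=; rewrite Ec_dilation. Qed.

Lemma cE_point_mass a f : ccb f -> cE (point_mass a) f = f a.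
Proof. by move=> [f1 f2]; apply: complex_ext => /=; rewrite Ec_point_mass. Qed.

Lemma ccb_resolvent (z : R[i]) : complex.Im z != 0 -> ccb (fun x => (z - x%:C)^-1).
Proof.
move=> z0.
have Imz x : complex.Im (z - x%:C) = complex.Im z by rewrite cImB subr0.
have den x : (complex.Re (z - x%:C) ^+ 2 + complex.Im (z - x%:C) ^+ 2) != 0.
  by rewrite -sqr_normcE sqrf_eq0 normc_eq0 Im_neq0 ?Imz.
have contRe : continuous (fun x : R => complex.Re (z - x%:C)).
  move=> x; under eq_fun do rewrite cReB /=.
  by apply: cvgB; [exact: cvg_cst|exact: cvg_id].
have cden : continuous (fun x : R => (complex.Re (z - x%:C) ^+ 2 + complex.Im (z - x%:C) ^+ 2)^-1).
  move=> x; apply: cvgV; first exact: den.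
  have -> : (fun y : R => complex.Re (z - y%:C) ^+ 2 + complex.Im (z - y%:C) ^+ 2) =
    (fun y : R => complex.Re (z - y%:C) * complex.Re (z - y%:C) + complex.Im z ^+ 2).
    by apply/funext => y; rewrite Imz expr2.
  rewrite Imz (expr2 (complex.Re _)).
  exact: (cvgD (cvgM (contRe x) (contRe x)) (cvg_cst _)).
have bd x : normc (z - x%:C)^-1 <= `|complex.Im z|^-1.
  by rewrite normcV lef_pV2 ?posrE ?normc_gt0 ?normr_gt0 // ?Im_neq0 ?Imz // -{1}(Imz x) Im_le_normc.
split; split.
- move=> x; under eq_fun do rewrite cReV.
  exact: (cvgM (contRe x) (cden x)).
- by exists `|complex.Im z|^-1 => x; rewrite (le_trans (Re_le_normc _)).
- have -> : (fun x : R => complex.Im (z - x%:C)^-1) = (fun x : R => - complex.Im z /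
    (complex.Re (z - x%:C) ^+ 2 + complex.Im (z - x%:C) ^+ 2)).
    by apply/funext => x; rewrite cImV; congr (- _ / _); rewrite Imz.
  by move=> x; exact: (cvgM (cvg_cst _) (cden x)).
- by exists `|complex.Im z|^-1 => x; rewrite (le_trans (Im_le_normc _)).
Qed.
End ComplexIntegral.

Section WeakSequences.
Variable R : realType.
Implicit Types (m : nat -> prob R) (l : prob R).

Definition wcvg m l := forall f, cb f ->
  \int[m n]_x f x @[n --> \oo] --> \int[l]_x f x.

Lemma weak_cvg_seq (F : set_system R) (rho : R -> prob R) l (t : nat -> R) :
  weak_cvg F rho l -> (t n @[n --> \oo] --> F) -> wcvg (rho \o t) l.
Proof.
move=> rl tF f cf; have := rl f cf.1 (cb_bounded cf).
by move=> H; apply: (cvg_comp t (fun i => \int[rho i]_x f x)); [exact: tF|exact: H].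
Qed.

Lemma wcvg_cst l : wcvg (fun=> l) l.
Proof. by move=> f _; exact: cvg_cst. Qed.

Lemma wcvg_cE m l (f : R -> R[i]) : wcvg m l -> ccb f -> ccvg (fun n => cE (m n) f) (cE l f).
Proof. by move=> ml [f1 f2]; split => /=; exact: ml. Qed.
End WeakSequences.

(** * Tightness through a continuous tail functional *)

Section Tail.
Variable R : realType.
Implicit Types (mu : prob R) (b s : R).

(** A continuous majorant of the indicator of [b <= |x|]. Being a bounded continuous test function,
    it reduces tightness of a weakly convergent sequence to convergence of integrals; up to a factor
    it is also the bound that [x / (z - x)] obeys for [z] at height [b] in a cone. *)
Definition trunc b (x : R) : R := Num.min 1 (`|x| / b).

Definition tail mu b : R := \int[mu]_x trunc b x.

Lemma trunc_ge0 b x : 0 < b -> 0 <= trunc b x.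
Proof. by move=> b0; rewrite le_min ler01 /= divr_ge0 // ltW. Qed.

Lemma cb_trunc b : 0 < b -> cb (trunc b).
Proof.
move=> b0; split; last first.
  by exists 1 => x; rewrite ger0_norm ?trunc_ge0 // ge_min lexx.
move=> x; apply: (@continuous_min _ _ (fun=> 1) (fun x => `|x| / b)).
  exact: cvg_cst.
by apply: cvgM; [exact: norm_continuous|exact: cvg_cst].
Qed.

Lemma tail_ge0 mu b : 0 < b -> 0 <= tail mu b.
Proof. by move=> b0; apply: Ec_ge0 => x; exact: trunc_ge0. Qed.

Lemma tail_antimono mu b c : 0 < b -> b <= c -> tail mu c <= tail mu b.
Proof.
move=> b0 bc; have c0 := lt_le_trans b0 bc.
apply: Ec_le; [exact: cb_trunc|exact: cb_trunc|] => x.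
rewrite le_min ge_min lexx /= /trunc ge_min; apply/orP; right.
by rewrite ler_wpM2l // lef_pV2 ?posrE.
Qed.

Lemma tail_cvg0 mu : tail mu n.+1%:R @[n --> \oo] --> 0.
Proof.
rewrite -(Ec_cst mu 0); apply: (@Ec_dct _ _ (fun n => trunc n.+1%:R) _ 1).
- by move=> n; apply: cb_measurable; exact: cb_trunc.
- by move=> n x; rewrite ger0_norm ?trunc_ge0 // ge_min lexx.
- move=> x; apply: (squeeze_cvgr _ (cvg_cst 0) (_ : `|x| / n.+1%:R @[n --> \oo] --> 0)).
    by apply: nearW => n; rewrite trunc_ge0 // /trunc ge_min lexx orbT.
  by rewrite -(mulr0 `|x|); apply: cvgM; [exact: cvg_cst|exact: cvg_harmonic].
Qed.

Lemma tail_small mu eps : 0 < eps -> exists2 b, 0 < b & tail mu b < eps.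
Proof.
move=> e0; have /cvgrPdist_lt/(_ _ e0) [N _ /(_ N (leqnn N))] := tail_cvg0 mu.
by rewrite /= sub0r normrN ger0_norm ?tail_ge0 // => H; exists N.+1%:R.
Qed.

Lemma tail_dilation s mu b : 0 < s -> 0 < b -> tail (dilation s mu) b = tail mu (b / s).
Proof.
move=> s0 b0; rewrite /tail Ec_dilation; last exact: cb_trunc.
apply: eq_Rintegral => x _; congr (Num.min _ _).
by rewrite normrM gtr0_norm // invfM invrK; ring.
Qed.

(** Tightness: a cutoff chosen for the limit serves all large indices. *)
Lemma tail_wcvg (m : nat -> prob R) l b eps : 0 < b -> wcvg m l -> tail l b < eps ->
  \forall n \near \oo, tail (m n) b < eps.
Proof.
by move=> b0 /(_ _ (cb_trunc b0)) ml leps; exact: (cvgr_lt _ ml _ leps).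
Qed.
End Tail.

(** * Limits of types and stability in a linearized semigroup *)
Section Domains.
Variable R : realType.
Variables (M : Type) (add : M -> M -> M) (sc : R -> M -> M).
Variables (eqv : M -> M -> Prop) (cv : (nat -> M) -> M -> Prop).
Variable nondeg : M -> Prop.

Local Notation "x ~~ y" := (eqv x y) (at level 70).

(* [nm n x] is the sum of [n.+1] copies of [x]. *)
Fixpoint nm n x := if n is k.+1 then add (nm k x) x else x.

(** Here [eqv] is equality up to a shift. The hypothesis [cv (fun=> x) x] is not vacuous, since [cv]
    includes regularity of the sequence; it says that [x] itself is regular. [dom_types] is the
    convergence of types, in the weak form of one cluster point of the scales, and [dom_growth] says
    that multiples of a non-degenerate element outgrow every bounded range of scales. *)
Record conv_domain : Prop := ConvDomain {
  dom_refl : forall x, x ~~ x;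
  dom_sym : forall x y, x ~~ y -> y ~~ x;
  dom_trans : forall x y z, x ~~ y -> y ~~ z -> x ~~ z;
  dom_add : forall x y x' y', x ~~ x' -> y ~~ y' -> add x y ~~ add x' y';
  dom_sc : forall (l : R) x y, 0 < l -> x ~~ y -> sc l x ~~ sc l y;
  dom_addC : forall x y, add x y ~~ add y x;
  dom_addA : forall x y z, add x (add y z) ~~ add (add x y) z;
  dom_sc1 : forall x, sc 1 x ~~ x;
  dom_scA : forall (l m : R) x, 0 < l -> 0 < m -> sc l (sc m x) ~~ sc (l * m) x;
  dom_scD : forall (l : R) x y, 0 < l -> sc l (add x y) ~~ add (sc l x) (sc l y);
  dom_cvgD : forall X Y x y, cv X x -> cv Y y ->
    cv (fun n => add (X n) (Y n)) (add x y);
  dom_cvgZ : forall (A : nat -> R) (a : R) x, (forall n, 0 < A n) -> 0 < a ->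
    A n @[n --> \oo] --> a -> cv (fun=> x) x -> cv (fun n => sc (A n) x) (sc a x);
  dom_cvg_add0 : forall (A : nat -> R) x, (forall n, 0 < A n) ->
    A n @[n --> \oo] --> 0 -> cv (fun=> x) x ->
    cv (fun n => add x (sc (A n) x)) x;
  dom_nondegD : forall x y, nondeg x -> nondeg y -> nondeg (add x y);
  dom_nondegZ : forall (l : R) x, 0 < l -> nondeg x -> nondeg (sc l x);
  dom_types : forall X Y x y (C : nat -> R), cv X x -> cv Y y ->
    nondeg x -> nondeg y -> (forall n, 0 < C n) ->
    (forall n, X n ~~ sc (C n) (Y n)) ->
    exists2 c : R, 0 < c & x ~~ sc c y /\
      forall (eps : R) (N : nat), 0 < eps -> exists2 n, (N <= n)%N & `|C n - c| < eps;
  dom_growth : forall x (L : R), cv (fun=> x) x -> nondeg x -> 0 < L ->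
    exists N, forall n (l : R), (N <= n)%N -> 0 < l <= L -> ~ nm n x ~~ sc l x
}.
End Domains.

Section StableDomains.
Variable R : realType.
Variables (M : Type) (add : M -> M -> M) (sc : R -> M -> M).
Variables (eqv : M -> M -> Prop) (cv : (nat -> M) -> M -> Prop).
Variable nondeg : M -> Prop.
Hypothesis dom : conv_domain add sc eqv cv nondeg.
Local Notation "x ~~ y" := (eqv x y) (at level 70).
Local Notation "x ++ y" := (add x y).
Local Notation nm := (nm add).

Let refl := dom_refl dom.
Let sym := dom_sym dom.
Let trans := dom_trans dom.

Lemma nm_eqv n x y : x ~~ y -> nm n x ~~ nm n y.
Proof. by move=> xy; elim: n => //= n IH; apply: (dom_add dom) => //; exact: refl. Qed.

Lemma sc_nm n l x : 0 < l -> sc l (nm n x) ~~ nm n (sc l x).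
Proof.
move=> l0; elim: n => //= n IH.
by apply: trans (dom_scD dom _ _ l0) _; apply: (dom_add dom) => //; exact: refl.
Qed.

Lemma nm_add n m x : nm n x ++ nm m x ~~ nm (n + m).+1 x.
Proof.
elim: m => [|m IH]; first by rewrite addn0.
rewrite addnS /=; apply: trans (dom_addA dom _ _ _) _.
exact: (dom_add dom).
Qed.

Lemma cvg_nm n X x : cv X x -> cv (fun k => nm n (X k)) (nm n x).
Proof. by move=> Xx; elim: n => //= n IH; exact: (dom_cvgD dom). Qed.

Lemma nondeg_nm n x : nondeg x -> nondeg (nm n x).
Proof. by move=> xx; elim: n => //= n IH; exact: (dom_nondegD dom). Qed.

Section Element.
Variable x : M.
Hypotheses (cx : cv (fun=> x) x) (nx : nondeg x).
Hypothesis limits : forall n, exists2 l : R, 0 < l & nm n x ~~ sc l x.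

(* A scale [c < 1] fixing [x] could be iterated, and its powers would have a
   positive cluster point. *)
Let sc_lt1 c : 0 < c -> c < 1 -> ~ (x ~~ sc c x).
Proof.
move=> c0 c1 xc.
have xcn n : x ~~ sc (c ^+ n) x.
  elim: n => [|n IH]; first by rewrite expr0; exact: sym (dom_sc1 dom _).
  apply: trans xc _; apply: trans (dom_sc dom c0 IH) _.
  by apply: trans (dom_scA dom _ c0 (exprn_gt0 _ c0)) _; rewrite -exprS.
have cn0 n : 0 < c ^+ n by exact: exprn_gt0.
have [d d0 [_ clus]] := dom_types dom cx cx nx nx cn0 xcn.
have : c ^+ n @[n --> \oo] --> 0 by apply: cvg_expr; rewrite gtr0_norm.
move=> /cvgrPdist_lt /(_ (d / 2)); rewrite divr_gt0 // => /(_ isT) [N _ HN].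
have d2 : 0 < d / 2 by rewrite divr_gt0.
have [n Nn] := clus _ N d2.
have := HN n Nn; rewrite /= sub0r normrN gtr0_norm // ltr_norml => H.
by move=> /andP[H1 _]; lra.
Qed.

Lemma sc_inj1 c : 0 < c -> x ~~ sc c x -> c = 1.
Proof.
move=> c0 xc; have [c1|c1|//] := ltgtP c 1; first by case: (sc_lt1 c0 c1).
have ci0 : 0 < c^-1 by rewrite invr_gt0.
case: (sc_lt1 ci0); first by rewrite invf_lt1.
apply: sym; apply: trans (dom_sc dom ci0 xc) _.
apply: trans (dom_scA dom _ ci0 c0) _.
by rewrite mulVf ?gt_eqF //; exact: (dom_sc1 dom).
Qed.

Let lam n := projT1 (cid2 (limits n)).
Let lam0 n : 0 < lam n. Proof. by rewrite /lam; case: cid2. Qed.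
Let lamP n : nm n x ~~ sc (lam n) x. Proof. by rewrite /lam; case: cid2. Qed.

Let lam_infty L : exists N, forall n, (N <= n)%N -> L < lam n.
Proof.
have L0 : 0 < Num.max L 1 by rewrite lt_max ltr01 orbT.
have [N HN] := dom_growth dom cx nx L0.
exists N => n Nn; rewrite ltNge; apply/negP => lL.
by apply: (HN n (lam n) Nn _ (lamP n)); rewrite lam0 le_max lL.
Qed.

(** Rescaling [nm n.+1 x = nm n x ++ x] by the inverse of [lam n] gives [x ++ sc (lam n)^-1 x ~~ sc
    (lam n.+1 / lam n) x]. The left side tends to [x], so ratios staying away from 1 along indices
    tending to infinity would have a cluster point [c] with [x ~~ sc c x], and [sc_inj1] forces
    [c = 1]. *)
Let ratio eps : 0 < eps -> exists N, forall n, (N <= n)%N -> `|lam n.+1 / lam n - 1| < eps.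
Proof.
move=> e0; apply: contrapT => /forallNP H.
have {}H N : exists2 n, (N <= n)%N & eps <= `|lam n.+1 / lam n - 1|.
  have /existsNP[n /not_implyP[Nn /negP]] := H N.
  by rewrite -leNgt => Hn; exists n.
pose f N := projT1 (cid2 (H N)).
have fN N : (N <= f N)%N by rewrite /f; case: cid2.
have fe N : eps <= `|lam (f N).+1 / lam (f N) - 1| by rewrite /f; case: cid2.
pose A N := (lam (f N))^-1.
have A0 N : 0 < A N by rewrite invr_gt0.
have Ac : A n @[n --> \oo] --> 0.
  apply/cvgrPdist_lt => e e1; have [N HN] := lam_infty e^-1.
  exists N => // n /= Nn; rewrite sub0r normrN gtr0_norm // /A.
  by rewrite invf_plt ?posrE //; apply: HN; exact: leq_trans (fN n).
have XX := dom_cvg_add0 dom A0 Ac cx.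
pose C N := lam (f N).+1 / lam (f N).
have C0 N : 0 < C N by rewrite divr_gt0.
have XC N : x ++ sc (A N) x ~~ sc (C N) x.
  have /sym E1 := dom_sc dom (A0 N) (lamP (f N).+1).
  rewrite /C mulrC; apply: sym.
  apply: trans (sym (dom_scA dom _ (A0 N) (lam0 _))) _.
  apply: trans E1 _ => /=.
  apply: trans (dom_scD dom _ _ (A0 N)) _.
  apply: (dom_add dom); last exact: refl.
  apply: trans (dom_sc dom (A0 N) (lamP (f N))) _.
  apply: trans (dom_scA dom _ (A0 N) (lam0 _)) _.
  by rewrite mulVf ?gt_eqF //; exact: (dom_sc1 dom).
have [c c0 [xc clus]] := dom_types dom XX cx nx nx C0 XC.
have c1 := sc_inj1 c0 xc; rewrite c1 in clus.
have [n _ Hn] := clus _ 0 e0.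
by have := fe n; rewrite leNgt Hn.
Qed.

(** As [lam] need not be monotone, the index is the predecessor of the first one from [m0] on where
    [lam] exceeds [lam q * a]; the ratio bound keeps the jump there below [eps * lam q]. The claim
    covers all large [q] so that two numbers can be approximated with the same denominator. *)
Let approx a eps : 0 < a -> 0 < eps ->
  exists N, forall q, (N <= q)%N -> exists m, `|lam m / lam q - a| < eps.
Proof.
move=> a0 e0; pose d := Num.min 1 (eps / (2 * a)).
have d0 : 0 < d by rewrite lt_min ltr01 divr_gt0 // mulr_gt0.
have [m0 Hm0] := ratio d0.
have [N HN] := lam_infty (lam m0 / a).
exists N => q /HN; rewrite ltr_pdivrMr // => Hq.
have [N' HN'] := lam_infty (lam q * a).
have ex : exists n, (m0 <= n)%N && (lam q * a < lam n).
  by exists (maxn m0 N'); rewrite leq_maxl /= HN' // leq_maxr.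
case: (ex_minnP ex) => n /andP[m0n an] min_n.
have nm0 : n != m0 by apply: contraTneq an => ->; rewrite -leNgt ltW.
have {nm0 m0n} : (m0 < n)%N by rewrite ltn_neqAle eq_sym nm0.
case: n an min_n => // n an min_n; rewrite ltnS => m0n.
exists n.
have an' : lam n <= lam q * a.
  by rewrite leNgt; apply/negP => Hn; have := min_n n; rewrite m0n Hn ltnn => /(_ isT).
have := Hm0 n m0n; rewrite ltr_norml => /andP[_].
rewrite ltrBlDr ltr_pdivrMr // => H.
have dle : d * a <= eps / 2.
  rewrite (@le_trans _ _ (eps / (2 * a) * a)) //.
    by rewrite ler_wpM2r ?(ltW a0) // ge_min lexx orbT.
  by rewrite invfM mulrA -mulrA mulVf ?gt_eqF ?mulr1.
have lq := lam0 q; have ln := lam0 n.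
have -> : lam n / lam q - a = (lam n - lam q * a) / lam q by field; rewrite gt_eqF.
rewrite normrM normfV (gtr0_norm lq) ltr_pdivrMr // ler0_norm ?subr_le0 //.
rewrite opprB.
have : d * lam n <= eps / 2 * lam q.
  rewrite (le_trans (ler_wpM2l (ltW d0) an')) // mulrCA mulrC.
  by rewrite ler_wpM2r // ltW.
by move=> *; nra.
Qed.

(** With a common denominator the sum of the dilates of [x] by [lam m1 / lam q] and [lam m2 / lam q]
    is again a dilate of [x], by [nm_add]. The two scales are made to tend to [A] and [B], and [C]
    is a cluster point of the resulting scales. *)
Theorem domain_stable A B : 0 < A -> 0 < B ->
  exists2 C, 0 < C & sc A x ++ sc B x ~~ sc C x.
Proof.
move=> A0 B0.
have H k : exists mmq : nat * nat * nat,
    `|lam mmq.1.1 / lam mmq.2 - A| < k.+1%:R^-1 /\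
    `|lam mmq.1.2 / lam mmq.2 - B| < k.+1%:R^-1.
  have k0 : 0 < k.+1%:R^-1 :> R by rewrite invr_gt0.
  have [N1 H1] := approx A0 k0; have [N2 H2] := approx B0 k0.
  have [m1 Hm1] := H1 (maxn N1 N2) (leq_maxl _ _).
  have [m2 Hm2] := H2 (maxn N1 N2) (leq_maxr _ _).
  by exists (m1, m2, maxn N1 N2).
pose f k := projT1 (cid (H k)).
have fP k := projT2 (cid (H k)); rewrite -/(f _) in fP.
pose Ak k := lam (f k).1.1 / lam (f k).2.
pose Bk k := lam (f k).1.2 / lam (f k).2.
(* [nm m] counts [m.+1] copies, whence the successor. *)
pose Ck k := lam ((f k).1.1 + (f k).1.2).+1 / lam (f k).2.
have Ak0 k : 0 < Ak k by rewrite divr_gt0.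
have Bk0 k : 0 < Bk k by rewrite divr_gt0.
have Ck0 k : 0 < Ck k by rewrite divr_gt0.
have lim (u : nat -> R) a : (forall k, `|u k - a| < k.+1%:R^-1) -> u n @[n --> \oo] --> a.
  move=> ua; apply/cvgrPdist_lt => e e0.
  have /cvgrPdist_lt /(_ e e0) [N _ HN] := @cvg_harmonic R.
  exists N => // n /HN; rewrite /= sub0r normrN gtr0_norm ?invr_gt0 // => Hn.
  by rewrite distrC (lt_trans (ua n)).
have cA : Ak n @[n --> \oo] --> A by apply: lim => k; exact: (fP k).1.
have cB : Bk n @[n --> \oo] --> B by apply: lim => k; exact: (fP k).2.
have XX := dom_cvgD dom (dom_cvgZ dom Ak0 A0 cA cx) (dom_cvgZ dom Bk0 B0 cB cx).
have nX : nondeg (sc A x ++ sc B x).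
  by apply: (dom_nondegD dom); exact: (dom_nondegZ dom).
have scdiv m q : sc (lam m / lam q) x ~~ sc (lam q)^-1 (nm m x).
  have q0 : 0 < (lam q)^-1 by rewrite invr_gt0.
  rewrite mulrC; apply: trans (sym (dom_scA dom _ q0 (lam0 m))) _.
  by apply: (dom_sc dom) => //; exact: sym.
have XC k : sc (Ak k) x ++ sc (Bk k) x ~~ sc (Ck k) x.
  apply: trans (dom_add dom (scdiv _ _) (scdiv _ _)) _.
  have q0 : 0 < (lam (f k).2)^-1 by rewrite invr_gt0.
  apply: trans (sym (dom_scD dom _ _ q0)) _.
  apply: sym; apply: trans (scdiv _ _) _; apply: (dom_sc dom) => //.
  exact: sym (nm_add _ _ _).
have [C C0 [xC _]] := dom_types dom XX cx nX nx Ck0 XC.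
by exists C.
Qed.
End Element.

(** [y n k] stands for the transform of the normalized law at time [n.+1%:R * t k]. The multiples of
    [y 0 k] tend to [nm n x] and the [y n k] to [x], so the convergence of types identifies [nm n x]
    with a dilate of [x]. *)
Lemma limit_divisible x (y : nat -> nat -> M) (C : nat -> nat -> R) :
  nondeg x -> (forall n, cv (y n) x) -> (forall n k, 0 < C n k) ->
  (forall n k, nm n (y 0 k) ~~ sc (C n k) (y n k)) ->
  forall n, exists2 l : R, 0 < l & nm n x ~~ sc l x.
Proof.
move=> nx yx C0 E n.
have [c c0 [xc _]] := dom_types dom (cvg_nm n (yx 0)) (yx n) (nondeg_nm n nx) nx (C0 n) (E n).
by exists c.
Qed.
End StableDomains.

(** * From convolution semigroups to the abstract structure *)

Section Transforms.
Variable R : realType.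
Variables (M : Type) (add : M -> M -> M) (sc : R -> M -> M).
Variables (eqv : M -> M -> Prop) (cv : (nat -> M) -> M -> Prop).
Variable nondeg : M -> Prop.
Hypothesis dom : conv_domain add sc eqv cv nondeg.
Local Notation "x ~~ y" := (eqv x y) (at level 70).

(* The paper's convolutions become addition under [T]; [S] is the assertion
   that only trivial shifts are allowed. *)
Variables (S : Prop) (conv : prob R -> prob R -> prob R -> Prop) (T : prob R -> M).
Hypothesis T_cvg : forall m l, wcvg m l -> cv (fun n => T (m n)) (T l).
Hypothesis T_nondeg : forall nu, nondegenerate nu -> nondeg (T nu).
Hypothesis T_conv : forall mu nu rho, conv mu nu rho -> T rho ~~ add (T mu) (T nu).
Hypothesis T_dilation : forall a mu, 0 < a -> T (dilation a mu) ~~ sc a (T mu).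
Hypothesis T_shift : forall b x, (S -> b = 0) -> add x (T (point_mass b)) ~~ x.

(** For fixed [n] the times [n.+1%:R * t k] tend to the same end of the half-line as [t k], so one
    sequence serves all multiples. *)
Lemma limit_times (rho : R -> prob R) nu :
  weak_cvg 0^'+ rho nu \/ weak_cvg +oo rho nu ->
  exists2 t : nat -> R, (forall k, 0 < t k) &
    forall n, wcvg (fun k => rho (n.+1%:R * t k)) nu.
Proof.
case=> H.
- exists (fun k => k.+1%:R^-1) => [k|n]; first by rewrite invr_gt0.
  apply: (weak_cvg_seq H (t := fun k => n.+1%:R * k.+1%:R^-1)).
  have c0 : n.+1%:R * k.+1%:R^-1 @[k --> \oo] --> (0 : R).
    by rewrite -(mulr0 n.+1%:R); apply: cvgM; [exact: cvg_cst|exact: cvg_harmonic].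
  move=> A HA; have H' : \forall k \near \oo, 0 < n.+1%:R * k.+1%:R^-1 :> R ->
    A (n.+1%:R * k.+1%:R^-1) by exact: (c0 _ HA).
  by apply: filterS H' => k; apply; rewrite mulr_gt0 // invr_gt0.
- exists (fun k => k.+1%:R) => [k|n]; first by rewrite ltr0n.
  apply: (weak_cvg_seq H (t := fun k => n.+1%:R * k.+1%:R)).
  apply/cvgryPge => A; near=> k.
  have : A <= k%:R by near: k; exact: nbhs_infty_ger.
  move/le_trans; apply; rewrite -natrM ler_nat mulSn.
  by rewrite (leq_trans (leqnSn k)) // leq_addr.
Unshelve. all: by end_near.
Qed.

Let refl := dom_refl dom.
Let sym := dom_sym dom.
Let trans := dom_trans dom.

Theorem limit_law_stable (mu : R -> prob R) (a b : R -> R) (rho : R -> prob R) nu :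
  (forall s t, 0 <= s -> 0 <= t -> conv (mu s) (mu t) (mu (s + t))) ->
  (forall t, 0 < t -> 0 < a t) ->
  (forall t, 0 < t -> conv (dilation (a t) (mu t)) (point_mass (b t)) (rho t)) ->
  (S -> forall t, 0 < t -> b t = 0) ->
  nondegenerate nu ->
  weak_cvg 0^'+ rho nu \/ weak_cvg +oo rho nu ->
  forall A B, 0 < A -> 0 < B ->
  exists2 C, 0 < C & add (sc A (T nu)) (sc B (T nu)) ~~ sc C (T nu).
Proof.
move=> semi a0 rhoE bS nd lim A B A0 B0.
have [t t0 Ht] := limit_times lim.
have nt0 n k : 0 < n.+1%:R * t k by rewrite mulr_gt0.
have rhoT s : 0 < s -> T (rho s) ~~ sc (a s) (T (mu s)).
  move=> s0; apply: trans (T_conv (rhoE s s0)) _.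
  have sh := @T_shift (b s) (T (dilation (a s) (mu s))) (fun h => bS h s s0).
  by apply: trans sh _; exact: T_dilation (a0 s s0).
have muT s : 0 < s -> T (mu s) ~~ sc (a s)^-1 (T (rho s)).
  move=> s0; have as0 := a0 s s0; have ai0 : 0 < (a s)^-1 by rewrite invr_gt0.
  apply: sym; apply: trans (dom_sc dom ai0 (rhoT s s0)) _.
  apply: trans (dom_scA dom _ ai0 as0) _.
  by rewrite mulVf ?gt_eqF //; exact: (dom_sc1 dom).
have munT s n : 0 < s -> nm add n (T (mu s)) ~~ T (mu (n.+1%:R * s)).
  move=> s0; elim: n => [|n IH]; first by rewrite mul1r.
  have -> : n.+2%:R * s = n.+1%:R * s + s by rewrite -[n.+2%:R]natr1 mulrDl mul1r.
  apply: sym; apply: trans (T_conv (semi _ _ _ (ltW s0))) _.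
    by rewrite mulr_ge0 // ltW.
  by apply: (dom_add dom) => //; exact: sym.
pose y n k := T (rho (n.+1%:R * t k)).
(* Undoing the dilation at time [t k], adding up to time [n.+1%:R * t k] and normalizing again
   leaves this quotient. *)
pose C n k := a (t k) / a (n.+1%:R * t k).
have C0 n k : 0 < C n k by rewrite divr_gt0 ?a0.
have E n k : nm add n (y 0 k) ~~ sc (C n k) (y n k).
  rewrite /y mul1r; have tk := t0 k; have ntk := nt0 n k.
  have ak := a0 _ tk; have ai0 : 0 < (a (n.+1%:R * t k))^-1 by rewrite invr_gt0 a0.
  apply: trans (nm_eqv dom n (rhoT _ tk)) _.
  apply: trans (sym (sc_nm dom n _ ak)) _.
  apply: trans (dom_sc dom ak (munT _ n tk)) _.
  apply: trans (dom_sc dom ak (muT _ ntk)) _.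
  exact: (dom_scA dom).
have yx n : cv (y n) (T nu) by exact: T_cvg (Ht n).
have nx := T_nondeg nd.
have limits := limit_divisible dom nx yx C0 E.
exact: (domain_stable dom (T_cvg (@wcvg_cst R nu)) nx limits A0 B0).
Qed.
End Transforms.

(** * An identity theorem from second-order expansions *)
Section LittleO2.
Variable R : realType.
Implicit Types (r u f g : R[i] -> R[i]) (z h : R[i]).

Definition o2 r := forall eps : R, 0 < eps ->
  exists2 d : R, 0 < d & forall h, normc h < d -> normc (r h) <= eps * normc h ^+ 2.

Definition loc_bounded u :=
  exists M d : R, 0 < d /\ forall h, normc h < d -> normc (u h) <= M.

Lemma o2_eq r u : r =1 u -> o2 u -> o2 r.
Proof. by move=> /funext ->. Qed.

Lemma o2D r u : o2 r -> o2 u -> o2 (fun h => r h + u h).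
Proof.
move=> or ou e e0; have e2 : 0 < e / 2 by rewrite divr_gt0.
have [d1 d10 H1] := or _ e2; have [d2 d20 H2] := ou _ e2.
exists (Num.min d1 d2) => [|h]; first by rewrite lt_min d10.
rewrite lt_min => /andP[/H1 h1 /H2 h2].
by rewrite (le_trans (normc_leD _ _)) // [e]splitr mulrDl lerD.
Qed.

Lemma o2_mul u r : loc_bounded u -> o2 r -> o2 (fun h => u h * r h).
Proof.
move=> [M [d0 [d00 uM]]] or e e0.
have M1 : 0 < `|M| + 1 by rewrite ltr_wpDl.
have [d d1 H] := or (e / (`|M| + 1)) (divr_gt0 e0 M1).
exists (Num.min d0 d) => [|h]; first by rewrite lt_min d00.
rewrite lt_min => /andP[/uM hu /H hr].
rewrite normcM (@le_trans _ _ ((`|M| + 1) * normc (r h))) //.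
  rewrite ler_wpM2r ?normc_ge0 // (le_trans hu) // (le_trans (ler_norm _)) // lerDl //.
rewrite (le_trans (ler_wpM2l (ltW M1) hr)) // mulrA ler_wpM2r ?sqr_ge0 //.
by rewrite mulrC divfK // gt_eqF.
Qed.

Lemma loc_bounded_cst c : loc_bounded (fun=> c).
Proof. by exists (normc c), 1; split. Qed.

Lemma loc_boundedD u r : loc_bounded u -> loc_bounded r -> loc_bounded (fun h => u h + r h).
Proof.
move=> [M [d [d0 uM]]] [N [e [e0 uN]]]; exists (M + N), (Num.min d e).
split=> [|h]; first by rewrite lt_min d0.
rewrite lt_min => /andP[/uM h1 /uN h2].
by rewrite (le_trans (normc_leD _ _)) // lerD.
Qed.

Lemma loc_boundedM u r : loc_bounded u -> loc_bounded r -> loc_bounded (fun h => u h * r h).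
Proof.
move=> [M [d [d0 uM]]] [N [e [e0 uN]]]; exists (M * N), (Num.min d e).
split=> [|h]; first by rewrite lt_min d0.
rewrite lt_min => /andP[/uM h1 /uN h2].
by rewrite normcM ler_pM ?normc_ge0.
Qed.

Lemma loc_bounded_id : loc_bounded id.
Proof. by exists 1, 1; split => // h /ltW. Qed.

Lemma o2_loc_bounded r : o2 r -> loc_bounded r.
Proof.
move=> /(_ 1 ltr01)[d d0 H]; exists 1, (Num.min d 1); split=> [|h].
  by rewrite lt_min d0 /=.
rewrite lt_min => /andP[/H rh h1]; rewrite (le_trans rh) // mul1r.
by rewrite expr_le1 ?normc_ge0 // ltW.
Qed.

Lemma o2Z c r : o2 r -> o2 (fun h => c * r h).
Proof. exact: o2_mul (loc_bounded_cst c). Qed.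

Lemma o2_cube : o2 (fun h => h ^+ 3).
Proof.
move=> e e0; exists e => // h he.
by rewrite normcX exprS ler_wpM2r ?sqr_ge0 // ltW.
Qed.

Lemma o2_comp r k (L : R) : o2 r -> 0 < L ->
  (exists2 d : R, 0 < d & forall h, normc h < d -> normc (k h) <= L * normc h) ->
  o2 (fun h => r (k h)).
Proof.
move=> or L0 [d0 d00 kL] e e0.
have [d d1 H] := or (e / L ^+ 2) (divr_gt0 e0 (exprn_gt0 _ L0)).
exists (Num.min d0 (d / L)) => [|h]; first by rewrite lt_min d00 divr_gt0.
rewrite lt_min => /andP[/kL hk hd].
have : normc (k h) < d by rewrite (le_lt_trans hk) // mulrC -ltr_pdivlMr.
move/H => /le_trans; apply.
have -> : e * normc h ^+ 2 = e / L ^+ 2 * (L * normc h) ^+ 2 by field; rewrite gt_eqF.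
rewrite ler_wpM2l ?divr_ge0 ?sqr_ge0 // ?(ltW e0) // ler_pXn2r ?nnegrE ?normc_ge0 //.
by rewrite mulr_ge0 ?normc_ge0 // ltW.
Qed.

Lemma o2_local r u : o2 u ->
  (exists2 d : R, 0 < d & forall h, normc h < d -> r h = u h) -> o2 r.
Proof.
move=> ou [d d0 ru] e e0; have [d' d'0 H] := ou e e0.
exists (Num.min d d') => [|h]; first by rewrite lt_min d0.
by rewrite lt_min => /andP[/ru -> /H].
Qed.
End LittleO2.

(** * Second-order expansions of complex functions *)

Section Jets.
Variable R : realType.
Implicit Types (f g : R[i] -> R[i]) (z w h : R[i]).

(* Second-order expansions suffice for the maximum principle, and unlike
   derivatives they need no theory of differentiation over the complex numbers. *)
Definition jet2 f z := exists a b : R[i],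
  o2 (fun h => f (z + h) - f z - a * h - b * h ^+ 2).

Lemma jet2_cst c z : jet2 (fun=> c) z.
Proof.
exists 0, 0; apply: (o2_eq (u := fun h => 0 * h ^+ 3)).
  by move=> h; rewrite subrr !mul0r !subr0.
exact/o2Z/o2_cube.
Qed.

Lemma jet2_id z : jet2 id z.
Proof.
exists 1, 0; apply: (o2_eq (u := fun h => 0 * h ^+ 3)); last exact/o2Z/o2_cube.
by move=> h; ring.
Qed.

Lemma jet2D f g z : jet2 f z -> jet2 g z -> jet2 (fun z => f z + g z) z.
Proof.
move=> [a [b F]] [c [d G]]; exists (a + c), (b + d); apply: o2_eq (o2D F G).
by move=> h; ring.
Qed.

Lemma jet2_bounded f z : jet2 f z -> loc_bounded (fun h => f (z + h)).
Proof.
move=> [a [b F]].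
have -> : (fun h => f (z + h)) = (fun h => (f (z + h) - f z - a * h - b * h ^+ 2)
   + (f z + (a * h + b * (h * h)))) by apply/funext => h; ring.
apply: loc_boundedD; first exact: o2_loc_bounded.
apply: loc_boundedD; first exact: loc_bounded_cst.
apply: loc_boundedD; apply: loc_boundedM; try exact: loc_bounded_cst.
  exact: loc_bounded_id.
by apply: loc_boundedM; exact: loc_bounded_id.
Qed.

Lemma jet2M f g z : jet2 f z -> jet2 g z -> jet2 (fun z => f z * g z) z.
Proof.
move=> jf jg; have := jet2_bounded jg; move: jf jg.
move=> [a [b F]] [c [d G]] gb.
exists (a * g z + f z * c), (b * g z + a * c + f z * d).
apply: (o2_eq (u := fun h => g (z + h) * (f (z + h) - f z - a * h - b * h ^+ 2) +
  ((f z + (a * h + b * (h * h))) * (g (z + h) - g z - c * h - d * h ^+ 2) +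
   (a * d + b * c + b * d * h) * h ^+ 3))).
  by move=> h; ring.
apply: o2D; first exact: o2_mul.
apply: o2D; apply: o2_mul => //; last exact: o2_cube.
- apply: loc_boundedD; first exact: loc_bounded_cst.
  apply: loc_boundedD; apply: loc_boundedM; try exact: loc_bounded_cst.
    exact: loc_bounded_id.
  by apply: loc_boundedM; exact: loc_bounded_id.
- apply: loc_boundedD; first exact: loc_bounded_cst.
  by apply: loc_boundedM; [exact: loc_bounded_cst|exact: loc_bounded_id].
Qed.

Lemma jet2Z c f z : jet2 f z -> jet2 (fun z => c * f z) z.
Proof. by move=> jf; apply: jet2M => //; exact: jet2_cst. Qed.

Lemma jet2B f g z : jet2 f z -> jet2 g z -> jet2 (fun z => f z - g z) z.
Proof.
move=> jf /(jet2Z (-1)) jg; have := jet2D jf jg.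
by under eq_fun do rewrite mulN1r.
Qed.

Lemma jet2X f n z : jet2 f z -> jet2 (fun z => f z ^+ n) z.
Proof.
move=> jf; elim: n => [|n IH]; first exact: jet2_cst.
by under eq_fun do rewrite exprS; exact: jet2M.
Qed.

Lemma jet2_cont f z eps : jet2 f z -> 0 < eps ->
  exists2 d, 0 < d & forall h, normc h < d -> normc (f (z + h) - f z) < eps.
Proof.
move=> [a [b F]] e0.
have [d d0 H] := F 1 ltr01.
pose K := normc a + normc b + 2.
have K0 : 0 < K by rewrite /K; have := normc_ge0 a; have := normc_ge0 b; lra.
exists (Num.min d (Num.min 1 (eps / K))) => [|h].
  by rewrite !lt_min d0 ltr01 divr_gt0.
rewrite !lt_min => /and3P[/H Hh h1]; rewrite ltr_pdivlMr // => hK.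
have -> : f (z + h) - f z = (f (z + h) - f z - a * h - b * h ^+ 2) + a * h + b * h ^+ 2.
  by ring.
rewrite (le_lt_trans (normc_leD _ _)) //.
have H1 := normc_leD (f (z + h) - f z - a * h - b * h ^+ 2) (a * h).
have a0 := normc_ge0 a; have b0 := normc_ge0 b; have nh0 := normc_ge0 h.
have hh : normc h ^+ 2 <= normc h by rewrite expr2 ler_piMr // ltW.
have bhh : normc b * normc h ^+ 2 <= normc b * normc h by rewrite ler_wpM2l.
rewrite (normcM a) in H1; rewrite (normcM b) normcX.
by move: Hh hK; rewrite /K => Hh hK; nra.
Qed.

Lemma jet2_local f g z : jet2 g z ->
  (exists2 d : R, 0 < d & forall h, normc h < d -> f (z + h) = g (z + h)) -> jet2 f z.
Proof.
move=> [a [b G]] [d d0 fg]; exists a, b; apply: (o2_local G); exists d => // h hd.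
have -> : f z = g z by rewrite -[z]addr0 fg // normc0.
by rewrite fg.
Qed.

Lemma jet2V f z : f z != 0 -> jet2 f z -> jet2 (fun z => (f z)^-1) z.
Proof.
move=> f0 jf; have nf0 : 0 < normc (f z) by rewrite normc_gt0.
have nf2 : 0 < normc (f z) / 2 by rewrite divr_gt0.
have [d d0 Hd] := jet2_cont jf nf2.
have low h : normc h < d -> normc (f z) / 2 <= normc (f (z + h)).
  move=> /Hd; rewrite normc_distC => H; have := normc_geB (f z) (f (z + h)); lra.
have fne h : normc h < d -> f (z + h) != 0.
  by move=> /low H; rewrite -normc_gt0 (lt_le_trans nf2).
have bV : loc_bounded (fun h => (f (z + h))^-1).
  exists (normc (f z) / 2)^-1, d; split => // h hd.
  rewrite normcV lef_pV2 ?posrE ?low //; last exact: lt_le_trans (low _ hd).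
move: jf => [a [b F]].
(* The Taylor coefficients of the reciprocal, from inverting [f z + a h + b h^2] to second order. *)
pose u := - a / f z ^+ 2; pose v := a ^+ 2 / f z ^+ 3 - b / f z ^+ 2.
exists u, v.
pose r h := f (z + h) - f z - a * h - b * h ^+ 2.
apply: (o2_local (u := fun h => (f (z + h))^-1 *
  ((- (f z)^-1 - u * h - v * (h * h)) * r h - (u * b + v * a + v * b * h) * h ^+ 3))).
  apply: o2_mul => //; apply: o2D.
    apply: o2_mul => //.
    apply: loc_boundedD; last first.
      have -> : (fun h => - (v * (h * h))) = fun h => - v * (h * h).
        by apply/funext => h; rewrite mulNr.
      apply: loc_boundedM; first exact: loc_bounded_cst.
      by apply: loc_boundedM; exact: loc_bounded_id.
    apply: loc_boundedD; first exact: loc_bounded_cst.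
    have -> : (fun h => - (u * h)) = fun h => - u * h.
      by apply/funext => h; rewrite mulNr.
    by apply: loc_boundedM; [exact: loc_bounded_cst|exact: loc_bounded_id].
  have -> : (fun h : R[i] => - ((u * b + v * a + v * b * h) * h ^+ 3)) =
    (fun h => (- (u * b + v * a) + (- (v * b)) * h) * h ^+ 3).
    by apply/funext => h; ring.
  apply: o2_mul; last exact: o2_cube.
  apply: loc_boundedD; first exact: loc_bounded_cst.
  by apply: loc_boundedM; [exact: loc_bounded_cst|exact: loc_bounded_id].
exists d => // h /fne fh; rewrite /r /u /v.
by field; rewrite fh f0.
Qed.

Lemma jet2_scale f z (l : R) : 0 < l -> jet2 f (z / l%:C) -> jet2 (fun z => f (z / l%:C)) z.
Proof.
move=> l0 [a [b F]]; exists (a / l%:C), (b / l%:C ^+ 2).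
have nl : l%:C != 0 by rewrite realC_eq0 gt_eqF.
have li : 0 < l^-1 by rewrite invr_gt0.
apply: (o2_eq _ (o2_comp (k := fun h => h / l%:C) F li _)).
  by move=> h /=; rewrite mulrDl; field.
by exists 1 => // h _; rewrite normcM normcV normcR gtr0_norm // mulrC.
Qed.

(** The Lipschitz bound on the right inverse replaces an inverse function theorem: it turns a
    remainder [o(k^2)] in [k = g (z + h) - g z] into [o(h^2)], and it excludes a vanishing
    derivative of [f], under which [h] would be of order [h^2]. *)
Lemma jet2_inverse f g z (L : R) : 0 < L ->
  (exists2 d : R, 0 < d & forall h, normc h < d ->
     f (g (z + h)) = z + h /\ normc (g (z + h) - g z) <= L * normc h) ->
  jet2 f (g z) -> jet2 g z.
Proof.
move=> L0 [d d0 Hd] [a [b F]].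
have fgz : f (g z) = z by have := Hd 0; rewrite addr0 normc0 => /(_ d0)[].
pose r k := f (g z + k) - f (g z) - a * k - b * k ^+ 2.
pose k h := g (z + h) - g z.
have hE h : normc h < d -> h = a * k h + b * k h ^+ 2 + r (k h).
  move=> /Hd[E _]; have e : g z + k h = g (z + h) by rewrite /k addrC subrK.
  by rewrite /r e E fgz; ring.
have a0 : a != 0.
  apply/eqP => a0.
  (* otherwise [h] would be o(h) *)
  have o1 : 0 < (4 * L ^+ 2 * (normc b + 1))^-1.
    rewrite invr_gt0 !mulr_gt0 ?exprn_gt0 //.
    by rewrite ltr_wpDl ?normc_ge0.
  have [d' d'0 H] := F 1 ltr01.
  (* The last bound makes [(normc b + 1) * (L * t) ^+ 2] at most [t / 4], although the expansion of
     [f] without linear term bounds [t] by it. *)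
  pose t := Num.min (d / 2) (Num.min (d' / (2 * L)) (4 * L ^+ 2 * (normc b + 1))^-1).
  have t0 : 0 < t by rewrite !lt_min o1 !divr_gt0 // mulr_gt0.
  have nt : normc (t%:C) = t by rewrite normcR gtr0_norm.
  have td : normc (t%:C) < d.
    rewrite nt gt_min; apply/orP; left; lra.
  have := hE _ td; rewrite a0 mul0r add0r => E.
  have [_ kL] := Hd _ td; rewrite nt -/(k _) in kL.
  have kd' : normc (k t%:C) < d'.
    rewrite (le_lt_trans kL) // mulrC -ltr_pdivlMr //.
    rewrite /t gt_min; apply/orP; right; rewrite gt_min; apply/orP; left.
    by rewrite invfM mulrA ltr_pM2r ?invr_gt0 //; lra.
  have := H _ kd'; rewrite -/(r _) mul1r => rk.
  have : t <= normc b * normc (k t%:C) ^+ 2 + normc (k t%:C) ^+ 2.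
    rewrite -{1}nt {1}E (le_trans (normc_leD _ _)) // lerD //.
    by rewrite normcM normcX.
  have k2 : normc (k t%:C) ^+ 2 <= (L * t) ^+ 2.
    by rewrite ler_pXn2r ?nnegrE ?normc_ge0 // mulr_ge0 ?ltW.
  have b1 : 0 < normc b + 1 by rewrite ltr_wpDl ?normc_ge0.
  have : t <= (4 * L ^+ 2 * (normc b + 1))^-1 by rewrite /t !ge_min lexx !orbT.
  rewrite -[X in _ <= X]mul1r ler_pdivlMr; last by rewrite !mulr_gt0 ?exprn_gt0.
  move=> tK tt.
  have : t <= (normc b + 1) * (L * t) ^+ 2.
    by rewrite (le_trans tt) // -{2}[normc _ ^+ 2]mul1r -mulrDl ler_wpM2l // ltW.
  have -> : (normc b + 1) * (L * t) ^+ 2 = t * (4 * L ^+ 2 * (normc b + 1)) / 4 * t by field.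
  move=> H2; have : t * (4 * L ^+ 2 * (normc b + 1)) / 4 * t <= 1 / 4 * t.
    by rewrite ler_pM2r // ler_pM2r.
  lra.
(* Reversion of the series [h = a k + b k^2 + r]. Below, [rr] is what [k - h / a + b h^2 / a^3]
   becomes once this expression is substituted for [h]. *)
exists a^-1, (- b / a ^+ 3).
pose rr k := (- a^-1 + b / a ^+ 3 * (2 * (a * k + b * k ^+ 2) + r k)) * r k +
   b / a ^+ 3 * (2 * a * b + b ^+ 2 * k) * k ^+ 3.
have orr : o2 rr.
  have lk : @loc_bounded R id by exact: loc_bounded_id.
  have lc c : @loc_bounded R (fun=> c) by exact: loc_bounded_cst.
  apply: o2D; apply: o2_mul => //; last exact: o2_cube.
    apply: loc_boundedD => //; apply: loc_boundedM => //; apply: loc_boundedD; last exact: o2_loc_bounded.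
    apply: loc_boundedM => //; apply: loc_boundedD; first exact: loc_boundedM.
    apply: loc_boundedM => //; exact: (@loc_boundedM _ id id).
  apply: loc_boundedM => //; apply: loc_boundedD => //; exact: loc_boundedM.
apply: (o2_local (u := fun h => rr (k h))).
  by apply: (o2_comp orr L0); exists d => // h /Hd[].
exists d => // h hd; rewrite -/(k h).
rewrite {2 3}(hE _ hd) /rr; move: (k h) (r (k h)) => x y.
by field.
Qed.
End Jets.

(** * Maximum principle and propagation of zeros *)

Section MaximumPrinciple.
Variable R : realType.
Implicit Types (f g : R[i] -> R[i]) (z w h c : R[i]) (rho : R).

(** Squares instead of discs: a square is a product of two segments, hence compact. *)
Definition square c rho : set R[i] := [set z |
  `|complex.Re (z - c)| <= rho /\ `|complex.Im (z - c)| <= rho].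

Lemma square_EVT (v : R[i] -> R) c rho : 0 < rho ->
  (forall z eps, square c rho z -> 0 < eps -> exists2 d, 0 < d &
     forall h, normc h < d -> `|v (z + h) - v z| < eps) ->
  exists2 z, square c rho z & forall w, square c rho w -> v w <= v z.
Proof.
move=> r0 vc.
pose A : set (R * R) := `[- rho, rho]%classic `*` `[- rho, rho]%classic.
pose F (p : R * R) := v (c + (p.1 +i* p.2)).
have cA : compact A by apply: compact_setX; exact: segment_compact.
have A0 : A !=set0 by exists (0, 0); split; rewrite /= in_itv /= oppr_le0 !ltW.
have sA p : A p -> square c rho (c + (p.1 +i* p.2)).
  case: p => x y [/=]; rewrite !in_itv /= => /andP[x1 x2] /andP[y1 y2].
  by split; rewrite addrAC subrr add0r /= ler_norml ?x1 ?y1.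
have Fc : {within A, continuous F}.
  apply: continuous_in_subspaceT => p /set_mem/sA pA.
  apply/cvgrPdist_lt => e e0.
  have [d d0 H] := vc _ _ pA e0.
  have d2 : 0 < d / 2 by rewrite divr_gt0.
  near=> q.
  have -> : F q = v (c + (p.1 +i* p.2) + ((q.1 - p.1) +i* (q.2 - p.2))).
    by rewrite /F; congr v; apply: complex_ext; rewrite !(cReD, cImD) /=; ring.
  rewrite distrC; apply: H; apply: (le_lt_trans (normc_le_ReIm _)) => /=.
  rewrite [d]splitr ltrD // distrC; near: q.
    by apply: (@cvgr_dist_lt _ R) => //; exact: cvg_fst.
  by apply: (@cvgr_dist_lt _ R) => //; exact: cvg_snd.
have [p /set_mem pA pmax] := compact_EVT_max A0 cA Fc.
exists (c + (p.1 +i* p.2)); first exact: sA.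
move=> w [w1 w2].
have : (complex.Re (w - c), complex.Im (w - c)) \in A.
  by apply/mem_set; split => /=; rewrite in_itv /= -ler_norml.
move/pmax; rewrite /F /=.
have -> // : c + (complex.Re (w - c) +i* complex.Im (w - c)) = w.
by rewrite addrC -[RHS](subrK c); congr (_ + _); case: (w - c).
Unshelve. all: by end_near.
Qed.

(* The mean of [|f|^2] over [z + h], [h = t, it, -t, -it], exceeds [|f z|^2]
   up to o(t^2), so [|f|^2 + eps |z - c|^2] has no interior local maximum. *)
Lemma no_interior_max f z c eps : 0 < eps -> jet2 f z ->
  forall d, 0 < d -> exists2 h, normc h < d &
    normc (f z) ^+ 2 + eps * normc (z - c) ^+ 2 <
    normc (f (z + h)) ^+ 2 + eps * normc (z + h - c) ^+ 2.
Proof.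
move=> e0 [a [b F]] d d0.
apply: contrapT => /forall2NP H.
(* [P] bounds the quadratic polynomial for [|h| <= 1], and [eta] below is so small that replacing
   [f (z + h)] by this polynomial costs at most half of the gain [eps * t ^+ 2]. *)
pose P := normc (f z) + normc a + normc b.
have P0 : 0 <= P by rewrite !addr_ge0 ?normc_ge0.
have eta0 : 0 < Num.min 1 (eps / (2 * (2 * P + 1))).
  by rewrite lt_min ltr01 divr_gt0 // mulr_gt0 //; lra.
set eta := Num.min _ _ in eta0.
have eta1 : eta <= 1 by rewrite ge_min lexx.
have etaP : eta * (2 * P + 1) <= eps / 2.
  have : eta <= eps / (2 * (2 * P + 1)) by rewrite ge_min lexx orbT.
  rewrite ler_pdivlMr ?mulr_gt0 //; last lra.
  by move=> ?; lra.
have [d' d'0 Hd'] := F eta eta0.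
pose t := Num.min 1 (Num.min d d') / 2.
have t0 : 0 < t by rewrite divr_gt0 // !lt_min ltr01 d0.
have tmin : t < Num.min 1 (Num.min d d').
  by rewrite /t; move: t0; rewrite /t; lra.
move: tmin; rewrite !lt_min => /and3P[t1 td td'].
have key h : normc h = t ->
    normc (f z + a * h + b * h ^+ 2) ^+ 2 + eps * normc (z + h - c) ^+ 2
      - eps / 2 * t ^+ 2 <= normc (f z) ^+ 2 + eps * normc (z - c) ^+ 2.
  move=> ht; have [//|/negP] := H h; first by rewrite ht.
  rewrite -leNgt; apply: le_trans; rewrite addrAC lerD2r.
  have := Hd' h; rewrite ht => /(_ td').
  set r := normc (_ - _) => rb.
  have pP : normc (f z + a * h + b * h ^+ 2) <= P.
    rewrite (le_trans (normc_leD _ _)) // lerD //.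
      rewrite (le_trans (normc_leD _ _)) // lerD // normcM ht.
      by rewrite ler_piMr ?normc_ge0 // ltW.
    by rewrite normcM normcX ht ler_piMr ?normc_ge0 // expr_le1 // ltW.
  have : normc (f z + a * h + b * h ^+ 2) <= normc (f (z + h)) + r.
    rewrite /r -[X in _ <= _ + X]normc_opp (le_trans _ (normc_leD _ _)) //.
    by rewrite le_eqVlt; apply/orP; left; apply/eqP; congr normc; ring.
  have r0 : 0 <= r by exact: normc_ge0.
  have fp := normc_ge0 (f (z + h)).
  have pp := normc_ge0 (f z + a * h + b * h ^+ 2).
  have tt : 0 < t ^+ 2 by exact: exprn_gt0.
  have tt1 : t ^+ 2 <= 1 by rewrite expr_le1 // ltW.
  set p := normc (f z + a * h + b * h ^+ 2) in pP pp *.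
  set q := normc (f (z + h)) in fp * => pq.
  have {fp} q0 := fp; have {pp} p0 := pp.
  have rr : 2 * P * r <= eps / 2 * t ^+ 2.
    have : 2 * P * r <= 2 * P * (eta * t ^+ 2) by rewrite ler_wpM2l // mulr_ge0.
    nra.
  have [pr|pr] := leP p r; first by nra.
  have : (p - r) ^+ 2 <= q ^+ 2 by rewrite ler_pXn2r ?nnegrE ?subr_ge0 ?(ltW pr) ?lerBlDr //.
  nra.
have nt : normc (t%:C) = t by rewrite normcR gtr0_norm.
have nt2 : normc (- t%:C) = t by rewrite normc_opp.
have nt3 : normc ('i * t%:C) = t by rewrite normcM nt /= expr0n expr1n /= add0r sqrtr1 mul1r.
have nt4 : normc (- ('i * t%:C)) = t by rewrite normc_opp.
(* In the sum over the four directions all cross terms cancel, and [4 |a|^2 t^2 + 4 |b|^2 t^4 + 2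
   eps t^2 <= 0] remains. *)
have := key _ nt; have := key _ nt2; have := key _ nt3; have := key _ nt4.
rewrite !sqr_normcE; move: (f z) => [f1 f2]; case: (a) => a1 a2; case: (b) => b1 b2.
case: (z) => z1 z2; case: (c) => c1 c2 /=.
have tt : 0 < t ^+ 2 by exact: exprn_gt0.
have s1 : 0 <= (b1 * t ^+ 2) ^+ 2 by exact: sqr_ge0.
have s2 : 0 <= (b2 * t ^+ 2) ^+ 2 by exact: sqr_ge0.
have s3 : 0 <= (a1 * t) ^+ 2 by exact: sqr_ge0.
have s4 : 0 <= (a2 * t) ^+ 2 by exact: sqr_ge0.
have et : 0 < eps * t ^+ 2 by exact: mulr_gt0.
move: eps e0 et {key H etaP eta0 eta1 eta Hd'} => eps e0 et.
by move=> ? ? ? ?; lra.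
Qed.

(** On the square the weight [eps * normc (z - c) ^+ 2] never exceeds half of the excess
    [|f z1|^2 - M^2]. A maximum of the weighted function therefore has [|f| > M], so it lies in the
    open disc, where [no_interior_max] contradicts it. *)
Lemma maximum_principle f c rho M : 0 < rho ->
  (forall z, square c rho z -> jet2 f z) ->
  (forall z, square c rho z -> rho <= normc (z - c) -> normc (f z) <= M) ->
  forall z, square c rho z -> normc (f z) <= M.
Proof.
move=> r0 jf fM z1 z1Q; rewrite leNgt; apply/negP => Mf.
have M0 : 0 <= M.
  apply: le_trans (normc_ge0 (f (c + rho%:C))) _; apply: fM.
    by split; rewrite addrAC subrr add0r /= ?normr0 ?gtr0_norm // ltW.
  by rewrite addrAC subrr add0r normcR ler_norm.
pose eps := (normc (f z1) ^+ 2 - M ^+ 2) / (4 * rho ^+ 2).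
have rr : 0 < 4 * rho ^+ 2 by rewrite mulr_gt0 // exprn_gt0.
have e0 : 0 < eps.
  by rewrite divr_gt0 // subr_gt0 ltr_pXn2r ?nnegrE ?normc_ge0.
pose v z := normc (f z) ^+ 2 + eps * normc (z - c) ^+ 2.
have jc z : jet2 (fun z => z - c) z by apply: jet2B; [exact: jet2_id|exact: jet2_cst].
have sq (g : R[i] -> R[i]) z e : jet2 g z -> 0 < e -> exists2 d : R, 0 < d &
    forall h, normc h < d -> `|normc (g (z + h)) ^+ 2 - normc (g z) ^+ 2| < e.
  move=> jg e1; pose K := 2 * normc (g z) + 1.
  have K0 : 0 < K by rewrite /K; have := normc_ge0 (g z); lra.
  have m0 : 0 < Num.min 1 (e / K) by rewrite lt_min ltr01 divr_gt0.
  have [d d0 Hd] := jet2_cont jg m0.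
  exists d => // h /Hd; rewrite lt_min ltr_pdivlMr // => /andP[H1 H2].
  have H3 := normc_geB (g (z + h)) (g z).
  have H4 := normc_geB (g z) (g (z + h)); rewrite (normc_distC (g z)) in H4.
  have p0 := normc_ge0 (g (z + h)); have q0 := normc_ge0 (g z).
  have s0 := normc_ge0 (g (z + h) - g z).
  rewrite subr_sqr normrM (@le_lt_trans _ _ (normc (g (z + h) - g z) * K)) //.
  apply: ler_pM => //; first by rewrite ler_norml; apply/andP; split; lra.
  rewrite ger0_norm ?addr_ge0 //; rewrite /K; lra.
have [z zQ zmax] : exists2 z, square c rho z & forall w, square c rho w -> v w <= v z.
  apply: square_EVT => // z e zQ e1.
  have e2 : 0 < e / 2 by rewrite divr_gt0.
  have e3 : 0 < e / 2 / eps by rewrite divr_gt0.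
  have [d1 d10 H1] := sq _ _ _ (jf _ zQ) e2.
  have [d2 d20 H2] := sq _ _ _ (jc z) e3.
  exists (Num.min d1 d2) => [|h]; first by rewrite lt_min d10.
  rewrite lt_min => /andP[/H1 h1 /H2 h2].
  have -> : v (z + h) - v z = (normc (f (z + h)) ^+ 2 - normc (f z) ^+ 2) +
     eps * (normc (z + h - c) ^+ 2 - normc (z - c) ^+ 2) by rewrite /v; ring.
  rewrite (le_lt_trans (ler_normD _ _)) // [e]splitr ltrD // normrM (gtr0_norm e0).
  by rewrite mulrC -ltr_pdivlMr.
have vz1 := zmax _ z1Q.
have vz1' : normc (f z1) ^+ 2 <= v z1 by rewrite lerDl mulr_ge0 ?sqr_ge0 // ltW.
have zc2 : normc (z - c) ^+ 2 <= 2 * rho ^+ 2.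
  have [x1 x2] := zQ; rewrite sqr_normcE -[X in X + _]real_normK ?num_real //.
  rewrite -[X in _ + X]real_normK ?num_real // mulr_natl mulr2n.
  by apply: lerD; rewrite ler_pXn2r ?nnegrE // ltW.
have epsE : eps * (2 * rho ^+ 2) = (normc (f z1) ^+ 2 - M ^+ 2) / 2.
  by rewrite /eps; field; rewrite gt_eqF.
have ez : eps * normc (z - c) ^+ 2 <= (normc (f z1) ^+ 2 - M ^+ 2) / 2.
  by rewrite -epsE ler_wpM2l // ltW.
have MM : M ^+ 2 < normc (f z1) ^+ 2 by rewrite ltr_pXn2r ?nnegrE ?normc_ge0.
have Mz : M < normc (f z).
  rewrite -(ltr_pXn2r (n := 2)) ?nnegrE ?normc_ge0 //.
  by move: vz1 vz1' ez MM; rewrite /v; lra.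
have zin : normc (z - c) < rho by rewrite ltNge; apply/negP => /(fM _ zQ); rewrite leNgt Mz.
have gap : 0 < rho - normc (z - c) by rewrite subr_gt0.
have [h hd] := no_interior_max c e0 (jf _ zQ) gap.
rewrite -!/(v _) ltNge => /negP; apply; apply: zmax.
have H : normc (z + h - c) <= rho.
  have -> : z + h - c = (z - c) + h by ring.
  by rewrite (le_trans (normc_leD _ _)) //; lra.
by split; rewrite (le_trans _ H) ?Re_le_normc ?Im_le_normc.
Qed.

(** Dividing by [(z - c) ^+ n] is harmless because [f] vanishes near [c]. The maximum principle for
    the quotient gives [|f z1| <= M * (|z1 - c| / rho) ^+ n] for every [n], and the right side tends
    to 0. *)
Lemma zero_spreads f c rho d : 0 < rho -> 0 < d ->
  (forall z, square c rho z -> jet2 f z) ->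
  (forall z, normc (z - c) < d -> f z = 0) ->
  forall z, normc (z - c) < rho -> f z = 0.
Proof.
move=> r0 d0 jf f0 z1 z1r.
have sqz z : normc (z - c) < rho -> square c rho z.
  move=> zr; split; rewrite (le_trans _ (ltW zr)) ?Re_le_normc ?Im_le_normc //.
have [z0 z0Q z0max] : exists2 z, square c rho z & forall w, square c rho w -> normc (f w) <= normc (f z).
  apply: square_EVT => // z e zQ e1.
  have [d' d'0 H] := jet2_cont (jf _ zQ) e1.
  exists d' => // h /H Hh; rewrite (le_lt_trans _ Hh) // ler_norml; apply/andP; split.
    by rewrite lerNl opprB normc_distC normc_geB.
  exact: normc_geB.
set M := normc (f z0) in z0max.
have jn n z : square c rho z -> jet2 (fun z => f z * (z - c)^-1 ^+ n) z.
  move=> zQ; have [zc|zc] := eqVneq z c.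
    apply: (jet2_local (jet2_cst 0 z)); exists d => // h hd.
    by rewrite f0 ?mul0r // zc addrAC subrr add0r.
  apply: jet2M; first exact: jf.
  apply: jet2X; apply: jet2V; first by rewrite subr_eq0.
  by apply: jet2B; [exact: jet2_id|exact: jet2_cst].
have bn n : normc (f z1) <= M * (normc (z1 - c) / rho) ^+ n.
  have [zc|zc] := eqVneq z1 c.
    by rewrite f0 ?zc ?subrr ?normc0 // mulr_ge0 ?normc_ge0 // mul0r exprn_ge0.
  have zc0 : 0 < normc (z1 - c) by rewrite normc_gt0 subr_eq0.
  have := maximum_principle r0 (jn n) (M := M / rho ^+ n) _ (sqz _ z1r).
  rewrite normcM normcX normcV => H.
  rewrite expr_div_n mulrCA mulrC -ler_pdivrMr ?exprn_gt0 // -exprVn H //.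
  move=> z zQ zr; rewrite normcM normcX normcV ler_pM ?normc_ge0 ?z0max //.
    by rewrite exprn_ge0 // invr_ge0 normc_ge0.
  rewrite -exprVn lerXn2r ?nnegrE ?invr_ge0 ?normc_ge0 ?(ltW r0) //.
  by rewrite lef_pV2 ?posrE // (lt_le_trans r0).
have lim : M * (normc (z1 - c) / rho) ^+ n @[n --> \oo] --> 0.
  rewrite -(mulr0 M); apply: cvgM; first exact: cvg_cst.
  apply: cvg_expr; rewrite ger0_norm ?divr_ge0 ?normc_ge0 ?(ltW r0) //.
  by rewrite ltr_pdivrMr // mul1r.
apply/eqP; rewrite -normc_eq0 eq_le normc_ge0 andbT.
by apply: (ler_cvg_to (cvg_cst _) lim); exact: nearW.
Qed.

(** Zeros spread along centres on the segment spaced by less than [rho / 2]: the disc of radius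
    [rho / 2] about each centre lies in the disc of radius [rho] about the previous one. *)
Lemma identity_segment f z0 z1 rho d : 0 < rho -> 0 < d ->
  (forall t z, 0 <= t <= 1 -> square (z0 + t%:C * (z1 - z0)) rho z -> jet2 f z) ->
  (forall z, normc (z - z0) < d -> f z = 0) -> f z1 = 0.
Proof.
move=> r0 d0 jf f0.
pose N := (Num.truncn (2 * normc (z1 - z0) / rho)).+1.
have N0 : 0 < N%:R :> R by rewrite ltr0n.
have NL : 2 * normc (z1 - z0) / rho < N%:R by rewrite truncnS_gt.
pose p k := z0 + (k%:R / N%:R)%:C * (z1 - z0).
have H k : (k <= N)%N -> exists2 d', 0 < d' & forall z, normc (z - p k) < d' -> f z = 0.
  elim: k => [|k IH] kN.
    by exists d => // z; rewrite /p mul0r mul0r addr0; exact: f0.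
  have [d' d'0 Hd'] := IH (ltnW kN).
  exists (rho / 2); first by rewrite divr_gt0.
  move=> z zp; apply: (zero_spreads (c := p k) (d := d') r0 d'0) => //.
    move=> w; apply: jf; rewrite divr_ge0 ?ler0n //= ler_pdivrMr // mul1r ler_nat.
    exact: ltnW.
  have -> : z - p k = (z - p k.+1) + (p k.+1 - p k) by ring.
  rewrite (le_lt_trans (normc_leD _ _)) // [rho]splitr ltrD //.
  have -> : p k.+1 - p k = (N%:R^-1)%:C * (z1 - z0).
    rewrite /p -(natr1 k) mulrDl mul1r rmorphD /=; ring.
  rewrite normcM normcR gtr0_norm ?invr_gt0 //.
  move: NL; rewrite ltr_pdivrMr // => NL.
  rewrite mulrC ltr_pdivrMr //; lra.
have [d' d'0 Hd'] := H N (leqnn N).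
have pN : p N = z1.
  by rewrite /p divff ?gt_eqF // mul1r addrC subrK.
by apply: Hd'; rewrite pN subrr normc0.
Qed.
End MaximumPrinciple.

(** * Cauchy transforms and their reciprocals *)
Section CauchyTransform.
Variable R : realType.
Implicit Types (mu nu : prob R) (z w h : R[i]) (x b : R).

Local Notation G := cauchy_transform.
Local Notation F := recip_cauchy.
Local Notation res z := (fun x : R => (z - x%:C)^-1).

Lemma Im_subR z x : complex.Im (z - x%:C) = complex.Im z.
Proof. by rewrite cImB subr0. Qed.

Lemma subR_neq0 z x : 0 < complex.Im z -> z - x%:C != 0.
Proof. by move=> z0; apply: Im_neq0; rewrite Im_subR gt_eqF. Qed.

Lemma ccb_res z : 0 < complex.Im z -> ccb (res z).
Proof. by move=> z0; apply: ccb_resolvent; rewrite gt_eqF. Qed.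
Hint Resolve ccb_res : core.

Lemma normc_res z x : 0 < complex.Im z -> normc (z - x%:C)^-1 <= (complex.Im z)^-1.
Proof.
move=> z0; rewrite normcV lef_pV2 ?posrE ?normc_gt0 ?subR_neq0 //.
by rewrite (le_trans _ (Im_le_normc _)) // Im_subR ler_norm.
Qed.

Lemma cauchyE mu z : G mu z = cE mu (res z).
Proof. by []. Qed.

Lemma cauchy_sub mu z w : 0 < complex.Im z -> 0 < complex.Im w ->
  G mu w - G mu z = (z - w) * cE mu (fun x => (z - x%:C)^-1 * (w - x%:C)^-1).
Proof.
move=> z0 w0; rewrite !cauchyE -(cEB _ (ccb_res w0) (ccb_res z0)).
rewrite -(cEZ _ _ (ccbM (ccb_res z0) (ccb_res w0))); apply: eq_cE => x.
by field; rewrite (subR_neq0 x z0) (subR_neq0 x w0).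
Qed.

Lemma Im_res z x : complex.Im (z - x%:C)^-1 = - complex.Im z * normc (z - x%:C)^-1 ^+ 2.
Proof. by rewrite cImV Im_subR -{2}(Im_subR z x) -sqr_normcE normcV exprVn. Qed.

Lemma Im_cauchy mu z : 0 < complex.Im z ->
  complex.Im (G mu z) = - complex.Im z * \int[mu]_x (normc (z - x%:C)^-1 ^+ 2).
Proof.
move=> z0; rewrite /= -EcZ; last exact/cb_sqr_normc/ccb_res.
by apply: eq_Rintegral => x _; rewrite Im_res.
Qed.

Lemma Im_cauchy_lt0 mu z : 0 < complex.Im z -> complex.Im (G mu z) < 0.
Proof.
move=> z0; rewrite Im_cauchy // mulNr oppr_lt0 mulr_gt0 // Ec_gt0 //.
  exact/cb_sqr_normc/ccb_res.
by move=> x; rewrite exprn_gt0 // normc_gt0 invr_eq0 subR_neq0.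
Qed.

Lemma cauchy_neq0 mu z : 0 < complex.Im z -> G mu z != 0.
Proof. by move=> z0; apply: Im_neq0; rewrite lt_eqF // Im_cauchy_lt0. Qed.

(** Three uses of the resolvent identity leave the exact remainder [- h^3] times the integral of
    [(z - x)^-3 (z + h - x)^-1], which stays bounded while [|h| < Im z / 2]. *)
Lemma jet2_cauchy mu z : 0 < complex.Im z -> jet2 (G mu) z.
Proof.
move=> z0; have v2 : 0 < complex.Im z / 2 by rewrite divr_gt0.
have c1 := ccb_res z0; have c2 := ccbM c1 c1; have c3 := ccbM c1 c2.
exists (- cE mu (fun x => res z x * res z x)),
  (cE mu (fun x => res z x * (res z x * res z x))).
have Imh h : normc h < complex.Im z / 2 -> complex.Im z / 2 <= complex.Im (z + h).
  by move=> hz; have := Im_le_normc h; rewrite cImD ler_norml => /andP[H _]; lra.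
have Imh0 h : normc h < complex.Im z / 2 -> 0 < complex.Im (z + h).
  by move=> /Imh; exact: lt_le_trans.
pose r3 h := cE mu (fun x => res z x * (res z x * res z x) * res (z + h) x).
apply: (o2_local (u := fun h => - r3 h * h ^+ 3)).
  apply: o2_mul; last exact: o2_cube.
  exists ((complex.Im z)^-1 * ((complex.Im z)^-1 * (complex.Im z)^-1) * (complex.Im z / 2)^-1).
  exists (complex.Im z / 2); split => // h hz.
  have zh := Imh0 _ hz; have z1 := Imh _ hz.
  rewrite normc_opp; apply: normc_cE_bound => [|x].
    by apply: ccbM => //; exact: ccb_res.
  rewrite !normcM; apply: ler_pM; rewrite ?mulr_ge0 ?normc_ge0 //.
    apply: ler_pM; rewrite ?mulr_ge0 ?normc_ge0 ?normc_res //.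
    by apply: ler_pM; rewrite ?normc_ge0 ?normc_res.
  by rewrite (le_trans (normc_res _ zh)) // lef_pV2 ?posrE.
exists (complex.Im z / 2) => // h hz; have zh := Imh0 _ hz.
have shift f : ccb f -> cE mu (fun x => f x * res (z + h) x) =
    cE mu (fun x => f x * res z x) - h * cE mu (fun x => f x * res z x * res (z + h) x).
  move=> cf; have c4 := ccb_res zh.
  rewrite -(cEZ _ _ (ccbM (ccbM cf c1) c4)) -cEB; last 2 first.
  - exact: ccbM.
  - by apply: ccbZ; apply: ccbM => //; exact: ccbM.
  apply: eq_cE => x; have n1 := subR_neq0 x z0; have n2 := subR_neq0 x zh.
  by field; rewrite n1 n2.
have E1 := shift _ (ccb_cst 1); have E2 := shift _ c1; have E3 := shift _ c2.
have -> : G mu (z + h) = cE mu (fun x => 1 * res (z + h) x).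
  by rewrite cauchyE; apply: eq_cE => x; rewrite mul1r.
have e1 : cE mu (fun x => 1 * res z x) = G mu z.
  by rewrite cauchyE; apply: eq_cE => x; rewrite mul1r.
have e2 : cE mu (fun x => 1 * res z x * res (z + h) x) = cE mu (fun x => res z x * res (z + h) x).
  by apply: eq_cE => x; rewrite mul1r.
have e3 : cE mu (fun x => res z x * (res z x * res z x)) =
   cE mu (fun x => res z x * res z x * res z x).
  by apply: eq_cE => x; rewrite mulrA.
have e4 : r3 h = cE mu (fun x => res z x * res z x * res z x * res (z + h) x).
  by apply: eq_cE => x; rewrite !mulrA.
rewrite E1 e1 e2 E2 E3 e3 e4; ring.
Qed.

Lemma jet2_recip mu z : 0 < complex.Im z -> jet2 (F mu) z.
Proof. by move=> z0; apply: jet2V; [exact: cauchy_neq0|exact: jet2_cauchy]. Qed.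

(** Inverses of [F] are studied at points of cones of aperture 1; preimages deviate slightly from
    their images, and aperture 2 leaves room for them. *)
Definition sector b z := b <= complex.Im z /\ `|complex.Re z| <= 2 * complex.Im z.

Lemma sector_Im b z : 0 < b -> sector b z -> 0 < complex.Im z.
Proof. by move=> b0 [bz _]; exact: lt_le_trans bz. Qed.

(** One bound on [|x| / |z - x|] comes from [|x| <= |Re z| + |Re z - x|], both terms being
    controlled by [|z - x|]; the other from [|z - x| >= Im z >= b]. *)
Lemma normc_trunc a b z x : 0 <= a -> 0 < b -> b <= complex.Im z ->
  `|complex.Re z| <= a * complex.Im z ->
  normc (x%:C / (z - x%:C)) <= (1 + a) * trunc b x.
Proof.
move=> a0 b0 bz zz; have z0 : 0 < complex.Im z := lt_le_trans b0 bz.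
have a1 : 0 <= 1 + a by rewrite addr_ge0.
have n0 : 0 < normc (z - x%:C) by rewrite normc_gt0 subR_neq0.
have Imn : complex.Im z <= normc (z - x%:C).
  by rewrite (le_trans _ (Im_le_normc _)) // Im_subR ler_norm.
rewrite normcM normcR normcV /trunc minr_pMr // mulr1 le_min; apply/andP; split.
  rewrite ler_pdivrMr // mulrDl mul1r.
  have := Re_le_normc (z - x%:C); rewrite cReB /= => Ren.
  have -> : x = complex.Re z - (complex.Re z - x) by ring.
  rewrite (le_trans (ler_normB _ _)) // addrC lerD //.
    by rewrite (_ : complex.Re z - (complex.Re z - x) = x) //; ring.
  rewrite (_ : complex.Re z - (complex.Re z - x) = x); last by ring.
  by rewrite (le_trans zz) // ler_wpM2l.
rewrite mulrCA ler_wpM2l // -[X in X <= _]mul1r ler_pM // ?invr_ge0 ?normc_ge0 //.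
  by rewrite lerDl.
by rewrite lef_pV2 ?posrE // (le_trans bz).
Qed.

Lemma ccb_ratio z : 0 < complex.Im z -> ccb (fun x => x%:C / (z - x%:C)).
Proof.
move=> z0; have -> : (fun x : R => x%:C / (z - x%:C)) = (fun x => z * (z - x%:C)^-1 - 1).
  by apply/funext => x; field; exact: subR_neq0.
by apply: ccbB; [apply: ccbZ; exact: ccb_res|exact: ccb_cst].
Qed.

(** The difference is the integral of [x / (z - x)], so [normc_trunc] controls it by the tail alone,
    uniformly over the cone. *)
Lemma cauchy_near1_aperture mu a b z : 0 <= a -> 0 < b -> b <= complex.Im z ->
  `|complex.Re z| <= a * complex.Im z ->
  normc (z * G mu z - 1) <= (1 + a) * tail mu b.
Proof.
move=> a0 b0 bz zz; have z0 : 0 < complex.Im z := lt_le_trans b0 bz.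
have -> : z * G mu z - 1 = cE mu (fun x => x%:C / (z - x%:C)).
  rewrite cauchyE -(cEZ _ _ (ccb_res z0)) -[X in _ - X](cE_cst mu 1) -cEB; last 2 first.
  - exact/ccbZ/ccb_res.
  - exact: ccb_cst.
  by apply: eq_cE => x; field; exact: subR_neq0.
rewrite /tail -EcZ; last exact: cb_trunc.
apply: normc_cE_le; [exact: ccb_ratio|exact/cbZ/cb_trunc|] => x.
exact: normc_trunc.
Qed.

Lemma cauchy_near1 mu b z : 0 < b -> sector b z -> normc (z * G mu z - 1) <= 3 * tail mu b.
Proof.
move=> b0 [bz zz]; have := cauchy_near1_aperture mu (ler0n _ 2) b0 bz zz.
by congr (_ <= _ * _); ring.
Qed.

(** With [p = x / (z - x)] and [q = x / (w - x)] the integrand is [p + q + p q]. The constant is 3 +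
    3 + 9, where [trunc <= 1] is used for the product. *)
Lemma cauchy2_near1 mu b z w : 0 < b -> sector b z -> sector b w ->
  normc (z * w * cE mu (fun x => (z - x%:C)^-1 * (w - x%:C)^-1) - 1) <= 15 * tail mu b.
Proof.
move=> b0 zb wb; have z0 := sector_Im b0 zb; have w0 := sector_Im b0 wb.
pose f x := x%:C / (z - x%:C) + x%:C / (w - x%:C) + x%:C / (z - x%:C) * (x%:C / (w - x%:C)).
have cz := ccb_ratio z0; have cw := ccb_ratio w0.
have cf : ccb f by apply: ccbD; [exact: ccbD|exact: ccbM].
have -> : z * w * cE mu (fun x => (z - x%:C)^-1 * (w - x%:C)^-1) - 1 = cE mu f.
  rewrite -(cEZ _ _ (ccbM (ccb_res z0) (ccb_res w0))) -[X in _ - X](cE_cst mu 1) -cEB; last 2 first.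
  - by apply: ccbZ; apply: ccbM; exact: ccb_res.
  - exact: ccb_cst.
  apply: eq_cE => x; rewrite /f; have n1 := subR_neq0 x z0; have n2 := subR_neq0 x w0.
  by field; rewrite n1 n2.
rewrite /tail -EcZ; last exact: cb_trunc.
apply: normc_cE_le => // [|x]; first exact/cbZ/cb_trunc.
have H1 := normc_trunc x (ler0n _ 2) b0 zb.1 zb.2.
have H2 := normc_trunc x (ler0n _ 2) b0 wb.1 wb.2.
rewrite /f (le_trans (normc_leD _ _)) // (le_trans (lerD (normc_leD _ _) (lexx _))) //.
rewrite (normcM (x%:C / _) (x%:C / _)).
have t0 := trunc_ge0 x b0; have t1 : trunc b x <= 1 by rewrite ge_min lexx.
have := normc_ge0 (x%:C / (z - x%:C)); have := normc_ge0 (x%:C / (w - x%:C)).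
move: (normc _) (normc _) (trunc b x) H1 H2 t0 t1 => p q t *; nra.
Qed.

End CauchyTransform.

(** * Inverting the reciprocal Cauchy transform *)

Section ReciprocalCauchy.
Variable R : realType.
Implicit Types (mu nu : prob R) (z w h : R[i]) (x b : R).

Local Notation G := cauchy_transform.
Local Notation F := recip_cauchy.

(** The constant turns the bounds [3 * tail] and [15 * tail] on Cauchy transforms into 1/80 and
    1/16, enough to make [F] a small Lipschitz perturbation of the identity on [sector b]. *)
Definition small_tail mu b := 0 < b /\ tail mu b <= 240^-1.

Lemma small_tail_le mu b c : small_tail mu b -> b <= c -> small_tail mu c.
Proof.
move=> [b0 tb] bc; split; first exact: lt_le_trans bc.
exact: le_trans (tail_antimono _ b0 bc) tb.
Qed.

Lemma sector_le b c z : b <= c -> sector c z -> sector b z.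
Proof. by move=> bc [cz zz]; split => //; exact: le_trans cz. Qed.

Lemma recip_near mu b z : small_tail mu b -> sector b z ->
  normc (F mu z - z) <= 4 * tail mu b * normc z.
Proof.
move=> [b0 tb] zb; have z0 := sector_Im b0 zb.
have H := cauchy_near1 mu b0 zb; set p := z * G mu z - 1 in H.
have G0 := cauchy_neq0 mu z0.
have zn : z != 0 by apply: Im_neq0; rewrite gt_eqF.
have -> : F mu z - z = z * (- p / (1 + p)).
  rewrite /p addrCA subrr addr0 /recip_cauchy; field.
  by rewrite G0 zn.
rewrite normcM mulrC ler_wpM2r ?normc_ge0 // normcM normc_opp normcV.
have t0 := tail_ge0 mu b0.
have L : 79 / 80 <= normc (1 + p).
  have := normc_geB 1 (- p); rewrite opprK normc_opp normc1 => ?; lra.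
rewrite ler_pdivrMr; last by lra.
have := normc_ge0 p; nra.
Qed.

(** By [cauchy_sub] the difference quotient of [F] is [M / (G z * G w)], with [M] the integral of
    the product of the two resolvents; [cauchy_near1] and [cauchy2_near1] put it within 1/10 of 1.
    Injectivity, expansion and surjectivity of [F] rest on this. *)
Lemma recip_lipschitz mu b z w : small_tail mu b -> sector b z -> sector b w ->
  normc (F mu z - F mu w - (z - w)) <= normc (z - w) / 10.
Proof.
move=> [b0 tb] zb wb; have z0 := sector_Im b0 zb; have w0 := sector_Im b0 wb.
have H1 := cauchy_near1 mu b0 zb; set p := z * G mu z - 1 in H1.
have H2 := cauchy_near1 mu b0 wb; set q := w * G mu w - 1 in H2.
have H3 := cauchy2_near1 mu b0 zb wb.
have S := cauchy_sub mu z0 w0.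
set M := cE mu _ in H3 S; set m := z * w * M - 1 in H3.
have Gz := cauchy_neq0 mu z0; have Gw := cauchy_neq0 mu w0.
have zn : z != 0 by apply: Im_neq0; rewrite gt_eqF.
have wn : w != 0 by apply: Im_neq0; rewrite gt_eqF.
have -> : F mu z - F mu w - (z - w) = (z - w) * ((m - p - q - p * q) / ((1 + p) * (1 + q))).
  transitivity ((G mu w - G mu z) / (G mu z * G mu w) - (z - w)).
    by rewrite /recip_cauchy; field; rewrite Gz Gw.
  have -> : 1 + p = z * G mu z by rewrite /p; ring.
  have -> : 1 + q = w * G mu w by rewrite /q; ring.
  rewrite S /m /p /q; field.
  by rewrite zn wn Gz Gw.
have t0 := tail_ge0 mu b0.
have L1 : 79 / 80 <= normc (1 + p).
  have := normc_geB 1 (- p); rewrite opprK normc_opp normc1 => ?; lra.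
have L2 : 79 / 80 <= normc (1 + q).
  have := normc_geB 1 (- q); rewrite opprK normc_opp normc1 => ?; lra.
rewrite normcM ler_wpM2l ?normc_ge0 // normcM normcV normcM.
have pq := normc_ge0 p; have qq := normc_ge0 q.
have U : normc (m - p - q - p * q) <= 1 / 16 + 2 / 80 + 1 / 6400.
  rewrite (le_trans (normc_leB _ _)) // normcM.
  have A := normc_leB (m - p) q; have B := normc_leB m p.
  have : normc p * normc q <= 1 / 80 * (1 / 80) by apply: ler_pM => //; lra.
  lra.
rewrite ler_pdivrMr; last by apply: mulr_gt0; lra.
apply: (le_trans U).
have : 79 / 80 * (79 / 80) <= normc (1 + p) * normc (1 + q) by apply: ler_pM => //; lra.
lra.
Qed.

Lemma recip_expand mu b z w : small_tail mu b -> sector b z -> sector b w ->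
  9 / 10 * normc (z - w) <= normc (F mu z - F mu w).
Proof.
move=> sb zb wb; have := recip_lipschitz sb zb wb.
rewrite normc_distC; have := normc_geB (z - w) (F mu z - F mu w); lra.
Qed.

Lemma recip_inj mu b z w : small_tail mu b -> sector b z -> sector b w ->
  F mu z = F mu w -> z = w.
Proof.
move=> sb zb wb e; have := recip_expand sb zb wb; rewrite e subrr.
have -> : normc (0 : R[i]) = 0 := @normc0 R.
move=> H; apply/eqP; rewrite -subr_eq0 -normc_eq0 eq_le normc_ge0 andbT; lra.
Qed.

Local Notation TC := (@truncated_cone R).

Lemma cone_normc c z : TC 1 c z -> normc z <= 2 * complex.Im z.
Proof.
move=> [_]; rewrite mul1r => zz; rewrite (le_trans (normc_le_ReIm _)) //.
have z0 : 0 < complex.Im z by rewrite (le_lt_trans _ zz).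
by rewrite (gtr0_norm z0); lra.
Qed.

Lemma cone_Im c z : TC 1 c z -> 0 < complex.Im z.
Proof. by move=> [_]; rewrite mul1r; exact: le_lt_trans. Qed.

(** In the cone [normc z <= 2 * Im z], so each coordinate moves by at most [Im z / 8]. *)
Lemma cone_square c z w : TC 1 c z -> square z (normc z / 16) w ->
  TC 2 (complex.Im z / 2) w.
Proof.
move=> zc [w1 w2]; have := cone_normc zc; have z0 := cone_Im zc.
case: zc => _; rewrite mul1r => zz nz.
move: w1 w2; rewrite cReB cImB !ler_norml => /andP[u1 u2] /andP[v1 v2].
move: zz; rewrite ltr_norml => /andP[a1 a2].
split; first lra.
by rewrite ltr_norml; apply/andP; split; lra.
Qed.

Lemma cone_sector b z : TC 2 b z -> sector b z.
Proof. by move=> [bz zz]; split; exact: ltW. Qed.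

(** A minimizer [w] of [|F v - z|] over a square about [z] is a solution: the corrected point
    [w - (F w - z)] is still in the square, and its residual is at most a tenth of that of [w]. *)
Lemma recip_surj mu z : 0 < complex.Im z -> TC 1 0 z -> small_tail mu (complex.Im z / 2) ->
  exists w, [/\ TC 2 (complex.Im z / 2) w, F mu w = z &
    normc (w - z) <= 5 * tail mu (complex.Im z / 2) * normc z].
Proof.
move=> z0 zc sb; have b0 : 0 < complex.Im z / 2 by rewrite divr_gt0.
have zn : 0 < normc z by rewrite normc_gt0 Im_neq0 // gt_eqF.
have r0 : 0 < normc z / 16 by rewrite divr_gt0.
have tc w := @cone_square 0 z w zc.
have sec w (wQ : square z (normc z / 16) w) := cone_sector (tc w wQ).
have zz : square z (normc z / 16) z.
  by split; rewrite subrr /= normr0 ltW.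
have [w wQ wmin] : exists2 w, square z (normc z / 16) w &
    forall v, square z (normc z / 16) v -> - normc (F mu v - z) <= - normc (F mu w - z).
  apply: square_EVT => // v e vQ e0.
  have [d d0 H] := jet2_cont (jet2_recip mu (sector_Im b0 (sec _ vQ))) e0.
  exists d => // h /H; apply: le_lt_trans.
  rewrite opprK addrC ler_norml; apply/andP; split.
    rewrite lerNl opprB (le_trans (normc_geB _ _)) //.
    by rewrite le_eqVlt; apply/orP; left; apply/eqP; congr normc; ring.
  rewrite (le_trans (normc_geB _ _)) // normc_distC.
  by rewrite le_eqVlt; apply/orP; left; apply/eqP; congr normc; ring.
have t0 := tail_ge0 mu b0.
have Hz := recip_near sb (sec _ zz).
have tb := sb.2.
have Hw := wmin _ zz; rewrite lerN2 in Hw.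
(* Here [4 / 240 = 1 / 60]; two such residuals divided by 9/10 give 1/27, and
   [1 / 27 + 1 / 60 < 1 / 16] keeps the corrected point in the square. *)
have dz : normc (F mu z - z) <= normc z / 60 by nra.
have wz : normc (w - z) <= normc z / 27.
  have := recip_expand sb (sec _ wQ) (sec _ zz).
  have := normc_leB (F mu w - z) (F mu z - z).
  have -> : F mu w - z - (F mu z - z) = F mu w - F mu z by ring.
  lra.
pose w' := w - (F mu w - z).
have w'Q : square z (normc z / 16) w'.
  have H : normc (w' - z) <= normc z / 16.
    have -> : w' - z = (w - z) - (F mu w - z) by rewrite /w'; ring.
    by rewrite (le_trans (normc_leB _ _)) //; lra.
  by split; rewrite (le_trans _ H) ?Re_le_normc ?Im_le_normc.
have Hw' := wmin _ w'Q; rewrite lerN2 in Hw'.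
have := recip_lipschitz sb (sec _ w'Q) (sec _ wQ).
have -> : w' - w = - (F mu w - z) by rewrite /w'; ring.
have -> : F mu w' - F mu w - - (F mu w - z) = F mu w' - z by ring.
rewrite normc_opp => H.
have Fwz : F mu w = z.
  apply/eqP; rewrite -subr_eq0 -normc_eq0 eq_le normc_ge0 andbT.
  by have := normc_ge0 (F mu w - z); lra.
exists w; split => //; first exact: tc.
have := recip_near sb (sec _ wQ); rewrite Fwz normc_distC => H5.
have wn : normc w <= 28 / 27 * normc z.
  have -> : w = (w - z) + z by ring.
  by rewrite (le_trans (normc_leD _ _)) //; lra.
rewrite (le_trans H5) //; nra.
Qed.

(** The selecting condition involves the height of [z] but no cutoff for [mu], so one inverse serves
    all cutoffs. The default 0 is taken only where no preimage exists, which does not happen high in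
    the cone. *)
Definition recip_inverse mu z : R[i] :=
  xget 0 [set w | TC 2 (complex.Im z / 2) w /\ F mu w = z].

Definition vphi mu z : R[i] := recip_inverse mu z - z.

Lemma cone_weaken c d z : d <= c -> TC 1 c z -> TC 1 d z.
Proof. by move=> dc [cz zz]; split => //; exact: le_lt_trans cz. Qed.

(** The factor 2 in the cone makes [Im z / 2], the height guaranteed for the preimage, at least
    [b]. *)
Lemma recip_inverseP mu b z : small_tail mu b -> TC 1 (2 * b) z ->
  [/\ TC 2 (complex.Im z / 2) (recip_inverse mu z), F mu (recip_inverse mu z) = z,
   sector b (recip_inverse mu z) &
   normc (vphi mu z) <= 5 * tail mu (complex.Im z / 2) * normc z].
Proof.
move=> sb zc; have z0 := cone_Im zc.
have bz : b <= complex.Im z / 2 by case: zc => /ltW ? _; lra.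
have sz := small_tail_le sb bz.
have zc0 : TC 1 0 z by apply: cone_weaken zc; rewrite mulr_ge0 // ltW // sb.1.
have [w [w1 w2 w3]] := recip_surj z0 zc0 sz.
have [v1 v2] : TC 2 (complex.Im z / 2) (recip_inverse mu z) /\ F mu (recip_inverse mu z) = z.
  by rewrite /recip_inverse; case: xgetP => [v -> //|/(_ w)]; case.
have e : recip_inverse mu z = w by apply: (recip_inj sz); rewrite ?v2 //; exact: cone_sector.
split => //; first exact: sector_le bz (cone_sector v1).
by rewrite /vphi e.
Qed.

Lemma recip_inverse_unique mu b z w : small_tail mu b -> TC 1 (2 * b) z ->
  sector b w -> F mu w = z -> w = recip_inverse mu z.
Proof.
move=> sb zc wb wz; have [_ e s _] := recip_inverseP sb zc.
by apply: (recip_inj sb) => //; rewrite e.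
Qed.

Lemma recip_inverse_lipschitz mu b z w : small_tail mu b -> TC 1 (2 * b) z -> TC 1 (2 * b) w ->
  normc (recip_inverse mu z - recip_inverse mu w) <= 10 / 9 * normc (z - w).
Proof.
move=> sb zc wc; have [_ ez sz _] := recip_inverseP sb zc.
have [_ ew sw _] := recip_inverseP sb wc.
have := recip_expand sb sz sw; rewrite ez ew; lra.
Qed.

Lemma vphi_lipschitz mu b z w : small_tail mu b -> TC 1 (2 * b) z -> TC 1 (2 * b) w ->
  normc (vphi mu z - vphi mu w) <= normc (z - w).
Proof.
move=> sb zc wc; have [_ ez sz _] := recip_inverseP sb zc.
have [_ ew sw _] := recip_inverseP sb wc.
have := recip_lipschitz sb sz sw; rewrite ez ew.
have := recip_inverse_lipschitz sb zc wc.
have -> : vphi mu z - vphi mu w = - (z - w - (recip_inverse mu z - recip_inverse mu w)).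
  by rewrite /vphi; ring.
rewrite normc_opp; have := normc_ge0 (z - w); lra.
Qed.

Lemma cone_open a c z : TC a c z -> 0 < a -> exists2 d, 0 < d &
  forall h, normc h < d -> TC a c (z + h).
Proof.
move=> [cz zz] a0; pose s := Num.min (complex.Im z - c) ((a * complex.Im z - `|complex.Re z|) / (1 + a)).
have a1 : 0 < 1 + a by lra.
have s0 : 0 < s by rewrite lt_min subr_gt0 cz divr_gt0 // subr_gt0.
exists s => // h; rewrite lt_min ltr_pdivlMr // => /andP[h1 h2].
have := Re_le_normc h; have := Im_le_normc h.
rewrite ler_norml => /andP[i1 i2] r.
split; rewrite ?cReD cImD; first lra.
rewrite (le_lt_trans (ler_normD _ _)) //; nra.
Qed.

Lemma jet2_recip_inverse mu b z : small_tail mu b -> TC 1 (2 * b) z ->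
  jet2 (recip_inverse mu) z.
Proof.
move=> sb zc; have [_ ez sz _] := recip_inverseP sb zc.
apply: (@jet2_inverse _ (F mu) _ _ (10 / 9)) => //.
  have [d d0 H] := cone_open zc ltr01; exists d => // h /H hc.
  have [_ eh _ _] := recip_inverseP sb hc; split => //.
  have := recip_inverse_lipschitz sb hc zc; congr (_ <= _ * normc _); ring.
by apply: jet2_recip; exact: sector_Im sb.1 sz.
Qed.

Lemma jet2_vphi mu b z : small_tail mu b -> TC 1 (2 * b) z -> jet2 (vphi mu) z.
Proof. by move=> sb zc; apply: jet2B; [exact: jet2_recip_inverse zc|exact: jet2_id]. Qed.

Lemma wcvg_cauchy (m : nat -> prob R) l z : wcvg m l -> 0 < complex.Im z ->
  ccvg (fun n => G (m n) z) (G l z).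
Proof. by move=> ml z0; rewrite cauchyE; apply: wcvg_cE => //; exact: ccb_res. Qed.

Lemma wcvg_recip (m : nat -> prob R) l z : wcvg m l -> 0 < complex.Im z ->
  ccvg (fun n => F (m n) z) (F l z).
Proof. by move=> ml z0; apply: ccvgV; [exact: cauchy_neq0|exact: wcvg_cauchy]. Qed.

(** At the limiting preimage [w], [F (m n) w] tends to [z]; the expansion bound for [F (m n)],
    uniform in [n], then pulls [recip_inverse (m n) z] to [w]. *)
Lemma wcvg_recip_inverse (m : nat -> prob R) l b z : wcvg m l -> small_tail l b ->
  (\forall n \near \oo, small_tail (m n) b) -> TC 1 (2 * b) z ->
  ccvg (fun n => recip_inverse (m n) z) (recip_inverse l z).
Proof.
move=> ml sl sm zc; have [_ ez sz _] := recip_inverseP sl zc.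
set w := recip_inverse l z in ez sz *.
have w0 := sector_Im sl.1 sz.
have H := ccvg_dist (wcvg_recip ml w0); rewrite ez in H.
apply: (ccvg_squeeze (a := fun n => 10 / 9 * normc (F (m n) w - z))).
  apply: filterS sm => n sn.
  have [_ en sn' _] := recip_inverseP sn zc.
  have := recip_expand sn sn' sz; rewrite en normc_distC.
  rewrite (normc_distC z); lra.
by rewrite -(mulr0 (10 / 9)); apply: cvgM => //; exact: cvg_cst.
Qed.

Lemma recip_inverse_square mu b z w : small_tail mu b -> TC 1 (2 * b) z ->
  square z (normc z / 16) w -> F mu w = z -> w = recip_inverse mu z.
Proof.
move=> sb zc wQ; apply: (recip_inverse_unique sb zc).
apply: (sector_le (c := complex.Im z / 2)); last exact: cone_sector (cone_square zc wQ).
by case: zc => /ltW ? _; lra.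
Qed.
End ReciprocalCauchy.

(** * Functions near infinity on truncated cones *)
Section Cones.
Variable R : realType.
Implicit Types (f : R[i] -> R[i]) (z w : R[i]) (a b c l : R).
Local Notation TC := (@truncated_cone R).

Lemma cone_sub a b a' b' z : 0 <= b -> a <= a' -> b' <= b -> TC a b z -> TC a' b' z.
Proof.
move=> b0 aa bb [bz az]; split; first exact: le_lt_trans bz.
by rewrite (lt_le_trans az) // ler_wpM2r // (le_trans b0) // ltW.
Qed.

Lemma cone_scale a b l z : 0 < l -> TC a b (z / l%:C) <-> TC a (l * b) z.
Proof.
move=> l0; rewrite /truncated_cone /= cReVZ cImVZ normrM (gtr0_norm (x := l^-1)) ?invr_gt0 //.
by rewrite ltr_pdivlMr // mulrA ltr_pM2r ?invr_gt0 // (mulrC l).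
Qed.

(** Convexity of the cone in coordinates: both endpoints [i y] and [u1 + i v1] have slack [s], and
    [u + i v] is within [rho] of a point of their segment. [A] stands for [|u1|]. *)
Lemma convex_slack a b t y u1 v1 u v A rho s : 0 < a -> 0 < rho ->
  rho * (2 * (1 + a)) = s -> 0 <= t -> t <= 1 ->
  s <= a * v1 - A -> s <= v1 - b -> s <= a * y - 0 -> s <= y - b ->
  - u1 <= A -> u1 <= A ->
  - rho <= u - (0 + t * (u1 - 0)) -> u - (0 + t * (u1 - 0)) <= rho ->
  - rho <= v - (y + t * (v1 - y)) -> b < v /\ `|u| < a * v.
Proof.
move=> a0 r0 rs t0 t1 k1 k2 k3 k4 uA1 uA2 p1 p2 q1.
have tt : 0 <= 1 - t by lra.
have m1 := ler_wpM2l t0 k1; have m2 := ler_wpM2l t0 k2.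
have m3 := ler_wpM2l tt k3; have m4 := ler_wpM2l tt k4.
have m5 := ler_wpM2l t0 uA1; have m6 := ler_wpM2l t0 uA2.
have ar : 0 < a * rho by exact: mulr_gt0.
have aq1 : a * - rho <= a * (v - (y + t * (v1 - y))) by rewrite ler_wpM2l // ltW.
split; first by lra.
by rewrite ltr_norml; apply/andP; split; lra.
Qed.

(** A point high on the imaginary axis lies in both cones. The segment from it to [z1] keeps a
    positive distance from the boundary of the convex cone, so squares of one size fit along it. *)
Lemma identity_cone f a b a' b' : 0 < a -> 0 < a' -> (forall z, TC a b z -> jet2 f z) ->
  (forall z, TC a' b' z -> f z = 0) -> forall z, TC a b z -> f z = 0.
Proof.
move=> a0 a'0 jf f0 z1 z1c.
pose y := Num.max 1 (Num.max (b + 1) (b' + 1)).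
have y0 : 0 < y by rewrite lt_max ltr01.
have yb : b < y by rewrite !lt_max ltrDl ltr01 /= orbT.
have yb' : b' < y by rewrite !lt_max [b' < b' + 1]ltrDl ltr01 !orbT.
pose z0 : R[i] := 0 +i* y.
have z0c : TC a b z0 by split => //=; rewrite normr0 mulr_gt0.
have z0c' : TC a' b' z0 by split => //=; rewrite normr0 mulr_gt0.
have [d d0 Hd] := cone_open z0c' a'0.
pose sl z : R := Num.min (complex.Im z - b) (a * complex.Im z - `|complex.Re z|).
have slL z : sl z <= complex.Im z - b by rewrite /sl ge_min le_refl.
have slR z : sl z <= a * complex.Im z - `|complex.Re z| by rewrite /sl ge_min le_refl orbT.
have sl0 z : TC a b z -> 0 < sl z.
  by move=> [bz az]; rewrite lt_min !subr_gt0 bz.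
pose s := Num.min (sl z0) (sl z1).
have s0 : 0 < s by rewrite lt_min !sl0.
have [s1 s2] : s <= sl z0 /\ s <= sl z1 by split; rewrite /s ge_min lexx ?orbT.
have ri : 0 < s / (2 * (1 + a)) by rewrite divr_gt0 // mulr_gt0 //; lra.
apply: (identity_segment (z0 := z0) (d := d) ri d0); last first.
  move=> z zd; apply: f0; have -> : z = z0 + (z - z0) by rewrite addrC subrK. exact: Hd.
move=> t z /andP[t0 t1] [q1 q2]; apply: jf.
set rho := s / _ in ri q1 q2.
have rs : rho * (2 * (1 + a)) = s by rewrite /rho divfK // gt_eqF // mulr_gt0 //; lra.
have : s <= complex.Im z0 - b by exact: le_trans s1 (slL _).
have : s <= a * complex.Im z0 - `|complex.Re z0| by exact: le_trans s1 (slR _).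
have : s <= complex.Im z1 - b by exact: le_trans s2 (slL _).
have : s <= a * complex.Im z1 - `|complex.Re z1| by exact: le_trans s2 (slR _).
rewrite /z0 /= normr0 => k1 k2 k3 k4.
move: q1 q2; rewrite cReB cImB cReD cImD cReZ cImZ cReB cImB /=.
have := ler_norm (complex.Re z1); have := ler_norm (- complex.Re z1); rewrite normrN.
rewrite !ler_norml => uA1 uA2 /andP[p1 p2] /andP[q1 q2].
have [q p] := convex_slack a0 ri rs t0 t1 k1 k2 k3 k4 uA1 uA2 p1 p2 q1.
by split.
Qed.
End Cones.

(** * The abstract structure for functions on truncated cones *)

Section ConeDomain.
Variables (R : realType) (S : Prop).
Local Notation TC := (@truncated_cone R).
Local Notation M := (R[i] -> R[i]).
Implicit Types (x y : M) (X Y : nat -> M) (z w : R[i]) (l : R).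

Definition addK x y : M := fun z => x z + y z.
Definition scK l x : M := fun z => l%:C * x (z / l%:C).
(** The cone may depend on the pair, as domains of Voiculescu transforms do. Being real, the shift
    is invisible to imaginary parts, from which the bounds on scales are drawn. *)
Definition eqvK x y := exists2 d : R, (S -> d = 0) &
  exists a b : R, [/\ 0 < a, 0 < b & forall z, TC a b z -> x z = y z + d%:C].

(** The uniform estimates that tightness provides for large [n]. The Lipschitz bound permits
    evaluation of [X n] at moving points, and the uniform [o(z)] bound controls scales that tend to
    zero or infinity. *)
Definition regK X := exists b L : R, exists N : nat, [/\ 0 < b, 0 < L,
  forall n, (N <= n)%N -> (forall z, TC 1 b z -> jet2 (X n) z) /\
    (forall z w, TC 1 b z -> TC 1 b w -> normc (X n z - X n w) <= L * normc (z - w)) &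
  forall e : R, 0 < e -> exists (B : R) (N' : nat), 0 < B /\
    forall n z, (N' <= n)%N -> TC 1 B z -> normc (X n z) <= e * normc z].

Definition cvK X x := regK X /\ exists2 b : R, 0 < b & forall z, TC 1 b z -> ccvg (fun n => X n z) (x z).

(** The sign that [Im z < Im (F z)] gives to both transforms of a law that is not a point mass. *)
Definition nondegK x := exists2 b : R, 0 < b & forall z, TC 1 b z -> complex.Im (x z) < 0.

Lemma regK_add X Y : regK X -> regK Y -> regK (fun n => addK (X n) (Y n)).
Proof.
move=> [b [L [N [b0 L0 HX oX]]]] [b' [L' [N' [b0' L0' HY oY]]]].
exists (Num.max b b'), (L + L'), (maxn N N'); split; first by rewrite lt_max b0.
- exact: addr_gt0.
- move=> n; rewrite geq_max => /andP[/HX [jX lX] /HY [jY lY]].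
  have w1 z : TC 1 (Num.max b b') z -> TC 1 b z by apply: cone_weaken; rewrite le_max lexx.
  have w2 z : TC 1 (Num.max b b') z -> TC 1 b' z by apply: cone_weaken; rewrite le_max lexx orbT.
  split=> [z zc|z w zc wc]; first by apply: jet2D; [exact/jX/w1|exact/jY/w2].
  have -> : addK (X n) (Y n) z - addK (X n) (Y n) w = (X n z - X n w) + (Y n z - Y n w).
    by rewrite /addK; ring.
  by rewrite (le_trans (normc_leD _ _)) // mulrDl lerD // ?lX ?lY //; auto.
- move=> e e0; have e2 : 0 < e / 2 by rewrite divr_gt0.
  have [B [n1 [B0 H1]]] := oX _ e2; have [B' [n2 [B0' H2]]] := oY _ e2.
  exists (Num.max B B'), (maxn n1 n2); split; first by rewrite lt_max B0.
  move=> n z; rewrite geq_max => /andP[Hn1 Hn2] zc.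
  rewrite (le_trans (normc_leD _ _)) // [e]splitr mulrDl lerD //.
    by apply: H1 => //; apply: cone_weaken zc; rewrite le_max lexx.
  by apply: H2 => //; apply: cone_weaken zc; rewrite le_max lexx orbT.
Qed.

Lemma cvK_add X Y x y : cvK X x -> cvK Y y -> cvK (fun n => addK (X n) (Y n)) (addK x y).
Proof.
move=> [rX [b b0 HX]] [rY [b' b0' HY]]; split; first exact: regK_add.
exists (Num.max b b'); first by rewrite lt_max b0.
move=> z zc; apply: ccvgD; [apply: HX|apply: HY].
- by apply: cone_weaken zc; rewrite le_max lexx.
- by apply: cone_weaken zc; rewrite le_max lexx orbT.
Qed.

Lemma regK_sc (A : nat -> R) x K : regK (fun=> x) -> (forall n, 0 < A n) ->
  (\forall n \near \oo, A n <= K) -> regK (fun n => scK (A n) x).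
Proof.
move=> [b [L [N [b0 L0 Hx ox]]]] A0 [N1 _ AK].
have [jx lx] := Hx N (leqnn N).
have K0 : 0 < K by apply: lt_le_trans (A0 N1) (AK _ (leqnn _)).
have zA B n z : 0 < B -> (N1 <= n)%N -> TC 1 (K * B) z -> TC 1 B (z / (A n)%:C).
  move=> B0 /AK AnK zc; apply/cone_scale => //; apply: cone_weaken zc.
  by rewrite ler_wpM2r // ltW.
exists (K * b), L, N1; split => //; first exact: mulr_gt0.
- move=> n Nn; split=> [z zc|z w zc wc].
    by apply: jet2Z; apply: jet2_scale => //; apply: jx; exact: zA.
  rewrite /scK -mulrBr normcM normcR (gtr0_norm (A0 n)).
  have := lx _ _ (zA b n z b0 Nn zc) (zA b n w b0 Nn wc).
  rewrite -mulrBl normcM normcV normcR (gtr0_norm (A0 n)) mulrA ler_pdivlMr // mulrC //.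
- move=> e e0; have [B [n1 [B0 H]]] := ox _ e0.
  exists (K * B), N1; split; first exact: mulr_gt0.
  move=> n z Nn zc; rewrite /scK normcM normcR (gtr0_norm (A0 n)).
  have := H n1 _ (leqnn _) (zA B n z B0 Nn zc).
  by rewrite normcM normcV normcR (gtr0_norm (A0 n)) mulrA ler_pdivlMr // mulrC.
Qed.

Lemma ccvg_moving X (u : nat -> R[i]) z m (b L : R) N :
  (forall n, (N <= n)%N -> forall z w, TC 1 b z -> TC 1 b w ->
    normc (X n z - X n w) <= L * normc (z - w)) ->
  TC 1 b z -> ccvg (fun n => X n z) m -> ccvg u z -> ccvg (fun n => X n (u n)) m.
Proof.
move=> lX zc Xz uz; rewrite -[m](subrK m).
have -> : (fun n => X n (u n)) = fun n => (X n (u n) - X n z) + X n z.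
  by apply/funext => n; rewrite subrK.
apply: ccvgD => //; rewrite subrr.
have [d d0 Hd] := cone_open zc ltr01.
apply: (ccvg_squeeze (a := fun n => L * normc (u n - z))).
  near=> n; rewrite subr0; apply: lX => //; first by near: n; exact: nbhs_infty_ge.
  rewrite -(subrK z (u n)) addrC; apply: Hd.
  by near: n; apply: cvgr_lt (ccvg_dist uz) _ d0.
by rewrite -(mulr0 L); apply: cvgM; [exact: cvg_cst|exact: ccvg_dist].
Unshelve. all: by end_near.
Qed.

Lemma ccvg_div (A : nat -> R) (a : R) z : 0 < a -> A n @[n --> \oo] --> a ->
  ccvg (fun n => z / (A n)%:C) (z / a%:C).
Proof.
move=> a0 Aa; apply: ccvgM; first exact: ccvg_cst.
by apply: ccvgV; [rewrite realC_eq0 gt_eqF|exact: ccvgR].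
Qed.

Lemma cvK_sc (A : nat -> R) (a : R) x : (forall n, 0 < A n) -> 0 < a ->
  A n @[n --> \oo] --> a -> cvK (fun=> x) x -> cvK (fun n => scK (A n) x) (scK a x).
Proof.
move=> A0 a0 Aa [rx _]; split.
  apply: (regK_sc (K := a + 1)) => //.
  by apply: cvgr_le Aa _ _; rewrite ltrDl.
have [b [L [N [b0 L0 Hx _]]]] := rx.
exists (a * b); first exact: mulr_gt0.
move=> z zc; apply: ccvgM; first exact: ccvgR.
apply: (ccvg_moving (X := fun=> x) (z := z / a%:C) (b := b) (L := L) (N := N)).
- by move=> n /Hx[].
- by apply/cone_scale.
- exact: ccvg_cst.
- exact: ccvg_div.
Qed.

(** As [A n] tends to 0, the point [z / A n] runs to infinity in its cone; there [x] is small
    compared with its argument, so [A n * x (z / A n)] tends to 0. *)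
Lemma cvK_add0 (A : nat -> R) x : (forall n, 0 < A n) ->
  A n @[n --> \oo] --> 0 -> cvK (fun=> x) x -> cvK (fun n => addK x (scK (A n) x)) x.
Proof.
move=> A0 Aa [rx _]; have rA : regK (fun n => scK (A n) x).
  by apply: (regK_sc (K := 1)) => //; apply: cvgr_le Aa _ _.
split; first exact: (regK_add rx rA).
exists 1 => // z zc; rewrite -[x z]addr0; apply: ccvgD; first exact: ccvg_cst.
apply: ccvg_normc0; apply/cvgrPdist_le => e e0.
have zn : 0 < normc z by rewrite normc_gt0 Im_neq0 // gt_eqF // (cone_Im zc).
have [b [L [N [b0 L0 Hx ox]]]] := rx.
have [B [N' [B0 H]]] := ox _ (divr_gt0 e0 zn).
have zB : 0 < complex.Im z / B by rewrite divr_gt0 // (cone_Im zc).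
have AzB := cvgr_lt _ Aa _ zB.
near=> n; rewrite subr0 sub0r normrN ger0_norm ?normc_ge0 //.
have zA : TC 1 B (z / (A n)%:C).
  apply/cone_scale => //; split; last by case: zc.
  by rewrite -ltr_pdivlMr //; near: n; exact: AzB.
have := H N' _ (leqnn _) zA.
rewrite normcM normcV !normcR (gtr0_norm (A0 n)) mulrA ler_pdivlMr // [X in X <= _]mulrC.
by rewrite divfK ?gt_eqF // normcM normcR (gtr0_norm (A0 n)).
Unshelve. all: by end_near.
Qed.

Lemma nondegK_add x y : nondegK x -> nondegK y -> nondegK (addK x y).
Proof.
move=> [b b0 Hx] [b' b0' Hy]; exists (Num.max b b'); first by rewrite lt_max b0.
move=> z zc; rewrite cImD.
have : complex.Im (x z) < 0 by apply: Hx; apply: cone_weaken zc; rewrite le_max lexx.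
have : complex.Im (y z) < 0 by apply: Hy; apply: cone_weaken zc; rewrite le_max lexx orbT.
lra.
Qed.

Lemma nondegK_sc l x : 0 < l -> nondegK x -> nondegK (scK l x).
Proof.
move=> l0 [b b0 Hx]; exists (l * b); first exact: mulr_gt0.
by move=> z zc; rewrite cImZ pmulr_rlt0 //; apply: Hx; apply/cone_scale.
Qed.

Lemma eqvK_refl x : eqvK x x.
Proof. by exists 0 => //; exists 1, 1; split => // z _; rewrite addr0. Qed.

Lemma eqvK_sym x y : eqvK x y -> eqvK y x.
Proof.
move=> [d dS [a [b [a0 b0 H]]]]; exists (- d); first by move=> /dS ->; rewrite oppr0.
by exists a, b; split => // z /H ->; rewrite rmorphN addrK.
Qed.

Lemma eqvK_meet x y x' y' (d d' : R) :
  (exists a b : R, [/\ 0 < a, 0 < b & forall z, TC a b z -> x z = y z + d%:C]) ->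
  (exists a b : R, [/\ 0 < a, 0 < b & forall z, TC a b z -> x' z = y' z + d'%:C]) ->
  exists a b : R, [/\ 0 < a, 0 < b & forall z, TC a b z ->
    x z = y z + d%:C /\ x' z = y' z + d'%:C].
Proof.
move=> [a [b [a0 b0 H]]] [a' [b' [a0' b0' H']]].
exists (Num.min a a'), (Num.max b b'); split; first by rewrite lt_min a0.
  by rewrite lt_max b0.
have m0 : 0 <= Num.max b b' by rewrite le_max ltW.
move=> z zc; split; [apply: H|apply: H'].
- by apply: (cone_sub _ _ _ zc) => //; rewrite ?ge_min ?le_max lexx.
- by apply: (cone_sub _ _ _ zc) => //; rewrite ?ge_min ?le_max lexx orbT.
Qed.

Lemma eqvK_trans x y (y2 : M) : eqvK x y -> eqvK y y2 -> eqvK x y2.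
Proof.
move=> [d dS Hd] [e eS He]; exists (d + e); first by move=> s; rewrite dS ?eS ?addr0.
have [a [b [a0 b0 H]]] := eqvK_meet Hd He.
exists a, b; split => // w /H[-> ->]; rewrite rmorphD /=; ring.
Qed.

Lemma eqvK_add x y x' y' : eqvK x x' -> eqvK y y' -> eqvK (addK x y) (addK x' y').
Proof.
move=> [d dS Hd] [e eS He]; exists (d + e); first by move=> s; rewrite dS ?eS ?addr0.
have [a [b [a0 b0 H]]] := eqvK_meet Hd He.
by exists a, b; split => // w /H[]; rewrite /addK rmorphD /= => -> ->; ring.
Qed.

Lemma eqvK_sc l x y : 0 < l -> eqvK x y -> eqvK (scK l x) (scK l y).
Proof.
move=> l0 [d dS [a [b [a0 b0 H]]]]; exists (l * d); first by move=> /dS ->; rewrite mulr0.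
exists a, (l * b); split => //; first exact: mulr_gt0.
by move=> z zc; rewrite /scK H; [rewrite rmorphM /= mulrDr|apply/cone_scale].
Qed.

Lemma eqK_eqv x y : x =1 y -> eqvK x y.
Proof. by move=> /funext ->; exact: eqvK_refl. Qed.

Lemma nmK n x z : nm addK n x z = n.+1%:R * x z.
Proof.
elim: n => [|n IH] /=; first by rewrite mul1r.
by rewrite /addK IH -[n.+2%:R]natr1 mulrDl mul1r.
Qed.

(** At a point [z0] fixed in advance, high enough for all scales up to [L], imaginary parts give
    [n.+1 * Im (x z0) = Im (l * x (z0 / l))], whose right side is at most [|z0|] in absolute
    value. *)
Lemma growthK x (L : R) : cvK (fun=> x) x -> nondegK x -> 0 < L ->
  exists N, forall n l, (N <= n)%N -> 0 < l <= L -> ~ eqvK (nm addK n x) (scK l x).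
Proof.
move=> [[b [L' [N [b0 L0 Hx ox]]]] _] [c c0 nx] L1.
have [B [N' [B0 HB]]] := ox 1 ltr01.
have [jx _] := Hx N (leqnn N).
pose L2 := Num.max 1 L.
have L20 : 0 < L2 by rewrite lt_max ltr01.
pose b2 := Num.max (L2 * b) (Num.max c (L2 * B)).
have b20 : 0 < b2 by rewrite !lt_max c0 orbT.
pose z0 : R[i] := 0 +i* (b2 + 1).
have z0c : TC 1 b2 z0 by split; rewrite /= ?ltrDl // normr0 mul1r addr_gt0.
have z0n : complex.Im (x z0) < 0.
  by apply: nx; apply: cone_weaken z0c; rewrite !le_max lexx orbT.
pose q := normc z0 / - complex.Im (x z0).
exists (Num.truncn q).+1 => n l Nn /andP[l0 lL] [d _ [a [e [a0 e0 H]]]].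
have lL2 : l <= L2 by rewrite le_max lL orbT.
have L21 : 1 <= L2 by rewrite le_max lexx.
have zero : forall z, TC 1 b2 z -> nm addK n x z - (scK l x z + d%:C) = 0.
  apply: (identity_cone (a' := a) (b' := e)) => // [z zc|z zc]; last first.
    by rewrite H // subrr.
  have zc1 : TC 1 (L2 * b) z by apply: cone_weaken zc; rewrite le_max lexx.
  have zb : TC 1 b z by apply: cone_weaken zc1; rewrite ler_peMl // ltW.
  apply: jet2B; last apply: jet2D; last exact: jet2_cst.
    have -> : nm addK n x = fun z => n.+1%:R * x z by apply/funext => w; exact: nmK.
    by apply: jet2Z; exact: jx.
  apply: jet2Z; apply: jet2_scale => //; apply: jx; apply/cone_scale => //.
  by apply: cone_weaken zc1; rewrite ler_wpM2r // ltW.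
have /eqP := zero _ z0c; rewrite subr_eq0 nmK => /eqP E.
have zB : TC 1 B (z0 / l%:C).
  apply/cone_scale => //; apply: cone_weaken z0c.
  by rewrite !le_max ler_wpM2r ?orbT // ltW.
have := HB N' _ (leqnn _) zB; rewrite mul1r normcM normcV normcR gtr0_norm // ler_pdivlMr // => K.
have : `|complex.Im (scK l x z0)| <= normc z0.
  by rewrite (le_trans (Im_le_normc _)) // /scK normcM normcR gtr0_norm // mulrC.
have -> : complex.Im (scK l x z0) = n.+1%:R * complex.Im (x z0).
  have := congr1 (@complex.Im R) E; rewrite cImD /= addr0 => <-.
  have -> : n.+1%:R = (n.+1%:R : R)%:C :> R[i] by rewrite rmorph_nat.
  by rewrite cImZ.
rewrite normrM ger0_norm // ltr0_norm // -ler_pdivlMr ?oppr_gt0 // leNgt => /negP; apply.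
rewrite -/q (lt_le_trans (truncnS_gt q)) // ler_nat.
exact: leq_trans Nn _.
Qed.

(** Each relation holds on a cone of its own, so it is first extended to all [z] such that [z] and
    [z / C n] are in one common cone. Imaginary parts then bound the scales on both sides; along a
    subsequence [C] converges, and the shifts converge as differences of convergent values. *)
Lemma typesK X Y x y (C : nat -> R) : cvK X x -> cvK Y y ->
  nondegK x -> nondegK y -> (forall n, 0 < C n) ->
  (forall n, eqvK (X n) (scK (C n) (Y n))) ->
  exists2 c : R, 0 < c & eqvK x (scK c y) /\
  forall eps (N : nat), 0 < eps -> exists2 n, (N <= n)%N & `|C n - c| < eps.
Proof.
move=> [[bX [LX [NX [bX0 LX0 HX oX]]]] [cX cX0 Xx]].
move=> [[bY [LY [NY [bY0 LY0 HY oY]]]] [cY cY0 Yy]].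
move=> [dX dX0 nx] [dY dY0 ny] C0 E.
pose b := Num.max (Num.max bX bY) (Num.max (Num.max cX cY) (Num.max dX dY)).
have b0 : 0 < b by rewrite !lt_max bX0.
have wk z : TC 1 b z -> [/\ TC 1 bX z, TC 1 bY z, TC 1 cX z, TC 1 cY z & TC 1 dX z /\ TC 1 dY z].
  by move=> zc; split; [| | | |split]; apply: cone_weaken zc; rewrite !le_max lexx ?orbT.
pose d n := projT1 (cid2 (E n)).
have dS n : S -> d n = 0 by rewrite /d; case: cid2.
have dE n : exists a b : R, [/\ 0 < a, 0 < b & forall z, TC a b z ->
    X n z = scK (C n) (Y n) z + (d n)%:C] by rewrite /d; case: cid2.
pose N0 := maxn NX NY.
have ext n z : (N0 <= n)%N -> TC 1 b z -> TC 1 b (z / (C n)%:C) ->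
    X n z = scK (C n) (Y n) z + (d n)%:C.
  rewrite geq_max => /andP[/HX[jX _] /HY[jY _]] zc /cone_scale - /(_ (C0 n)) zc'.
  have [a [e [a0 e0 H]]] := dE n.
  apply/eqP; rewrite -subr_eq0; apply/eqP.
  apply: (@identity_cone R (fun z => X n z - (scK (C n) (Y n) z + (d n)%:C)) 1 (Num.max b (C n * b)) a e) => //; last 2 first.
  - by move=> w /H ->; rewrite subrr.
  - by case: zc zc' => [z1 z2] [z3 _]; split => //; rewrite gt_max z1.
  move=> w wc.
  have w1 : TC 1 b w by apply: cone_weaken wc; rewrite le_max lexx.
  have w2 : TC 1 b (w / (C n)%:C).
    by apply/cone_scale => //; apply: cone_weaken wc; rewrite le_max lexx orbT.
  apply: jet2B; first by apply: jX; have [] := wk _ w1.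
  apply: jet2D; last exact: jet2_cst.
  by apply: jet2Z; apply: jet2_scale => //; apply: jY; have [] := wk _ w2.
pose z0 : R[i] := 0 +i* (b + 1).
have TCi t : b < t -> TC 1 b (0 +i* t).
  by move=> bt; split => //=; rewrite normr0 mul1r (lt_trans b0).
have z0c : TC 1 b z0 by apply: TCi; rewrite ltrDl.
have z0n : 0 < normc z0 by rewrite normc_gt0 Im_neq0 //= gt_eqF // addr_gt0.
have Imz0 : complex.Im z0 = b + 1 by [].
have b10 : 0 < b + 1 by rewrite addr_gt0.
(* [C] is bounded away from zero, as [C_n Y_n(z/C_n)] is small for small [C_n] *)
have [m m0 mC] : exists2 m, 0 < m & \forall n \near \oo, m <= C n.
  have Ix : complex.Im (x z0) < 0 by apply: nx; have [_ _ _ _ []] := wk _ z0c.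
  have e0 : 0 < - complex.Im (x z0) / 2 / normc z0 by rewrite !divr_gt0 // oppr_gt0.
  have [B [N1 [B0 HB]]] := oY _ e0.
  exists (Num.min 1 ((b + 1) / (B + 1))).
    by rewrite lt_min ltr01 divr_gt0 // addr_gt0.
  have [_ _ z0X _ _] := wk _ z0c.
  have XL : \forall n \near \oo, complex.Im (X n z0) < complex.Im (x z0) / 2.
    by have [_ H] := Xx _ z0X; apply: (cvgr_lt _ H); lra.
  near=> n; rewrite leNgt; apply/negP; rewrite lt_min => /andP[C1 C2].
  have zB : TC 1 B (z0 / (C n)%:C).
    apply/cone_scale => //; split; last by case: z0c.
    move: C2; rewrite Imz0 ltr_pdivlMr ?addr_gt0 // => C2.
    by apply: le_lt_trans C2; rewrite ler_wpM2l ?(ltW (C0 n)) // lerDl.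
  have zb : TC 1 b (z0 / (C n)%:C).
    apply/cone_scale => //; split; last by case: z0c.
    by rewrite Imz0 (le_lt_trans (y := b)) ?ltrDl // ler_piMl // ltW.
  have Nn : (N0 <= n)%N by near: n; exact: nbhs_infty_ge.
  have N1n : (N1 <= n)%N by near: n; exact: nbhs_infty_ge.
  have := ext n z0 Nn z0c zb.
  move=> /(congr1 (@complex.Im R)); rewrite cImD /= addr0 => E1.
  have := HB n _ N1n zB.
  rewrite normcM normcV normcR (gtr0_norm (C0 n)) mulrA ler_pdivlMr // divfK ?gt_eqF // => E2.
  have E3 : `|complex.Im (scK (C n) (Y n) z0)| <= - complex.Im (x z0) / 2.
    by rewrite (le_trans (Im_le_normc _)) // /scK normcM normcR (gtr0_norm (C0 n)) mulrC.
  have : complex.Im (X n z0) < complex.Im (x z0) / 2.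
    by near: n; exact: XL.
  by move: E3; rewrite E1 ler_norml => /andP[E3 _]; lra.
(* Conversely, at [C n * z0] the relation gives [C n * Im (Y n z0) = Im (X n (C n * z0))], where the
   right side is small compared with a large [C n]. *)
have [K K0 CK] : exists2 K, 0 < K & \forall n \near \oo, C n <= K.
  have Iy : complex.Im (y z0) < 0 by apply: ny; have [_ _ _ _ []] := wk _ z0c.
  have e0 : 0 < - complex.Im (y z0) / 2 / normc z0 by rewrite !divr_gt0 // oppr_gt0.
  have [B [N1 [B0 HB]]] := oX _ e0.
  exists (Num.max 1 (B + 1)); first by rewrite lt_max ltr01.
  have [_ _ _ z0Y _] := wk _ z0c.
  have YL : \forall n \near \oo, complex.Im (Y n z0) < complex.Im (y z0) / 2.
    by have [_ H] := Yy _ z0Y; apply: (cvgr_lt _ H); lra.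
  near=> n; rewrite leNgt; apply/negP; rewrite gt_max => /andP[C1 C2].
  have CC : (C n)%:C != 0 :> R[i] by rewrite realC_eq0 gt_eqF.
  have z0E : (C n)%:C * z0 / (C n)%:C = z0 by rewrite mulrC mulKf.
  have zB : TC 1 B ((C n)%:C * z0).
    split; rewrite ?cReZ ?cImZ /=; last by rewrite mulr0 normr0 mul1r mulr_gt0.
    by rewrite (lt_trans (y := C n)) ?ltr_pMr ?ltrDr // (lt_trans _ C2) // ltrDl.
  have zb : TC 1 b ((C n)%:C * z0).
    split; rewrite ?cReZ ?cImZ /=; last by rewrite mulr0 normr0 mul1r mulr_gt0.
    by rewrite (lt_le_trans (y := b + 1)) ?ltrDl // ler_peMl // ltW.
  have Nn : (N0 <= n)%N by near: n; exact: nbhs_infty_ge.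
  have N1n : (N1 <= n)%N by near: n; exact: nbhs_infty_ge.
  have := ext n _ Nn zb; rewrite z0E => /(_ z0c).
  move=> /(congr1 (@complex.Im R)); rewrite cImD /= addr0 /scK z0E cImZ => E1.
  have := HB n _ N1n zB.
  rewrite normcM normcR (gtr0_norm (C0 n)) mulrCA divfK ?gt_eqF // => E2.
  have := le_trans (Im_le_normc _) E2; rewrite E1 normrM (gtr0_norm (C0 n)) ler_pM2l // => E3.
  have : complex.Im (Y n z0) < complex.Im (y z0) / 2.
    by near: n; exact: YL.
  by move: E3; rewrite ler_norml => /andP[E3 _]; lra.
have [N2 _ HN2] := mC; have [N3 _ HN3] := CK.
pose N4 := maxn N0 (maxn N2 N3).
have CB n : (N4 <= n)%N -> m <= C n <= K.
  rewrite !geq_max => /and3P[_ n2 n3]; apply/andP; split; [exact: HN2|exact: HN3].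
have bC : bounded_fun (fun n => C (n + N4)%N : R^o).
  exists K; split=> [|k Kk n _]; first exact: num_real.
  have /andP[mm KK] := CB (n + N4)%N (leq_addl _ _).
  by rewrite /= (gtr0_norm (C0 _)) (le_trans KK) // ltW.
have [f finc /cvg_ex[/= c fc]] := bolzano_weierstrass bC.
pose g k := (f k + N4)%N.
have gc : C (g n) @[n --> \oo] --> c by exact: fc.
have kf k : (k <= f k)%N.
  elim: k => // k IH; apply: leq_ltn_trans IH _.
  by have := (increasing_seqP f).2 finc k.
have kg k : (k <= g k)%N by rewrite (leq_trans (kf k)) // leq_addr.
have gN4 k : (N4 <= g k)%N by rewrite leq_addl.
have goo : g n @[n --> \oo] --> \oo.
  by apply/cvgnyPge => A; exists A => // k /= Ak; exact: leq_trans (kg k).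
have mc : m <= c by apply: (ler_cvg_to (cvg_cst m) gc); apply: nearW => k; have /andP[] := CB _ (gN4 k).
have cK : c <= K by apply: (ler_cvg_to gc (cvg_cst K)); apply: nearW => k; have /andP[] := CB _ (gN4 k).
have c0 : 0 < c := lt_le_trans m0 mc.
have Cg0 k : 0 < C (g k) by exact: C0.
have mov z : TC 1 b z -> TC 1 b (z / c%:C) ->
    ccvg (fun k => scK (C (g k)) (Y (g k)) z) (scK c y z).
  move=> zc zcc; apply: ccvgM; first exact: ccvgR.
  have [_ zY _ zY' _] := wk _ zcc.
  apply: (ccvg_moving (X := fun k => Y (g k)) (z := z / c%:C) (b := bY) (L := LY) (N := NY)).
  - move=> n Nn; have [//|_ lY] := HY (g n) _; last by [].
    by rewrite (leq_trans Nn).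
  - exact: zY.
  - exact: (ccvg_sub goo (Yy _ zY')).
  - exact: ccvg_div.
have movX z : TC 1 b z -> ccvg (fun k => X (g k) z) (x z).
  by move=> zc; have [_ _ zX _ _] := wk _ zc; exact: (ccvg_sub goo (Xx _ zX)).
have eqg z : TC 1 b z -> TC 1 b (z / c%:C) -> ccvg (fun k => (d (g k))%:C) (x z - scK c y z).
  move=> zc zcc; have [e e0 He] := cone_open zcc ltr01.
  apply: (ccvg_eq _ (ccvgB (movX _ zc) (mov _ zc zcc))).
  have := ccvg_dist (ccvg_div z c0 gc) => /cvgr_lt /(_ _ e0) H.
  apply: filterS H => k Hk.
  rewrite (ext (g k) z) //; first by rewrite addrC addKr.
    by rewrite (leq_trans _ (gN4 k)) // leq_maxl.
  by rewrite -(subrK (z / c%:C) (z / (C (g k))%:C)) addrC; exact: He.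
have scc z : TC 1 (Num.max b (c * b)) z -> TC 1 b z /\ TC 1 b (z / c%:C).
  move=> zc; split; first by apply: cone_weaken zc; rewrite le_max lexx.
  by apply/cone_scale => //; apply: cone_weaken zc; rewrite le_max lexx orbT.
pose b' := Num.max b (c * b).
have b'0 : 0 < b' by rewrite lt_max b0.
pose z1 : R[i] := 0 +i* (b' + 1).
have z1c : TC 1 b' z1 by split; rewrite /= ?ltrDl // normr0 mul1r addr_gt0.
have [z1b z1b'] := scc _ z1c.
have D := eqg _ z1b z1b'.
exists c => //; split; last first.
  move=> e N e0; have /cvgrPdist_lt/(_ _ e0) [N' _ H] := gc.
  exists (g (maxn N N')); first by rewrite (leq_trans _ (kg _)) // leq_maxl.
  by rewrite distrC; apply: H; exact: leq_maxr.
exists (complex.Re (x z1 - scK c y z1)).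
  move=> s; have Z : ccvg (fun k => (d (g k))%:C) 0.
    by apply: ccvg_eq (ccvg_cst 0); apply: nearW => k; rewrite dS.
  by rewrite (ccvg_unique D Z).
exists 1, b'; split => // z /scc[zb zb'].
have D' := eqg _ zb zb'.
(* The limiting shift is real as a limit of reals, and as the limit of [d (g k)] it is the same for
   every [z]. *)
have real u : ccvg (fun k => (d (g k))%:C) u -> u = (complex.Re u)%:C.
  move=> [_ Hu]; apply: complex_ext => //=.
  have Hc : (0 : R) @[k --> \oo] --> (0 : R) by exact: cvg_cst.
  exact: (cvg_unique _ Hu Hc).
by rewrite -(real _ D) (ccvg_unique D D') addrC subrK.
Unshelve. all: by end_near.
Qed.

Lemma cone_domain : conv_domain addK scK eqvK cvK nondegK.
Proof.
split.
- exact: eqvK_refl.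
- exact: eqvK_sym.
- exact: eqvK_trans.
- exact: eqvK_add.
- exact: eqvK_sc.
- by move=> x y; apply: eqK_eqv => z; rewrite /addK addrC.
- by move=> x y z; apply: eqK_eqv => w; rewrite /addK addrA.
- by move=> x; apply: eqK_eqv => w; rewrite /scK mul1r divr1.
- move=> l m x l0 m0; apply: eqK_eqv => w; rewrite /scK rmorphM /= mulrA.
  by rewrite invfM mulrA.
- by move=> l x y l0; apply: eqK_eqv => w; rewrite /scK /addK mulrDr.
- exact: cvK_add.
- exact: cvK_sc.
- exact: cvK_add0.
- exact: nondegK_add.
- exact: nondegK_sc.
- exact: typesK.
- exact: growthK.
Qed.
End ConeDomain.

(** * Free and Boolean transforms *)
Section Degenerate.
Variable R : realType.
Implicit Types (mu nu : prob R).

Lemma null_integral_ae mu (f : R -> R) : cb f -> (forall x, 0 <= f x) ->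
  \int[mu]_x f x = 0 -> mu.-negligible [set x | f x <> 0].
Proof.
move=> cf f0 If0.
have : (\int[mu]_x `|(f x)%:E| = 0)%E.
  under eq_integral => x _ do rewrite gee0_abs ?lee_fin //.
  rewrite -[LHS]fineK; first by rewrite -/(Rintegral mu setT f) If0.
  by apply: integrable_fin_num => //; exact: cb_integrable.
have mf : measurable_fun [set: measurableTypeR R] (EFin \o f).
  by apply/measurable_EFinP; exact: cb_measurable.
move/(ae_eq_integral_abs mu measurableT mf) => [N [mN N0 fN]].
exists N; split => // x /= fx; apply: fN => /=.
by apply/not_implyP; split => //; case.
Qed.

(** Off a null set all [f k] vanish, and the separation hypothesis leaves a single point there,
    which carries all the mass. A countable family is needed because a single function
    [x |-> cis (s * x)] does not separate points. *)
Lemma degenerate_of_null_integrals mu (f : nat -> R -> R) :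
  (forall k, cb (f k)) -> (forall k x, 0 <= f k x) ->
  (forall k, \int[mu]_x f k x = 0) ->
  (forall x y, (forall k, f k x = 0) -> (forall k, f k y = 0) -> x = y) ->
  exists x, same_law mu (point_mass x).
Proof.
move=> cf f0 If0 finj.
have := negligible_bigcup (fun k => null_integral_ae (cf k) (f0 k) (If0 k)).
move=> [N [mN N0 fN]].
have fN' x : ~ N x -> forall k, f k x = 0.
  by move=> Nx k; apply: contrapT => fx; apply: Nx; apply: fN; exists k.
have [x0 Nx0] : exists x, ~ N x.
  apply/existsNP => NT.
  have e : N = setT by apply/seteqP; split => // x _; exact: NT.
  by have := probability_setT mu; rewrite -e N0 => /eqP; rewrite eq_sym onee_eq0.
exists x0 => A mA; have -> : point_mass x0 A = (x0 \in A)%:R%:E by [].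
have null B : measurable B -> ~ B x0 -> mu B = 0%E.
  move=> mB Bx0; apply/eqP; rewrite eq_le measure_ge0 andbT -N0.
  apply: le_measure; rewrite ?inE // => x Bx.
  by apply: contrapT => /fN' fx; apply: Bx0; rewrite (finj x0 x (fN' _ Nx0) fx).
have [xA|xA] := pselect (A x0); last first.
  by rewrite null // memNset.
rewrite mem_set //; have := null (~` A) (measurableC mA) (fun h => h xA).
rewrite probability_setC // => H.
have : (mu A <= 1)%E := probability_le1 mu mA.
have fA : mu A \is a fin_num by exact: fin_num_measure.
move: H; rewrite -(fineK fA) -EFinB => -[] /eqP; rewrite subr_eq0 => /eqP <- //.
Qed.

Lemma variance_cE mu (f : R -> R[i]) : ccb f ->
  \int[mu]_x (normc (f x - cE mu f) ^+ 2) =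
  \int[mu]_x (normc (f x) ^+ 2) - normc (cE mu f) ^+ 2.
Proof.
move=> cf; set c := cE mu f.
have E x : normc (f x - c) ^+ 2 =
   normc (f x) ^+ 2 - 2 * complex.Re (c^* * f x) + normc c ^+ 2.
  rewrite !sqr_normcE; case: (c) => p q; case: (f x) => u v /=; ring.
have cc : ccb (fun x => c^* * f x) by exact: ccbZ.
under eq_Rintegral => x _ do rewrite E.
have c1 : cb (fun x => 2 * complex.Re (c^* * f x)) by apply: cbZ; exact: cc.1.
have c2 := cb_sqr_normc cf.
rewrite EcD ?EcB ?Ec_cst ?EcZ //; [|exact: cc.1|exact: cbB|exact: cb_cst].
have -> : \int[mu]_x complex.Re (c^* * f x) = normc c ^+ 2.
  transitivity (complex.Re (c^* * c)); first by rewrite {2}/c -cEZ.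
  by rewrite sqr_normcE; case: (c) => p q /=; ring.
ring.
Qed.
End Degenerate.

(** * Linearizing the free and Boolean convolutions *)

Section Linearization.
Variable R : realType.
Implicit Types (mu nu rho : prob R) (z w : R[i]) (a b : R).
Local Notation G := cauchy_transform.
Local Notation F := recip_cauchy.
Local Notation TC := (@truncated_cone R).

(* Equality would be the equality case of Cauchy-Schwarz. *)
Lemma Im_recip_gt mu z : nondegenerate mu -> 0 < complex.Im z ->
  complex.Im z < complex.Im (F mu z).
Proof.
move=> nd z0; rewrite ltNge; apply/negP => le; apply: nd.
set I := \int[mu]_x (normc (z - x%:C)^-1 ^+ 2).
have c1 := ccb_res z0.
have G0 : 0 < normc (G mu z) ^+ 2 by rewrite exprn_gt0 // normc_gt0 cauchy_neq0.
have IG : I <= normc (G mu z) ^+ 2.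
  move: le; rewrite /recip_cauchy cImV -sqr_normcE Im_cauchy // -/I.
  have -> : - (- complex.Im z * I) = complex.Im z * I by ring.
  by rewrite ler_pdivrMr // ler_pM2l.
pose f x := normc ((z - x%:C)^-1 - G mu z) ^+ 2.
have cf : cb f by apply/cb_sqr_normc/ccbB => //; exact: ccb_cst.
apply: (degenerate_of_null_integrals (f := fun=> f)) => //.
- by move=> _ x; exact: sqr_ge0.
- move=> _; apply/eqP; rewrite eq_le Ec_ge0 ?andbT; last by move=> x; exact: sqr_ge0.
  rewrite /f cauchyE variance_cE // -cauchyE.
  rewrite -/I; lra.
- move=> x y /(_ 0%N)/eqP; rewrite /f sqrf_eq0 normc_eq0 subr_eq0 => /eqP fx.
  move=> /(_ 0%N)/eqP; rewrite sqrf_eq0 normc_eq0 subr_eq0 => /eqP fy.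
  have : (z - x%:C)^-1 = (z - y%:C)^-1 by rewrite fx fy.
  by move/invr_inj/addrI/oppr_inj/complexI.
Qed.

Lemma recip_dilation mu a z : 0 < a -> 0 < complex.Im z ->
  F (dilation a mu) z = a%:C * F mu (z / a%:C).
Proof.
move=> a0 z0; have an : a%:C != 0 :> R[i] by rewrite realC_eq0 gt_eqF.
have za0 : 0 < complex.Im (z / a%:C) by rewrite cImVZ divr_gt0.
rewrite /recip_cauchy; have -> : G (dilation a mu) z = a%:C^-1 * G mu (z / a%:C).
  rewrite cauchyE cE_dilation; last exact: ccb_res.
  rewrite cauchyE -cEZ; last exact: ccb_res.
  apply: eq_cE => x; rewrite -invfM; congr (_^-1).
  by rewrite mulrBr mulrCA divff // mulr1 rmorphM.
by rewrite invfM invrK.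
Qed.

Lemma recip_point_mass b z : 0 < complex.Im z -> F (point_mass b) z = z - b%:C.
Proof.
by move=> z0; rewrite /recip_cauchy cauchyE cE_point_mass ?invrK //; exact: ccb_res.
Qed.

Definition translation (d : R) : measurableTypeR R -> measurableTypeR R := fun x => d + x.

Lemma measurable_translation d : measurable_fun [set: measurableTypeR R] (translation d).
Proof. by apply: (@measurable_funD _ _ R setT (cst d) id) => //. Qed.

HB.instance Definition _ d :=
  isMeasurableFun.Build _ _ _ _ (translation d) (measurable_translation d).

(** Free convolution with a point mass is translation of the law, so in the free case the measure
    needed at the end is explicit. *)
Definition translate d mu : prob R := distribution mu (translation d).

Lemma recip_translate mu d z : 0 < complex.Im z ->
  F (translate d mu) z = F mu (z - d%:C).
Proof.
move=> z0; have zd : 0 < complex.Im (z - d%:C) by rewrite Im_subR.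
have tr f : cb f -> \int[translate d mu]_x f x = \int[mu]_x f (d + x).
  move=> cf; rewrite /Rintegral; congr fine; rewrite integral_distribution //.
    by apply/measurable_EFinP; exact: cb_measurable.
  apply: (@cb_integrable _ mu (fun x => f (d + x))).
  case: cf => cf [M fM]; split; last by exists M.
  move=> x; apply: (@continuous_comp _ _ _ (fun x : R => d + x) f); last exact: cf.
  by apply: cvgD; [exact: cvg_cst|exact: cvg_id].
have [c1 c2] := ccb_res z0.
rewrite /recip_cauchy; congr (_^-1); apply: complex_ext => /=.
  rewrite (tr _ c1); apply: eq_Rintegral => x _.
  by congr (complex.Re (_^-1)); rewrite rmorphD opprD addrA.
rewrite (tr _ c2); apply: eq_Rintegral => x _.
by congr (complex.Im (_^-1)); rewrite rmorphD opprD addrA.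
Qed.

(** Undoing the substitution of [1 / z] in the eta transform moves it to the upper half-plane, where
    on cones it obeys the same kind of bounds as [vphi]. *)
Definition bool_energy mu z : R[i] := z - F mu z.

Lemma bool_energy_nondeg nu : nondegenerate nu -> nondegK (bool_energy nu).
Proof.
move=> nd; exists 1 => // z zc; rewrite cImB subr_lt0.
by apply: Im_recip_gt => //; exact: cone_Im zc.
Qed.

Lemma cone1_sector b z : TC 1 b z -> sector b z.
Proof.
move=> zc; have z0 := cone_Im zc; case: zc; rewrite mul1r => /ltW bz zz; split => //.
by rewrite (le_trans (ltW zz)) // ler_peMl // ?ler1n // ltW.
Qed.

(** Tightness supplies one cutoff for all large [n]; the required regularity is then
    [recip_lipschitz] and [recip_near]. The bound [e / 4] on the tail matches the constant of the
    latter. *)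
Lemma bool_energy_cvg (m : nat -> prob R) l : wcvg m l ->
  cvK (fun n => bool_energy (m n)) (bool_energy l).
Proof.
move=> ml; have e0 : 0 < 240^-1 :> R by rewrite invr_gt0.
have [b b0 tb] := tail_small l e0.
have [N _ HN] := tail_wcvg b0 ml tb.
have sm n : (N <= n)%N -> small_tail (m n) b by move=> /HN/ltW.
split; last first.
  exists b => // z zc; apply: ccvgB; first exact: ccvg_cst.
  by apply: wcvg_recip => //; exact: cone_Im zc.
exists b, 1, N; split => // [n Nn|e e1].
  split=> [z zc|z w zc wc].
    apply: jet2B; first exact: jet2_id.
    by apply: jet2_recip; exact: cone_Im zc.
  have -> : bool_energy (m n) z - bool_energy (m n) w =
    - (F (m n) z - F (m n) w - (z - w)) by rewrite /bool_energy; ring.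
  rewrite normc_opp (le_trans (recip_lipschitz (sm _ Nn) (cone1_sector zc) (cone1_sector wc))) //.
  by have := normc_ge0 (z - w); lra.
have [c c0 tc] := tail_small l (divr_gt0 e1 (ltr0n _ 4)).
have [N' _ HN'] := tail_wcvg c0 ml tc.
exists (Num.max b c), (maxn N N'); split; first by rewrite lt_max b0.
move=> n z; rewrite geq_max => /andP[Nn N'n] zc.
have bc : b <= Num.max b c by rewrite le_max lexx.
have sc := small_tail_le (sm _ Nn) bc.
have := recip_near sc (cone1_sector zc); rewrite normc_distC => /le_trans; apply.
rewrite ler_wpM2r ?normc_ge0 // mulrC -ler_pdivlMr //.
apply: le_trans (ltW (HN' n N'n)); apply: tail_antimono => //.
by rewrite le_max lexx orbT.
Qed.

Lemma bool_energy_dilation S a mu : 0 < a ->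
  eqvK S (bool_energy (dilation a mu)) (scK a (bool_energy mu)).
Proof.
move=> a0; exists 0 => //; exists 1, 1; split => // z zc.
rewrite /bool_energy recip_dilation //; last exact: cone_Im zc.
rewrite /scK addr0 mulrBr mulrCA divff ?mulr1 //.
by rewrite realC_eq0 gt_eqF.
Qed.

Lemma eta_energy mu z : complex.Im z < 0 -> eta_transform mu z = z * bool_energy mu z^-1.
Proof.
move=> z0; have zn : z != 0 by apply: Im_neq0; rewrite lt_eqF.
by rewrite /eta_transform /bool_energy mulrBr divff.
Qed.

Lemma Im_inv_lt0 z : 0 < complex.Im z -> complex.Im z^-1 < 0.
Proof.
move=> z0; rewrite cImV mulNr oppr_lt0 divr_gt0 // -sqr_normcE exprn_gt0 //.
by rewrite normc_gt0 Im_neq0 // gt_eqF.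
Qed.

Lemma Im_inv_gt0 z : complex.Im z < 0 -> 0 < complex.Im z^-1.
Proof.
move=> z0; rewrite cImV divr_gt0 ?oppr_gt0 // -sqr_normcE exprn_gt0 //.
by rewrite normc_gt0 Im_neq0 // lt_eqF.
Qed.

Lemma boolean_convP mu nu rho : boolean_conv mu nu rho <->
  forall z, 0 < complex.Im z -> bool_energy rho z = bool_energy mu z + bool_energy nu z.
Proof.
split=> H z z0.
  have zi := Im_inv_lt0 z0; have := H _ zi; rewrite !eta_energy // invrK -mulrDr.
  by apply/mulfI; rewrite invr_eq0 Im_neq0 // gt_eqF.
by rewrite !eta_energy // H ?mulrDr //; exact: Im_inv_gt0.
Qed.

Lemma bool_energy_conv S mu nu rho : boolean_conv mu nu rho ->
  eqvK S (bool_energy rho) (addK (bool_energy mu) (bool_energy nu)).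
Proof.
move=> /boolean_convP H; exists 0 => //; exists 1, 1; split => // z zc.
by rewrite H ?addr0 //; exact: cone_Im zc.
Qed.

Lemma bool_energy_point_mass b z : 0 < complex.Im z -> bool_energy (point_mass b) z = b%:C.
Proof. by move=> z0; rewrite /bool_energy recip_point_mass // opprB addrC subrK. Qed.

Lemma bool_energy_shift (S : Prop) b (x : R[i] -> R[i]) : (S -> b = 0) ->
  eqvK S (addK x (bool_energy (point_mass b))) x.
Proof.
move=> Sb; exists b => //; exists 1, 1; split => // z zc.
by rewrite /addK bool_energy_point_mass //; exact: cone_Im zc.
Qed.

Lemma vphi_nondeg nu : nondegenerate nu -> nondegK (vphi nu).
Proof.
move=> nd; have e0 : 0 < 240^-1 :> R by rewrite invr_gt0.
have [b b0 /ltW tb] := tail_small nu e0.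
exists (2 * b) => [|z zc]; first exact: mulr_gt0.
have sb : small_tail nu b by [].
have [_ e s _] := recip_inverseP sb zc.
rewrite cImB subr_lt0 -[in X in _ < X]e; apply: Im_recip_gt => //.
exact: sector_Im b0 s.
Qed.

Lemma vphi_cvg (m : nat -> prob R) l : wcvg m l ->
  cvK (fun n => vphi (m n)) (vphi l).
Proof.
move=> ml; have e0 : 0 < 240^-1 :> R by rewrite invr_gt0.
have [b b0 tb] := tail_small l e0.
have [N _ HN] := tail_wcvg b0 ml tb.
have sm n : (N <= n)%N -> small_tail (m n) b by move=> /HN/ltW.
split; last first.
  exists (2 * b); first exact: mulr_gt0.
  move=> z zc; apply: ccvgB; last exact: ccvg_cst.
  apply: (wcvg_recip_inverse (b := b)) => //; last by exists N.
  by split => //; exact: ltW.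
exists (2 * b), 1, N; split => // [|n Nn|e e1]; first exact: mulr_gt0.
  split=> [z zc|z w zc wc]; first exact: jet2_vphi (sm _ Nn) zc.
  by rewrite mul1r; exact: vphi_lipschitz (sm _ Nn) zc wc.
have [c c0 tc] := tail_small l (divr_gt0 e1 (ltr0n _ 5)).
have [N' _ HN'] := tail_wcvg c0 ml tc.
exists (2 * Num.max b c), (maxn N N'); split; first by rewrite mulr_gt0 // lt_max b0.
move=> n z; rewrite geq_max => /andP[Nn N'n] zc.
have bc : b <= Num.max b c by rewrite le_max lexx.
have [_ _ _] := recip_inverseP (small_tail_le (sm _ Nn) bc) zc.
move=> /le_trans; apply.
rewrite ler_wpM2r ?normc_ge0 // mulrC -ler_pdivlMr //.
apply: le_trans (ltW (HN' n N'n)); apply: tail_antimono => //.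
rewrite ler_pdivlMr // (le_trans _ (ltW zc.1)) // mulrC ler_wpM2l //.
by rewrite le_max lexx orbT.
Qed.

Lemma small_tail_dilation a mu b : 0 < a -> small_tail mu b -> small_tail (dilation a mu) (a * b).
Proof.
move=> a0 [b0 tb]; split; first exact: mulr_gt0.
rewrite tail_dilation ?mulr_gt0 //; have -> // : a * b / a = b by field; rewrite gt_eqF.
Qed.

Lemma small_tail_ex mu : exists b, small_tail mu b.
Proof.
have e0 : 0 < 240^-1 :> R by rewrite invr_gt0.
by have [b b0 /ltW tb] := tail_small mu e0; exists b.
Qed.

Lemma vphi_dilation S a mu : 0 < a -> eqvK S (vphi (dilation a mu)) (scK a (vphi mu)).
Proof.
move=> a0; have [b sb] := small_tail_ex mu; have b0 := sb.1.
have an : a%:C != 0 :> R[i] by rewrite realC_eq0 gt_eqF.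
exists 0 => //; exists 1, (2 * (a * b)); split => // [|z zc]; first by rewrite !mulr_gt0.
have zac : TC 1 (2 * b) (z / a%:C) by apply/cone_scale => //; rewrite mulrCA.
have [_ e [s1 s2] _] := recip_inverseP sb zac.
set w := recip_inverse mu _ in e s1 s2.
have aw : a%:C * w = recip_inverse (dilation a mu) z.
  apply: (recip_inverse_unique (small_tail_dilation a0 sb)) => //.
    split; rewrite ?cReZ ?cImZ; first by rewrite ler_pM2l.
    by rewrite normrM (gtr0_norm a0) mulrCA ler_pM2l.
  rewrite recip_dilation //; last by rewrite cImZ mulr_gt0 // (lt_le_trans b0).
  by rewrite (mulrC a%:C w) mulfK // e mulrC divfK.
by rewrite addr0 /vphi -aw /scK -/w mulrBr mulrCA divff ?mulr1.
Qed.

(** The shifted preimage [recip_inverse mu z + d] solves the equation for [nu]. It is the selected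
    branch because it stays within [|z| / 16] of [z]: the tail bound contributes 5/240 and the
    height condition 1/48 of [|z|]. *)
Lemma vphi_shift mu nu d b : small_tail mu b -> small_tail nu b ->
  (forall z, 0 < complex.Im z -> F nu z = F mu (z - d%:C)) ->
  forall z, TC 1 (Num.max (2 * b) (48 * `|d|)) z -> vphi nu z = vphi mu z + d%:C.
Proof.
move=> sm sn nuE z zc; have b0 := sm.1.
have zb : TC 1 (2 * b) z by apply: cone_weaken zc; rewrite le_max lexx.
have [_ e s h] := recip_inverseP sm zb.
have z0 := cone_Im zc; have nz : complex.Im z <= normc z.
  by rewrite (le_trans _ (Im_le_normc _)) // ler_norm.
have dz : `|d| <= normc z / 48.
  rewrite ler_pdivlMr // mulrC (le_trans _ nz) // (le_trans _ (ltW zc.1)) //.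
  by rewrite le_max lexx orbT.
have t1 : tail mu (complex.Im z / 2) <= 240^-1.
  apply: le_trans sm.2; apply: tail_antimono => //.
  by case: zb => /ltW ? _; lra.
rewrite /vphi -(@recip_inverse_square _ nu b z (recip_inverse mu z + d%:C)) //.
- by rewrite addrAC.
- have H : normc (recip_inverse mu z + d%:C - z) <= normc z / 16.
    rewrite addrAC (le_trans (normc_leD _ _)) // normcR.
    have := normc_ge0 z; move: h dz t1; rewrite /vphi.
    move: (normc _) `|d| (tail _ _) (normc _) => p q t n *; nra.
  by split; rewrite (le_trans _ H) ?Re_le_normc ?Im_le_normc.
- rewrite nuE ?addrK // cImD addr0; exact: sector_Im b0 s.
Qed.

Lemma vphi_translate d mu : exists2 B, 0 < B &
  forall z, TC 1 B z -> vphi (translate d mu) z = vphi mu z + d%:C.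
Proof.
have [b sb] := small_tail_ex mu; have [c sc] := small_tail_ex (translate d mu).
have sb' : small_tail mu (Num.max b c) by apply: small_tail_le sb _; rewrite le_max lexx.
have sc' : small_tail (translate d mu) (Num.max b c).
  by apply: small_tail_le sc _; rewrite le_max lexx orbT.
exists (Num.max (2 * Num.max b c) (48 * `|d|)); last first.
  by apply: vphi_shift => // z; exact: recip_translate.
by rewrite lt_max mulr_gt0 // sb'.1.
Qed.

(** Reduced by [vphi_shift] to the point mass at 0, whose [F] is the identity. *)
Lemma vphi_point_mass d : exists2 B, 0 < B &
  forall z, TC 1 B z -> vphi (point_mass d) z = d%:C.
Proof.
have [b sb] := small_tail_ex (point_mass d); have [c sc] := small_tail_ex (point_mass 0).
have sb' : small_tail (point_mass d) (Num.max b c).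
  by apply: small_tail_le sb _; rewrite le_max lexx.
have sc' : small_tail (point_mass 0) (Num.max b c).
  by apply: small_tail_le sc _; rewrite le_max lexx orbT.
have m0 : 0 < 2 * Num.max b c by rewrite mulr_gt0 // sb'.1.
exists (Num.max (2 * Num.max b c) (48 * `|d|)); first by rewrite lt_max m0.
move=> z zc; rewrite (@vphi_shift (point_mass 0) (point_mass d) d _ sc' sb' _ z zc); last first.
  by move=> w w0; rewrite !recip_point_mass ?Im_subR // rmorph0 subr0.
have zc' : TC 1 (2 * Num.max b c) z by apply: cone_weaken zc; rewrite le_max lexx.
have [_ e s _] := recip_inverseP sc' zc'.
rewrite /vphi; have := e; rewrite recip_point_mass ?rmorph0 ?subr0; last exact: sector_Im sc'.1 s.
by move=> ->; rewrite subrr add0r.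
Qed.

Lemma vphi_shiftK (S : Prop) b (x : R[i] -> R[i]) : (S -> b = 0) ->
  eqvK S (addK x (vphi (point_mass b))) x.
Proof.
move=> Sb; exists b => //; have [B B0 HB] := vphi_point_mass b.
by exists 1, B; split => // z zc; rewrite /addK HB.
Qed.

(* The values of an inverse of [F] taken in an arbitrary truncated cone tend to
   infinity with the argument, since [F] is bounded where [Im w] is. *)
Lemma recip_inverse_branch mu a b a' b' g : 0 < a -> 0 < b -> 0 < a' -> 0 < b' ->
  (forall z, TC a b z -> TC a' b' (g z) /\ F mu (g z) = z) ->
  exists2 B, 0 < B & forall z, TC (Num.min a 1) B z -> g z = recip_inverse mu z.
Proof.
move=> a0 b0 a'0 b'0 gP; have [c sc] := small_tail_ex mu; have c0 := sc.1.
(* With this tail bound [|w * G w - 1| <= 1 / 64] at a preimage [w] of [z], so [|w - z| <= |z| / 64]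
   and [w] is the selected branch. *)
have e0 : 0 < (64 * (1 + a'))^-1 by rewrite invr_gt0 mulr_gt0 // addr_gt0.
have [q q0 tq] := tail_small mu e0.
pose L := (1 + a') * q; have L0 : 0 < L by rewrite mulr_gt0 // addr_gt0.
(* [h] bounds [|w - x|^-2] from below whenever [|w| <= L]. A preimage below height [q] would satisfy
   [|w| <= L], hence [|G w| >= K] and [|z| <= 1 / K], which the choice of the cone excludes. *)
pose h (x : R) := (L + `|x|)^-1 * (L + `|x|)^-1.
have Lx (x : R) : 0 < L + `|x| by rewrite ltr_wpDr.
have ch : cb h.
  have c1 : cb (fun x : R => (L + `|x|)^-1).
    split; last first.
      by exists L^-1 => x; rewrite gtr0_norm ?invr_gt0 // lef_pV2 ?posrE // lerDl.
    move=> x; apply: cvgV; first by rewrite gt_eqF.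
    by apply: cvgD; [exact: cvg_cst|exact: norm_continuous].
  exact: cbM.
have Ih : 0 < \int[mu]_x h x by apply: Ec_gt0 => // x; rewrite mulr_gt0 ?invr_gt0.
pose K := b' * \int[mu]_x h x; have K0 : 0 < K by exact: mulr_gt0.
exists (Num.max b (Num.max (2 * c) (2 * K^-1))); first by rewrite lt_max b0.
set B := Num.max _ _; move=> z zc.
have zab : TC a b z.
  by apply: (cone_sub _ _ _ zc); rewrite ?le_max ?ge_min ?lexx // ltW.
have zc1 : TC 1 (2 * c) z.
  by apply: (cone_sub _ _ _ zc); rewrite ?le_max ?ge_min ?lexx ?orbT // ltW.
have zK : 2 * K^-1 < complex.Im z by apply: le_lt_trans zc.1; rewrite !le_max lexx !orbT.
have [[wb wa] wz] := gP _ zab; set w := g z in wb wa wz *.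
have w0 : 0 < complex.Im w := lt_trans b'0 wb.
have z0 := cone_Im zc1.
have nz : complex.Im z <= normc z by rewrite (le_trans _ (Im_le_normc _)) // ler_norm.
have G0 : 0 < normc (G mu w) by rewrite normc_gt0 cauchy_neq0.
have qw : q <= complex.Im w.
  rewrite leNgt; apply/negP => wq.
  have nw : normc w <= L.
    rewrite (le_trans (normc_le_ReIm _)) // (gtr0_norm w0) /L mulrDl mul1r addrC.
    by rewrite lerD ?(ltW wq) // (le_trans (ltW wa)) // ler_wpM2l // ltW.
  have : K <= normc (G mu w).
    rewrite (le_trans _ (Im_le_normc _)) // Im_cauchy // mulNr normrN.
    rewrite (le_trans _ (ler_norm _)) // /K ler_pM ?(ltW b'0) ?(ltW Ih) ?(ltW wb) //.
    apply: Ec_le => // [|x]; first exact/cb_sqr_normc/ccb_res.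
    rewrite /h -expr2 ler_pXn2r ?nnegrE ?invr_ge0 ?normc_ge0 ?(ltW (Lx x)) //.
    rewrite normcV lef_pV2 ?posrE ?normc_gt0 ?subR_neq0 //.
    by rewrite (le_trans (normc_leB _ _)) // normcR lerD2r.
  have : normc z = (normc (G mu w))^-1 by rewrite -wz /recip_cauchy normcV.
  move=> nzG KG; have : (normc (G mu w))^-1 <= K^-1 by rewrite lef_pV2 ?posrE.
  have : 0 < K^-1 by rewrite invr_gt0.
  lra.
have H := cauchy_near1_aperture mu (ltW a'0) q0 qw (ltW wa).
set p := w * G mu w - 1 in H.
have p64 : normc p <= 1 / 64.
  apply: (le_trans H); have := ltW tq; rewrite -[X in _ <= X]mul1r ler_pdivlMr; last first.
    by rewrite mulr_gt0 // addr_gt0.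
  by move=> ?; lra.
have wn : w != 0 by apply: Im_neq0; rewrite gt_eqF.
have Gn : G mu w != 0 by rewrite cauchy_neq0.
have wzE : w - z = p * z by rewrite -wz /p /recip_cauchy; field.
apply: (recip_inverse_square sc) => //.
have Q : normc (w - z) <= normc z / 16.
  by rewrite wzE normcM; have := normc_ge0 z; nra.
by split; rewrite (le_trans _ Q) ?Re_le_normc ?Im_le_normc.
Qed.

(** Far out in the cone the three inverses that witness [free_conv] coincide with the selected
    branches. *)
Lemma vphi_conv S mu nu rho : free_conv mu nu rho ->
  eqvK S (vphi rho) (addK (vphi mu) (vphi nu)).
Proof.
move=> [a [b [f1 [f2 [f3 [[a0 b0] [g1 [a1 [b1 [a10 b10 _ G1]]] E1]
  [g2 [a2 [b2 [a20 b20 _ G2]]] E2] [g3 [a3 [b3 [a30 b30 _ G3]]] E3] E]]]]]].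
exists 0 => //; exists (Num.min a 1).
have [B1 B10 H1] := recip_inverse_branch a0 b0 a10 b10 G1.
have [B2 B20 H2] := recip_inverse_branch a0 b0 a20 b20 G2.
have [B3 B30 H3] := recip_inverse_branch a0 b0 a30 b30 G3.
exists (Num.max b (Num.max B1 (Num.max B2 B3))); split.
- by rewrite lt_min a0 ltr01.
- by rewrite lt_max b0.
set B := Num.max _ _ => z zc.
have B0 : 0 <= B by rewrite le_max ltW.
have zab : TC a b z by apply: (cone_sub B0 _ _ zc); rewrite ?le_max ?ge_min ?lexx.
have z1 : TC (Num.min a 1) B1 z by apply: (cone_sub B0 _ _ zc); rewrite ?le_max ?lexx ?orbT.
have z2 : TC (Num.min a 1) B2 z by apply: (cone_sub B0 _ _ zc); rewrite ?le_max ?lexx ?orbT.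
have z3 : TC (Num.min a 1) B3 z by apply: (cone_sub B0 _ _ zc); rewrite ?le_max ?lexx ?orbT.
rewrite addr0 /addK /vphi -H1 // -H2 // -H3 // -E1 // -E2 // -E3 //.
exact: E.
Qed.

Lemma voiculescu_vphi mu b a c : small_tail mu b -> 0 < a -> a <= 1 -> 2 * b <= c ->
  voiculescu_transform mu (TC a c) (vphi mu).
Proof.
move=> sb a0 a1 bc; exists (recip_inverse mu); last by [].
have b0 := sb.1.
exists 2, b; split => //.
- by move=> z w /set_mem/cone_sector zc /set_mem/cone_sector wc; exact: recip_inj sb zc wc.
- move=> z zc; have zc1 : TC 1 (2 * b) z.
    by apply: (cone_sub _ _ bc zc) => //; rewrite (le_trans _ bc) // mulr_ge0 // ltW.
  have [w1 w2 _ _] := recip_inverseP sb zc1; split => //.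
  apply: cone_sub w1 => //; first by have := cone_Im zc1; lra.
  by case: zc1 => /ltW ? _; lra.
Qed.

(** [eqvK True] forces a zero shift, so it is equality on some cone. *)
Lemma free_conv_vphi mu nu rho :
  eqvK True (vphi rho) (addK (vphi mu) (vphi nu)) -> free_conv mu nu rho.
Proof.
move=> [d Sd [a [b [a0 b0 H]]]]; rewrite (Sd I) in H.
have [b1 s1] := small_tail_ex mu; have [b2 s2] := small_tail_ex nu.
have [b3 s3] := small_tail_ex rho.
pose c := Num.max b (2 * Num.max b1 (Num.max b2 b3)).
have le1 : Num.min a 1 <= 1 by rewrite ge_min lexx orbT.
have a10 : 0 < Num.min a 1 by rewrite lt_min a0 ltr01.
have c0 : 0 < c by rewrite lt_max b0.
have cb x : x <= Num.max b1 (Num.max b2 b3) -> 2 * x <= c.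
  by move=> ?; rewrite le_max ler_pM2l // orbC; apply/orP; left.
exists (Num.min a 1), c, (vphi mu), (vphi nu), (vphi rho); split.
- by [].
- by apply: voiculescu_vphi s1 _ _ _ => //; apply: cb; rewrite le_max lexx.
- by apply: voiculescu_vphi s2 _ _ _ => //; apply: cb; rewrite !le_max lexx orbT.
- by apply: voiculescu_vphi s3 _ _ _ => //; apply: cb; rewrite !le_max lexx !orbT.
- move=> z zc; rewrite H ?addr0 //; apply: (cone_sub _ _ _ zc).
  + exact: ltW.
  + by rewrite ge_min lexx.
  + by rewrite le_max lexx.
Qed.

Lemma eqvK_shift S (x y : R[i] -> R[i]) : eqvK S x y ->
  exists2 d : R, (S -> d = 0) & eqvK True x (addK y (fun=> d%:C)).
Proof.
move=> [d Sd [a [b [a0 b0 H]]]]; exists d => //; exists 0 => //.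
by exists a, b; split => // z /H ->; rewrite addr0.
Qed.

Lemma free_stable (S : Prop) nu A B C : 0 < A -> 0 < B -> 0 < C ->
  eqvK S (addK (scK A (vphi nu)) (scK B (vphi nu))) (scK C (vphi nu)) ->
  exists2 d : R, (S -> d = 0) &
    same_conv Free (dilation A nu) (dilation B nu) (dilation C nu) (point_mass d).
Proof.
move=> A0 B0 C0 /eqvK_shift[d Sd E]; exists d => //.
have [B1 B10 H1] := vphi_translate d (dilation C nu).
have [B2 B20 H2] := vphi_point_mass d.
have E1 : eqvK True (vphi (translate d (dilation C nu)))
    (addK (vphi (dilation C nu)) (fun=> d%:C)).
  by exists 0 => //; exists 1, B1; split => // z /H1 ->; rewrite addr0.
have E2 : eqvK True (vphi (point_mass d)) (fun=> d%:C).
  by exists 0 => //; exists 1, B2; split => // z /H2 ->; rewrite addr0.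
exists (translate d (dilation C nu)); apply: free_conv_vphi.
- apply: eqvK_trans E1 _; apply: eqvK_trans (eqvK_add (vphi_dilation _ _ C0) (eqvK_refl _ _)) _.
  apply: eqvK_trans (eqvK_sym E) _.
  by apply: eqvK_add; apply: eqvK_sym; exact: vphi_dilation.
- by apply: eqvK_trans E1 _; apply: eqvK_add; [exact: eqvK_refl|exact: eqvK_sym].
Qed.

(* A relation on a truncated cone extends to the upper half-plane, where
   Boolean energies are holomorphic. *)
Lemma bool_energy_upper nu A B C (d : R) : 0 < A -> 0 < B -> 0 < C ->
  (exists a b : R, [/\ 0 < a, 0 < b & forall z, TC a b z ->
    addK (scK A (bool_energy nu)) (scK B (bool_energy nu)) z =
    scK C (bool_energy nu) z + d%:C]) ->
  forall z, 0 < complex.Im z ->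
    bool_energy (dilation A nu) z + bool_energy (dilation B nu) z =
    bool_energy (dilation C nu) z + d%:C.
Proof.
move=> A0 B0 C0 [a [b [a0 b0 H]]].
have dil t w : 0 < t -> 0 < complex.Im w ->
    bool_energy (dilation t nu) w = scK t (bool_energy nu) w.
  move=> t0 w0; rewrite /bool_energy recip_dilation // /scK mulrBr mulrCA divff ?mulr1 //.
  by rewrite realC_eq0 gt_eqF.
pose f w := bool_energy (dilation A nu) w + bool_energy (dilation B nu) w -
    (bool_energy (dilation C nu) w + d%:C).
move=> z z0; apply/eqP; rewrite -subr_eq0; apply/eqP.
(* This aperture, with the height [Im z / 2], puts [z] inside the cone. *)
pose a' := `|complex.Re z| / complex.Im z + 1.
have a'0 : 0 < a' by rewrite ltr_wpDl // divr_ge0 // ltW.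
have jK mu w : 0 < complex.Im w -> jet2 (bool_energy mu) w.
  by move=> w0; apply: jet2B; [exact: jet2_id|exact: jet2_recip].
apply: (identity_cone (f := f) (a := a') (b := complex.Im z / 2) a'0 a0 (b' := b)).
- move=> w [w1 _]; have w0 : 0 < complex.Im w by rewrite (lt_trans _ w1) // divr_gt0.
  apply: jet2B; apply: jet2D; try exact: jK; exact: jet2_cst.
- move=> w wc; have w0 : 0 < complex.Im w := lt_trans b0 wc.1.
  rewrite /f !dil //; have := H _ wc; rewrite /addK => ->; exact: subrr.
- split; first by rewrite ltr_pdivrMr // ltr_pMr // ltr1n.
  by rewrite /a' mulrDl mul1r divfK ?gt_eqF // ltrDl.
Qed.
End Linearization.

(** * Characteristic functions *)
Section Cis.
Variable R : realType.
Implicit Types (s t : R).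

Definition cis t : R[i] := cos t +i* sin t.

Lemma cisD s t : cis (s + t) = cis s * cis t.
Proof. by rewrite /cis cosD sinD; apply: complex_ext => //=; rewrite addrC. Qed.

Lemma cis0 : cis 0 = 1.
Proof. by rewrite /cis cos0 sin0. Qed.

Lemma normc_cis t : normc (cis t) = 1.
Proof. by rewrite /= cos2Dsin2 sqrtr1. Qed.

Lemma cis_neq0 t : cis t != 0.
Proof. by rewrite -normc_gt0 normc_cis. Qed.

Lemma cisN t : cis (- t) = (cis t)^-1.
Proof.
apply: (mulfI (cis_neq0 t)); rewrite -cisD subrr cis0 divff //; exact: cis_neq0.
Qed.

Lemma lipschitz1 (f df : R -> R) s t : continuous f ->
  (forall x : R, is_derive x 1 f (df x)) -> (forall x, `|df x| <= 1) -> `|f s - f t| <= `|s - t|.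
Proof.
move=> cf dfP d1.
wlog st : s t / s <= t.
  move=> H; have [|/ltW ts] := leP s t; first exact: H.
  by rewrite distrC (distrC s); exact: H.
have [c _ E] := MVT_segment st (fun x _ => dfP x) (continuous_subspaceT cf).
by rewrite distrC E (distrC s) normrM ler_piMl.
Qed.

Lemma normc_cis_sub s t : normc (cis s - cis t) <= 2 * `|s - t|.
Proof.
rewrite (le_trans (normc_le_ReIm _)) // mulr_natl mulr2n lerD //.
- rewrite cReB /=; apply: (lipschitz1 (f := cos) (df := fun x => - sin x)).
  + exact: continuous_cos.
  + by move=> x; rewrite normrN sin_max.
- rewrite cImB /=; apply: (lipschitz1 (f := sin) (df := cos)).
  + exact: continuous_sin.
  + by move=> x; rewrite cos_max.
Qed.

Lemma cis_eq1 t : `|t| < pi -> cis t = 1 -> t = 0.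
Proof.
move=> tpi [ct _].
have : cos `|t| = cos 0 by rewrite cos0 -ct; have [_|_] := ger0P t; rewrite ?cosN.
move=> /eqP; apply: contraTeq => t0.
have p0 := pi_gt0 R.
by rewrite lt_eqF // ltr_cos ?in_itv /= ?normr_gt0 ?normr_ge0 ?lexx ?ltW.
Qed.
End Cis.

(** * The abstract structure for characteristic functions *)

Section CharDomain.
Variables (R : realType) (S : Prop).
Local Notation M := (R -> R[i]).
Implicit Types (x y : M) (X Y : nat -> M) (s t l : R).

Definition addC x y : M := fun s => x s * y s.
Definition scC l x : M := fun s => x (l * s).
Definition eqvC x y := exists2 d : R, (S -> d = 0) & forall s, x s = y s * cis (d * s).

(** Continuous convergence: [X n] may be evaluated at points that move with [n], such as [C n * s].
    For a constant sequence this is continuity. *)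
Definition cvC X x := (forall n, X n 0 = 1) /\
  forall s (e : R), 0 < e -> exists (d : R) (N : nat), 0 < d /\
    forall n t, (N <= n)%N -> `|t - s| < d -> normc (X n t - x s) < e.

(** The characteristic function of a lattice law has modulus 1 also at points other than 0, hence
    the demand for strict inequality arbitrarily near 0. *)
Definition nondegC x := (forall s, normc (x s) <= 1) /\
  forall d : R, 0 < d -> exists s, [/\ 0 < s, s < d & normc (x s) < 1].

Lemma cvC_pt X x s : cvC X x -> ccvg (fun n => X n s) (x s).
Proof.
move=> [_ H]; apply: ccvg_normc0; apply/cvgrPdist_lt => e e0.
have [d [N [d0 HN]]] := H s e e0; exists N => // n Nn.
by rewrite /= sub0r normrN ger0_norm ?normc_ge0 // HN // subrr normr0.
Qed.

Lemma cvC_at0 X x : cvC X x -> x 0 = 1.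
Proof.
move=> H; apply: (ccvg_unique (cvC_pt 0 H)).
by under eq_fun do rewrite H.1; exact: ccvg_cst.
Qed.

Lemma cvC_add X Y x y : cvC X x -> cvC Y y -> cvC (fun n => addC (X n) (Y n)) (addC x y).
Proof.
move=> [X0 HX] [Y0 HY]; split; first by move=> n; rewrite /addC X0 Y0 mulr1.
move=> s e e0; pose K := normc (x s) + normc (y s) + 1.
have nx := normc_ge0 (x s); have ny := normc_ge0 (y s).
have K0 : 0 < K by rewrite /K; lra.
have m0 : 0 < Num.min 1 (e / K) by rewrite lt_min ltr01 divr_gt0.
have [d1 [N1 [d10 H1]]] := HX s _ m0; have [d2 [N2 [d20 H2]]] := HY s _ m0.
exists (Num.min d1 d2), (maxn N1 N2); split; first by rewrite lt_min d10.
move=> n t; rewrite geq_max => /andP[n1 n2]; rewrite lt_min => /andP[t1 t2].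
have := H1 n t n1 t1; have := H2 n t n2 t2.
rewrite !lt_min !ltr_pdivlMr // => /andP[a1 a2] /andP[b1 b2].
rewrite /addC; have -> : X n t * Y n t - x s * y s =
  (X n t - x s) * (Y n t - y s) + (X n t - x s) * y s + x s * (Y n t - y s) by ring.
have := normc_leD ((X n t - x s) * (Y n t - y s) + (X n t - x s) * y s) (x s * (Y n t - y s)).
have := normc_leD ((X n t - x s) * (Y n t - y s)) ((X n t - x s) * y s).
rewrite !normcM; have := normc_ge0 (X n t - x s); have := normc_ge0 (Y n t - y s).
move: a1 a2 b1 b2; rewrite /K.
set p := normc (X n t - x s); set q := normc (Y n t - y s).
set u := normc (_ + _ + _); set v := normc (_ + _).
move: p q u v (normc (x s)) (normc (y s)) nx ny.
move=> p q u v a b a0 b0 *; nra.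
Qed.

Lemma cvC_sc (A : nat -> R) (a : R) x : (forall n, 0 < A n) -> 0 <= a ->
  A n @[n --> \oo] --> a -> cvC (fun=> x) x -> cvC (fun n => scC (A n) x) (scC a x).
Proof.
move=> A0 a0 Aa [x0 Hx]; split; first by move=> n; rewrite /scC mulr0; exact: (x0 0%N).
move=> s e e0; have [d [N [d0 H]]] := Hx (a * s) e e0.
have s1 : 0 < 2 * (`|s| + 1) by rewrite mulr_gt0 // ltr_wpDl.
have a1 : 0 < 2 * (a + 1) by rewrite mulr_gt0 // ltr_wpDl.
have m0 : 0 < Num.min 1 (d / (2 * (`|s| + 1))) by rewrite lt_min ltr01 divr_gt0.
have /cvgrPdist_lt/(_ _ m0) [N' _ HN'] := Aa.
exists (d / (2 * (a + 1))), N'; split; first by rewrite divr_gt0.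
move=> n t Nn td; apply: (H N) => //.
have := HN' n Nn; rewrite /= distrC lt_min ltr_pdivlMr // => /andP[A1 A2].
have An : `|A n| <= a + 1 by rewrite gtr0_norm //; move: A1; rewrite ltr_norml => /andP[_]; lra.
have -> : A n * t - a * s = A n * (t - s) + (A n - a) * s by ring.
move: td; rewrite ltr_pdivlMr // => td.
rewrite (le_lt_trans (ler_normD _ _)) // !normrM.
have := normr_ge0 (t - s); have := normr_ge0 s; have := normr_ge0 (A n); have := normr_ge0 (A n - a).
move: `|t - s| `|s| `|A n| `|A n - a| td A2 An => p q u v *; nra.
Qed.

Lemma cvC_add0 (A : nat -> R) x : (forall n, 0 < A n) -> A n @[n --> \oo] --> 0 ->
  cvC (fun=> x) x -> cvC (fun n => addC x (scC (A n) x)) x.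
Proof.
move=> A0 Aa cx; have := cvC_add cx (cvC_sc A0 (lexx 0) Aa cx).
have -> // : addC x (scC 0 x) = x.
by apply/funext => s; rewrite /addC /scC mul0r (cvC_at0 cx) mulr1.
Qed.

Lemma nondegC_add x y : nondegC x -> nondegC y -> nondegC (addC x y).
Proof.
move=> [x1 nx] [y1 _]; split=> [s|d d0]; rewrite /addC.
  by rewrite normcM mulr_ile1 ?normc_ge0.
have [s [s0 sd xs]] := nx d d0; exists s; split => //.
by rewrite normcM (le_lt_trans _ xs) // ler_piMr ?normc_ge0.
Qed.

Lemma nondegC_sc l x : 0 < l -> nondegC x -> nondegC (scC l x).
Proof.
move=> l0 [x1 nx]; split=> [s|d d0]; rewrite /scC; first exact: x1.
have [s [s0 sd xs]] := nx (l * d) (mulr_gt0 l0 d0); exists (s / l); split.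
- exact: divr_gt0.
- by rewrite ltr_pdivrMr // mulrC.
- by rewrite mulrCA divff ?mulr1 // gt_eqF.
Qed.

Lemma eqvC_refl x : eqvC x x.
Proof. by exists 0 => // s; rewrite mul0r cis0 mulr1. Qed.

Lemma eqvC_sym x y : eqvC x y -> eqvC y x.
Proof.
move=> [d Sd H]; exists (- d); first by move=> /Sd ->; rewrite oppr0.
by move=> s; rewrite H mulNr cisN mulfK // cis_neq0.
Qed.

Lemma eqvC_trans x y (z : M) : eqvC x y -> eqvC y z -> eqvC x z.
Proof.
move=> [d Sd Hd] [e Se He]; exists (d + e); first by move=> s; rewrite Sd ?Se ?addr0.
by move=> s; rewrite Hd He mulrDl cisD -mulrA (mulrC (cis (e * s))).
Qed.

Lemma eqvC_add x y x' y' : eqvC x x' -> eqvC y y' -> eqvC (addC x y) (addC x' y').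
Proof.
move=> [d Sd Hd] [e Se He]; exists (d + e); first by move=> s; rewrite Sd ?Se ?addr0.
by move=> s; rewrite /addC Hd He mulrDl cisD; ring.
Qed.

Lemma eqvC_sc l x y : 0 < l -> eqvC x y -> eqvC (scC l x) (scC l y).
Proof.
move=> l0 [d Sd Hd]; exists (d * l); first by move=> /Sd ->; rewrite mul0r.
by move=> s; rewrite /scC Hd mulrA.
Qed.

Lemma eqC_eqv x y : x =1 y -> eqvC x y.
Proof. by move=> /funext ->; exact: eqvC_refl. Qed.

Lemma eqvC_normc x y s : eqvC x y -> normc (x s) = normc (y s).
Proof. by move=> [d _ ->]; rewrite normcM normc_cis mulr1. Qed.

Lemma nmC n x s : nm addC n x s = x s ^+ n.+1.
Proof. by elim: n => [|n IH] /=; rewrite ?expr1 // /addC IH -exprSr. Qed.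

(** Shifts do not affect moduli, so the relation gives [|x s| ^+ n.+1 = |x (l * s)|]. The left side
    tends to 0, whereas [s] is so small that the right side exceeds 1/2 for all [l <= L]. *)
Lemma growthC x (L : R) : cvC (fun=> x) x -> nondegC x -> 0 < L ->
  exists N, forall n l, (N <= n)%N -> 0 < l <= L -> ~ eqvC (nm addC n x) (scC l x).
Proof.
move=> cx [x1 nx] L0; have half : 0 < 2^-1 :> R by rewrite invr_gt0.
have [d [N [d0 H]]] := cx.2 0 _ half.
have [s [s0 sd xs]] := nx (d / L) (divr_gt0 d0 L0).
have : normc (x s) ^+ n @[n --> \oo] --> 0.
  by apply: cvg_expr; rewrite ger0_norm ?normc_ge0.
move=> /cvgrPdist_lt/(_ _ half) [N' _ HN']; exists N' => n l Nn /andP[l0 lL] E.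
have := eqvC_normc s E; rewrite nmC normcX.
have := HN' n.+1 (leq_trans Nn (leqnSn n)).
rewrite /= sub0r normrN ger0_norm ?exprn_ge0 ?normc_ge0 // => E1 E2.
have : `|l * s - 0| < d.
  rewrite subr0 gtr0_norm ?mulr_gt0 //; move: sd; rewrite ltr_pdivlMr // mulrC.
  by apply: le_lt_trans; rewrite ler_pM2r.
move/(H N _ (leqnn _)); rewrite (cvC_at0 cx) normc_distC.
have := normc_geB 1 (x (l * s)); rewrite normc1.
by move: E1 E2; rewrite /scC; lra.
Qed.

(** Moduli forget the shifts and bound the scales; the shifts are bounded afterwards, and two
    successive extractions make both converge. *)
Lemma typesC X Y x y (C : nat -> R) : cvC X x -> cvC Y y ->
  nondegC x -> nondegC y -> (forall n, 0 < C n) ->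
  (forall n, eqvC (X n) (scC (C n) (Y n))) ->
  exists2 c : R, 0 < c & eqvC x (scC c y) /\
  forall eps (N : nat), 0 < eps -> exists2 n, (N <= n)%N & `|C n - c| < eps.
Proof.
move=> cX cY nx ny C0 E.
pose d n := projT1 (cid2 (E n)).
have dS n : S -> d n = 0 by rewrite /d; case: cid2.
have dE n s : X n s = Y n (C n * s) * cis (d n * s) by rewrite /d; case: cid2.
have nE n s : normc (X n s) = normc (Y n (C n * s)) by rewrite dE normcM normc_cis mulr1.
have x0 := cvC_at0 cX; have y0 := cvC_at0 cY.
(* [C] stays away from zero, since [Y] is close to [1] near the origin *)
have near1 Z z (w : R[i]) : cvC Z z -> normc w < 1 -> exists2 r : R, 0 < r &
    exists N, forall n t, (N <= n)%N -> `|t| < r -> (1 + normc w) / 2 < normc (Z n t).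
  move=> cZ w1; have e0 : 0 < (1 - normc w) / 2 by rewrite divr_gt0 // subr_gt0.
  have [r [N [r0 H]]] := cZ.2 0 _ e0; exists r => //; exists N => n t Nn tr.
  have := H n t Nn; rewrite subr0 => /(_ tr); rewrite (cvC_at0 cZ) normc_distC.
  by have := normc_geB 1 (Z n t); rewrite normc1; lra.
have below Z z s : cvC Z z -> normc (z s) < 1 ->
    \forall n \near \oo, normc (Z n s) < (1 + normc (z s)) / 2.
  move=> cZ z1; have H := cvg_normc (cvC_pt s cZ).
  by apply: (cvgr_lt _ H); lra.
have [m m0 mC] : exists2 m, 0 < m & \forall n \near \oo, m <= C n.
  have [s [s0 _ xs]] := nx.2 1 ltr01.
  have [r r0 [N HN]] := near1 _ _ _ cY xs.
  exists (r / s); first exact: divr_gt0.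
  have B := below _ _ _ cX xs.
  near=> n; rewrite leNgt; apply/negP; rewrite ltr_pdivlMr // => Cs.
  have Bn : normc (X n s) < (1 + normc (x s)) / 2 by near: n; exact: B.
  have Nn : (N <= n)%N by near: n; exact: nbhs_infty_ge.
  have := HN n (C n * s) Nn; rewrite gtr0_norm ?mulr_gt0 // => /(_ Cs).
  by rewrite -nE => H; have := lt_trans H Bn; rewrite ltxx.
(* The same argument at [s / C n], with [X] and [Y] exchanged. *)
have [K K0 CK] : exists2 K, 0 < K & \forall n \near \oo, C n <= K.
  have [s [s0 _ ys]] := ny.2 1 ltr01.
  have [r r0 [N HN]] := near1 _ _ _ cX ys.
  exists (s / r); first exact: divr_gt0.
  have B := below _ _ _ cY ys.
  near=> n; rewrite leNgt; apply/negP; rewrite ltr_pdivrMr // mulrC -ltr_pdivrMr // => Cs.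
  have Bn : normc (Y n s) < (1 + normc (y s)) / 2 by near: n; exact: B.
  have Nn : (N <= n)%N by near: n; exact: nbhs_infty_ge.
  have := HN n (s / C n) Nn; rewrite gtr0_norm ?divr_gt0 // => /(_ Cs).
  rewrite nE mulrCA divff ?gt_eqF // mulr1 => H.
  by have := lt_trans H Bn; rewrite ltxx.
(* at [s = pi / d] the shift contributes the factor [-1], so [d] is bounded *)
have [D D0 dD] : exists2 D, 0 < D & \forall n \near \oo, `|d n| <= D.
  have q0 : 0 < 4^-1 :> R by rewrite invr_gt0.
  have [r1 [N1 [r10 H1]]] := cX.2 0 _ q0; have [r2 [N2 [r20 H2]]] := cY.2 0 _ q0.
  pose r := Num.min r1 (r2 / K).
  have r0 : 0 < r by rewrite lt_min r10 divr_gt0.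
  exists (pi / r); first by rewrite divr_gt0 // pi_gt0.
  near=> n; rewrite leNgt; apply/negP => Dd.
  have d0 : 0 < `|d n| by apply: lt_trans Dd; rewrite divr_gt0 // pi_gt0.
  have dn : d n != 0 by rewrite -normr_gt0.
  have Nn1 : (N1 <= n)%N by near: n; exact: nbhs_infty_ge.
  have Nn2 : (N2 <= n)%N by near: n; exact: nbhs_infty_ge.
  have CKn : C n <= K by near: n; exact: CK.
  have sr : `|pi / d n| < r.
    rewrite normrM normfV (gtr0_norm (pi_gt0 R)) ltr_pdivrMr // mulrC.
    by rewrite -ltr_pdivrMr.
  move: (sr); rewrite lt_min => /andP[sr1 sr2].
  have := H1 n (pi / d n) Nn1; rewrite subr0 => /(_ sr1); rewrite x0.
  have := H2 n (C n * (pi / d n)) Nn2; rewrite subr0 y0 normrM (gtr0_norm (C0 n)).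
  have -> : C n * `|pi / d n| < r2.
    move: sr2; rewrite ltr_pdivlMr // mulrC; apply: le_lt_trans.
    by rewrite ler_wpM2r.
  move=> /(_ isT); rewrite dE (mulrC (d n)) divfK // => E1 E2.
  have : normc (Y n (C n * (pi / d n)) * cis pi - 1 + (Y n (C n * (pi / d n)) - 1)) < 4^-1 + 4^-1.
    by rewrite (le_lt_trans (normc_leD _ _)) // ltrD.
  have -> : cis pi = -1 :> R[i] by rewrite /cis cospi sinpi; apply: complex_ext => //=; rewrite oppr0.
  (* Both [u] and [- u] would be within 1/4 of 1. *)
  set u := Y n _; have -> : u * -1 - 1 + (u - 1) = - ((2 : R)%:C).
    by rewrite (_ : (2 : R)%:C = 2); [ring|rewrite rmorph_nat].
  by rewrite normc_opp normcR gtr0_norm //; lra.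
have [N1 _ HN1] := mC; have [N2 _ HN2] := CK; have [N3 _ HN3] := dD.
pose N4 := maxn N1 (maxn N2 N3).
have CB n : (N4 <= n)%N -> [/\ m <= C n, C n <= K & `|d n| <= D].
  by rewrite !geq_max => /and3P[? ? ?]; split; [exact: HN1|exact: HN2|exact: HN3].
have bC : bounded_fun (fun n => C (n + N4)%N : R^o).
  exists K; split=> [|k Kk n _]; first exact: num_real.
  have [_ KK _] := CB (n + N4)%N (leq_addl _ _).
  by rewrite /= (gtr0_norm (C0 _)) (le_trans KK) // ltW.
have [f finc /cvg_ex[/= c fc]] := bolzano_weierstrass bC.
have bd : bounded_fun (fun n => d (f n + N4)%N : R^o).
  exists D; split=> [|k Dk n _]; first exact: num_real.
  have [_ _ DD] := CB (f n + N4)%N (leq_addl _ _).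
  by rewrite /= (le_trans DD) // ltW.
have [g ginc /cvg_ex[/= e ge]] := bolzano_weierstrass bd.
pose h k := (f (g k) + N4)%N.
have kinc (u : nat -> nat) k : increasing_seq u -> (k <= u k)%N.
  move=> uinc; elim: k => // k IH; apply: leq_ltn_trans IH _.
  by have := (increasing_seqP u).2 uinc k.
have kg k : (k <= g k)%N by exact: kinc.
have kh k : (k <= h k)%N.
  by rewrite (leq_trans (kg k)) // (leq_trans (kinc f (g k) finc)) // leq_addr.
have hoo : h n @[n --> \oo] --> \oo.
  by apply/cvgnyPge => A; exists A => // k /= Ak; exact: leq_trans (kh k).
have goo : g n @[n --> \oo] --> \oo.
  by apply/cvgnyPge => A; exists A => // k /= Ak; exact: leq_trans (kg k).
have hN k : (N4 <= h k)%N by rewrite leq_addl.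
have hc : C (h n) @[n --> \oo] --> c.
  by apply: (cvg_comp g (fun k => C (f k + N4)%N)); [exact: goo|exact: fc].
have hd : d (h n) @[n --> \oo] --> e by exact: ge.
have mc : m <= c.
  by apply: (ler_cvg_to (cvg_cst m) hc); apply: nearW => k; have [] := CB _ (hN k).
have c0 : 0 < c := lt_le_trans m0 mc.
exists c => //; split; last first.
  move=> eps N e0; have /cvgrPdist_lt/(_ _ e0) [N' _ H] := hc.
  exists (h (maxn N N')); first by rewrite (leq_trans _ (kh _)) // leq_maxl.
  by rewrite distrC; apply: H; exact: leq_maxr.
exists e.
  move=> s; have Z : d (h n) @[n --> \oo] --> (0 : R).
    by under eq_fun do rewrite dS //; exact: cvg_cst.
  exact: (cvg_unique _ hd Z).
move=> s; apply: (ccvg_unique (ccvg_sub hoo (cvC_pt s cX))).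
have -> : (fun k => X (h k) s) = fun k => Y (h k) (C (h k) * s) * cis (d (h k) * s).
  by apply/funext => k; rewrite dE.
apply: ccvgM.
  apply: ccvg_normc0; apply/cvgrPdist_lt => eps e0.
  have [r [N [r0 HY]]] := cY.2 (c * s) _ e0.
  have Cs : C (h n) * s @[n --> \oo] --> c * s by apply: cvgM => //; exact: cvg_cst.
  have /cvgrPdist_lt/(_ _ r0) Cr := Cs.
  near=> k; rewrite sub0r normrN ger0_norm ?normc_ge0 //; apply: HY.
    by rewrite (leq_trans _ (kh k)) //; near: k; exact: nbhs_infty_ge.
  by rewrite distrC; near: k; exact: Cr.
have es : d (h n) * s @[n --> \oo] --> e * s by apply: cvgM => //; exact: cvg_cst.
split => /=.
- by apply: continuous_cvg => //; exact: continuous_cos.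
- by apply: continuous_cvg => //; exact: continuous_sin.
Unshelve. all: by end_near.
Qed.

Lemma char_domain : conv_domain addC scC eqvC cvC nondegC.
Proof.
split.
- exact: eqvC_refl.
- exact: eqvC_sym.
- exact: eqvC_trans.
- exact: eqvC_add.
- exact: eqvC_sc.
- by move=> x y; apply: eqC_eqv => z; rewrite /addC mulrC.
- by move=> x y z; apply: eqC_eqv => w; rewrite /addC mulrA.
- by move=> x; apply: eqC_eqv => w; rewrite /scC mul1r.
- by move=> l m x l0 m0; apply: eqC_eqv => w; rewrite /scC mulrA (mulrC l).
- by move=> l x y l0; exact: eqC_eqv.
- exact: cvC_add.
- by move=> A a x A0 a0 Aa; apply: cvC_sc => //; exact: ltW.
- exact: cvC_add0.
- exact: nondegC_add.
- exact: nondegC_sc.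
- exact: typesC.
- exact: growthC.
Qed.
End CharDomain.

(** * Trigonometric polynomials as test functions *)

Section TrigonometricPolynomials.
Variable R : realType.
Implicit Types (f g : R -> R) (mu nu : prob R).

(** Finite sums of shifted cosines have integrals that are read off the characteristic function. The
    shifts bring in sines and constants, and product-to-sum formulas make the class an algebra. *)
Inductive trigpoly : (R -> R) -> Prop :=
| trigpoly_cos c a b : trigpoly (fun x => c * cos (a * x + b))
| trigpoly_add f g : trigpoly f -> trigpoly g -> trigpoly (fun x => f x + g x).

Lemma trigpoly_ext f g : f =1 g -> trigpoly f -> trigpoly g.
Proof. by move=> /funext ->. Qed.

Lemma trigpoly_cst c : trigpoly (fun=> c).
Proof.
apply: trigpoly_ext (trigpoly_cos c 0 0) => x.
by rewrite mul0r addr0 cos0 mulr1.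
Qed.

Lemma trigpoly_sin c a b : trigpoly (fun x => c * sin (a * x + b)).
Proof.
apply: trigpoly_ext (trigpoly_cos (- c) a (b + pi / 2)) => x.
by rewrite addrA cosDpihalf mulrNN.
Qed.

Lemma trigpoly_mul f g : trigpoly f -> trigpoly g -> trigpoly (fun x => f x * g x).
Proof.
move=> tf tg; elim: tf => [c a b|f1 f2 _ IH1 _ IH2]; last first.
  by apply: trigpoly_ext (trigpoly_add IH1 IH2) => x; rewrite mulrDl.
elim: tg => [c' a' b'|g1 g2 _ IH1 _ IH2]; last first.
  by apply: trigpoly_ext (trigpoly_add IH1 IH2) => x; rewrite mulrDr.
apply: trigpoly_ext (trigpoly_add (trigpoly_cos (c * c' / 2) (a + a') (b + b'))
  (trigpoly_cos (c * c' / 2) (a - a') (b - b'))) => x.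
have -> : (a + a') * x + (b + b') = (a * x + b) + (a' * x + b') by ring.
have -> : (a - a') * x + (b - b') = (a * x + b) - (a' * x + b') by ring.
by rewrite cosD cosB; field.
Qed.

Lemma trigpoly_exp f n : trigpoly f -> trigpoly (fun x => f x ^+ n).
Proof.
move=> tf; elim: n => [|n IH]; first exact: trigpoly_cst.
by apply: trigpoly_ext (trigpoly_mul tf IH) => x; rewrite exprS.
Qed.

Lemma cb_comp_affine f a b : cb f -> cb (fun x => f (a * x + b)).
Proof.
move=> [cf [M fM]]; split; last by exists M.
move=> x; apply: (@continuous_comp _ _ _ (fun x : R => a * x + b) f); last exact: cf.
apply: cvgD; last exact: cvg_cst.
by apply: cvgM; [exact: cvg_cst|exact: cvg_id].
Qed.

Lemma cb_cos : cb (@cos R).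
Proof. by split; [exact: continuous_cos|exists 1 => x; exact: cos_max]. Qed.

Lemma cb_sin : cb (@sin R).
Proof. by split; [exact: continuous_sin|exists 1 => x; exact: sin_max]. Qed.

Lemma cb_trigpoly f : trigpoly f -> cb f.
Proof.
elim=> [c a b|f1 f2 _ c1 _ c2]; last exact: cbD.
by apply: cbZ; apply: cb_comp_affine; exact: cb_cos.
Qed.
End TrigonometricPolynomials.

(** * Characteristic functions of probability measures *)

Section CharacteristicFunction.
Variable R : realType.
Implicit Types (mu nu rho : prob R) (s t : R).

Definition chf mu s : R[i] := cE mu (fun x => cis (s * x)).

Lemma ccb_cis s : ccb (fun x : R => cis (s * x)).
Proof.
have E (f : R -> R) : (fun x => f (s * x)) = (fun x => f (s * x + 0)).
  by apply/funext => x; rewrite addr0.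
split => /=; rewrite E; apply: cb_comp_affine; [exact: cb_cos|exact: cb_sin].
Qed.

Lemma normc_chf mu s : normc (chf mu s) <= 1.
Proof. by apply: normc_cE_bound => [|x]; [exact: ccb_cis|rewrite normc_cis]. Qed.

(** Equicontinuity comes from the tail: for [|t - s| < 1 / b] the increment is at most
    [2 * tail (m n) b], and one [b] serves all large [n]. Pointwise convergence at [s] does the
    rest. *)
Lemma chf_cvg (m : nat -> prob R) l : wcvg m l -> cvC (fun n => chf (m n)) (chf l).
Proof.
move=> ml; split=> [n|s e e0].
  rewrite /chf -[RHS](cE_cst (m n)); apply: eq_cE => x.
  by rewrite mul0r cis0.
have e4 : 0 < e / 4 by rewrite divr_gt0.
have e2 : 0 < e / 2 by rewrite divr_gt0.
have [b b0 tb] := tail_small l e4.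
have [N1 _ H1] := tail_wcvg b0 ml tb.
have /cvgrPdist_lt/(_ _ e2) [N2 _ H2] := ccvg_dist (wcvg_cE ml (ccb_cis s)).
exists b^-1, (maxn N1 N2); split; first by rewrite invr_gt0.
move=> n t; rewrite geq_max => /andP[n1 n2] ts.
have -> : chf (m n) t - chf l s = (chf (m n) t - chf (m n) s) + (chf (m n) s - chf l s) by ring.
rewrite (le_lt_trans (normc_leD _ _)) // [e]splitr ltr_leD //; last first.
  by have := H2 n n2; rewrite /= sub0r normrN ger0_norm ?normc_ge0 // => /ltW.
have : normc (chf (m n) t - chf (m n) s) <= 2 * tail (m n) b.
  rewrite /chf -cEB; [|exact: ccb_cis|exact: ccb_cis].
  rewrite /tail -EcZ; last exact: cb_trunc.
  apply: normc_cE_le => [||x]; first by apply: ccbB; exact: ccb_cis.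
    by apply: cbZ; exact: cb_trunc.
  rewrite /trunc minr_pMr // mulr1 le_min; apply/andP; split.
    by rewrite (le_trans (normc_leB _ _)) // !normc_cis.
  rewrite (le_trans (normc_cis_sub _ _)) // -mulrBl normrM ler_wpM2l // mulrC.
  by rewrite ler_wpM2l // ltW.
by have := H1 n n1; rewrite /=; lra.
Qed.

(** Modulus 1 at [s] means that [cis (s * x)] has zero variance, so it is almost surely constant.
    Along [s k] tending to 0 these values determine [x]: if two points share them all,
    [cis (s k * (x - y)) = 1], and for large [k] the argument is below [pi] in absolute value, hence
    0. *)
Lemma chf_nondeg nu : nondegenerate nu -> nondegC (chf nu).
Proof.
move=> nd; split=> [s|d d0]; first exact: normc_chf.
apply: contrapT => /forallNP H; apply: nd.
pose K := (Num.truncn d^-1).+1.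
have Kd : d^-1 < K%:R by rewrite truncnS_gt.
have K0 : 0 < K%:R :> R by rewrite ltr0n.
pose s (k : nat) : R := (K + k)%:R^-1.
have sK k : 0 < (K + k)%:R :> R by rewrite ltr0n addSn.
have s0 k : 0 < s k by rewrite invr_gt0.
have sd k : s k < d.
  rewrite /s invf_plt ?posrE //; apply: lt_le_trans Kd _.
  by rewrite ler_nat leq_addr.
have h1 k : normc (chf nu (s k)) = 1.
  apply/eqP; rewrite eq_le normc_chf leNgt; apply/negP => lt1.
  by apply: (H (s k)); split.
apply: (degenerate_of_null_integrals (f := fun k x => normc (cis (s k * x) - chf nu (s k)) ^+ 2)).
- by move=> k; apply/cb_sqr_normc/ccbB; [exact: ccb_cis|exact: ccb_cst].
- by move=> k x; exact: sqr_ge0.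
- move=> k; rewrite /chf variance_cE; last exact: ccb_cis.
  under eq_Rintegral => x _ do rewrite normc_cis expr1n.
  by rewrite Ec_cst -/(chf nu (s k)) h1 expr1n subrr.
- move=> x y fx fy; apply/eqP; rewrite -subr_eq0; apply/eqP.
  have E k : cis (s k * (x - y)) = 1.
    move: (fx k) (fy k) => /eqP; rewrite sqrf_eq0 normc_eq0 subr_eq0 => /eqP e1.
    move=> /eqP; rewrite sqrf_eq0 normc_eq0 subr_eq0 => /eqP e2.
    rewrite mulrBr cisD cisN e1 e2 divff // -normc_gt0 h1 //.
  have p0 := pi_gt0 R.
  pose k := (Num.truncn (`|x - y| / pi)).+1.
  have kx : `|x - y| / pi < (K + k)%:R.
    by rewrite (lt_le_trans (truncnS_gt _)) // ler_nat leq_addl.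
  have : s k * (x - y) = 0.
    apply: cis_eq1; last exact: E.
    rewrite normrM (gtr0_norm (s0 k)) /s mulrC ltr_pdivrMr // mulrC.
    by rewrite -ltr_pdivrMr.
  by move=> /eqP; rewrite mulf_eq0 gt_eqF //= => /eqP.
Qed.

Lemma chf_dilation a mu s : chf (dilation a mu) s = chf mu (a * s).
Proof.
rewrite /chf cE_dilation; last exact: ccb_cis.
by apply: eq_cE => x; rewrite mulrA (mulrC s).
Qed.

Lemma chf_point_mass b s : chf (point_mass b) s = cis (b * s).
Proof. by rewrite /chf cE_point_mass ?(mulrC b) //; exact: ccb_cis. Qed.

Lemma integral_prod mu nu (f g : R -> R) : cb f -> cb g ->
  \int[(mu \x nu)%E]_p (f p.1 * g p.2) = (\int[mu]_x f x) * (\int[nu]_y g y).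
Proof.
move=> cf cg.
have mf : measurable_fun [set: measurableTypeR R * measurableTypeR R]
    (fun p => f p.1 * g p.2).
  apply: measurable_funM.
  - by apply: (measurableT_comp (cb_measurable cf)); exact: measurable_fst.
  - by apply: (measurableT_comp (cb_measurable cg)); exact: measurable_snd.
have intf : (mu \x nu)%E.-integrable setT
    (EFin \o (fun p : measurableTypeR R * measurableTypeR R => f p.1 * g p.2)).
  apply: measurable_bounded_integrable => //.
    by rewrite (le_lt_trans (probability_le1 _ _)) // ltry.
  case: (cf) => _ [M fM]; case: (cg) => _ [N gN].
  exists (M * N); split=> [|y My p _]; first exact: num_real.
  by apply: le_trans (ltW My); rewrite /= normrM; apply: ler_pM.
rewrite /Rintegral -(integral12_prod_meas1 intf) /fubini_F.

have E x : (\int[nu]_y (EFin \o (fun p : measurableTypeR R * measurableTypeR R => (f p.1 * g p.2)%R)) (x, y))%E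
    = (f x * \int[nu]_y g y)%:E.
  rewrite -[LHS]fineK; first by rewrite -EcZ.
  apply: integrable_fin_num => //.
  exact: (@cb_integrable _ nu (fun y => f x * g y) (cbZ _ cg)).
transitivity (\int[mu]_x (f x * \int[nu]_y g y)).
  by congr fine; apply: eq_integral => x _; exact: E.
exact: (@RintegralZr _ _ _ mu _ _ (\int[nu]_y g y) measurableT (cb_integrable mu cf)).
Qed.

Lemma chf_conv mu nu rho : classical_conv mu nu rho ->
  forall s, chf rho s = chf mu s * chf nu s.
Proof.
move=> H s.
have add_meas : measurable_fun [set: measurableTypeR R * measurableTypeR R]
    (fun p => p.1 + p.2 : measurableTypeR R).
  by apply: measurable_funD; [exact: measurable_fst|exact: measurable_snd].
have E f : cb f -> \int[rho]_x f x = \int[(mu \x nu)%E]_p (f (p.1 + p.2)).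
  move=> cf; rewrite /Rintegral; congr fine.
  rewrite (eq_measure_integral (pushforward (mu \x nu)%E
    (fun p : measurableTypeR R * measurableTypeR R => p.1 + p.2 : measurableTypeR R))); last first.
    by move=> A mA _; exact: H.
  rewrite integral_pushforward //.
    by apply/measurable_EFinP; exact: cb_measurable.
  rewrite preimage_setT.
  apply: measurable_bounded_integrable => //.
  - by rewrite (le_lt_trans (probability_le1 _ _)) // ltry.
  - by apply: (measurableT_comp (cb_measurable cf)).
  - case: (cf) => _ [M fM]; exists M; split=> [|y My p _]; first exact: num_real.
    by apply: le_trans (ltW My) => /=.
have cadd (f : R -> R) : cb f -> forall r, cb (fun x => f (r * x)).
  move=> cf r; have := cb_comp_affine r 0 cf.
  by under eq_fun do rewrite addr0.
have cc := cadd _ (@cb_cos R) s; have cs := cadd _ (@cb_sin R) s.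
have F f g : cb f -> cb g -> (mu \x nu)%E.-integrable setT
    (EFin \o (fun p : measurableTypeR R * measurableTypeR R => f p.1 * g p.2)).
  move=> cf cg; apply: measurable_bounded_integrable => //.
  - by rewrite (le_lt_trans (probability_le1 _ _)) // ltry.
  - apply: measurable_funM.
    + by apply: (measurableT_comp (cb_measurable cf)); exact: measurable_fst.
    + by apply: (measurableT_comp (cb_measurable cg)); exact: measurable_snd.
  - case: (cf) => _ [M fM]; case: (cg) => _ [N gN].
    exists (M * N); split=> [|y My p _]; first exact: num_real.
    by apply: le_trans (ltW My); rewrite /= normrM; apply: ler_pM.
apply: complex_ext; rewrite ?cReM ?cImM /=.
- rewrite E //; under eq_Rintegral => p _ do rewrite mulrDr cosD.
  rewrite RintegralB //; [|exact: (F _ _ cc cc)|exact: (F _ _ cs cs)].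
  by rewrite (integral_prod mu nu cc cc) (integral_prod mu nu cs cs).
- rewrite E //; under eq_Rintegral => p _ do rewrite mulrDr sinD addrC.
  rewrite RintegralD //; [|exact: (F _ _ cc cs)|exact: (F _ _ cs cc)].
  by rewrite (integral_prod mu nu cc cs) (integral_prod mu nu cs cc).
Qed.

Definition pair_sum (p : measurableTypeR R * measurableTypeR R) : measurableTypeR R :=
  p.1 + p.2.

Lemma measurable_pair_sum : measurable_fun setT pair_sum.
Proof. by apply: measurable_funD; [exact: measurable_fst|exact: measurable_snd]. Qed.

HB.instance Definition _ :=
  isMeasurableFun.Build _ _ _ _ pair_sum measurable_pair_sum.

Lemma conv_exists mu nu : exists rho, classical_conv mu nu rho.
Proof. by exists (distribution (mu \x nu)%E pair_sum) => A mA. Qed.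
End CharacteristicFunction.

(** * A law is determined by its characteristic function *)

Section Uniqueness.
Variable R : realType.
Implicit Types (mu nu : prob R) (s t : R).

Lemma sin_lower : exists2 r : R, 0 < r & forall t, 0 <= t < r -> t / 2 <= sin t.
Proof.
have h0 : 0 < 2^-1 :> R by rewrite invr_gt0.
have /cvgrPdist_lt/(_ _ h0) [r /= r0 H] := @continuous_cos R 0.
exists r => // t /andP[t0 tr].
have [c] := MVT_segment t0 (fun x _ => @is_derive_sin R x) (continuous_subspaceT (@continuous_sin R)).
rewrite in_itv /= sin0 !subr0 => /andP[c0 ct] ->.
have : `|cos 0 - cos c| < 2^-1.
  by apply: H; rewrite /= sub0r normrN ger0_norm // (le_lt_trans ct).
rewrite cos0 ltr_norml => /andP[_ H1]; rewrite mulrC ler_wpM2r //; lra.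
Qed.

Lemma bernoulli (s : R) n : -1 <= s -> 1 + n%:R * s <= (1 + s) ^+ n.
Proof.
move=> s1; elim: n => [|n IH]; first by rewrite mul0r addr0 expr0.
have s0 : 0 <= 1 + s by lra.
rewrite exprS (le_trans _ (ler_wpM2l s0 IH)) // -natr1.
have n0 : 0 <= n%:R :> R by [].
have : 0 <= n%:R * s ^+ 2 by rewrite mulr_ge0 ?sqr_ge0.
by move=> ?; lra.
Qed.

(* Bernoulli's inequality: [(1 - u^m)^(2^m)] tends to [1] when [2u < 1] and to
   [0] when [2u > 1]. *)
Definition step m (u : R) := (1 - u ^+ m) ^+ (2 ^ m).

Lemma step_bounds m u : 0 <= u <= 1 -> 0 <= step m u <= 1.
Proof.
move=> /andP[u0 u1]; have um0 : 0 <= u ^+ m by exact: exprn_ge0.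
have um1 : u ^+ m <= 1 by rewrite exprn_ile1.
by rewrite exprn_ge0 ?exprn_ile1 //; lra.
Qed.

(** Bernoulli gives the lower bound [1 - (1 - s) ^+ m]; then [(1 - s) ^+ m * (1 + s) ^+ m <= 1] and
    a second use of Bernoulli bound the power. *)
Lemma step_low m s : 0 <= s <= 1 -> 1 - (1 + m%:R * s)^-1 <= step m ((1 - s) / 2).
Proof.
move=> /andP[s0 s1]; have u0 : 0 <= (1 - s) / 2 by lra.
have um1 : ((1 - s) / 2) ^+ m <= 1 by rewrite exprn_ile1 //; lra.
rewrite /step; have := @bernoulli (- ((1 - s) / 2) ^+ m) (2 ^ m) ltac:(lra).
apply: le_trans; rewrite mulrN lerD2l lerN2.
rewrite natrX -exprMn mulrCA divff ?mulr1 //.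
have p1 : 0 < 1 + s by lra.
have pm : 0 < 1 + m%:R * s by rewrite ltr_pwDl // mulr_ge0.
have H : (1 - s) ^+ m * (1 + s) ^+ m <= 1.
  by rewrite -exprMn exprn_ile1 //; [apply: mulr_ge0; lra|nra].
rewrite -[X in _ <= X]mul1r ler_pdivlMr // (le_trans _ H) //.
by rewrite ler_wpM2l ?bernoulli ?exprn_ge0 //; lra.
Qed.

(** As [(1 - u ^+ m) * (1 + u ^+ m) <= 1], a lower bound for [(1 + u ^+ m) ^+ (2 ^ m)] is enough.
    Bernoulli gives [1 + (1 + s) ^+ m], and once more [1 + m s] for the last power. *)
Lemma step_high m s : 0 <= s <= 1 -> step m ((1 + s) / 2) <= (1 + m%:R * s)^-1.
Proof.
move=> /andP[s0 s1]; set u := (1 + s) / 2.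
have u0 : 0 < u by rewrite /u; lra.
have um0 : 0 < u ^+ m by exact: exprn_gt0.
have um1 : u ^+ m <= 1 by rewrite exprn_ile1 // /u; lra.
have pm : 0 < 1 + m%:R * s by rewrite ltr_pwDl // mulr_ge0.
have H : step m u * (1 + u ^+ m) ^+ (2 ^ m) <= 1.
  rewrite /step -exprMn exprn_ile1 //; first by apply: mulr_ge0; lra.
  by have := sqr_ge0 (u ^+ m); lra.
rewrite -[X in _ <= X]mul1r ler_pdivlMr // (le_trans _ H) //.
have um : u ^+ m <= 1 := um1.
rewrite ler_wpM2l //; first by rewrite /step exprn_ge0 //; lra.
have B1 : 1 + (2 ^ m)%:R * u ^+ m <= (1 + u ^+ m) ^+ (2 ^ m) by apply: bernoulli; lra.
rewrite (le_trans _ B1) // natrX -exprMn /u mulrCA divff // mulr1.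
have B2 : 1 + m%:R * s <= (1 + s) ^+ m by apply: bernoulli; lra.
by rewrite (le_trans B2) // lerDr.
Qed.

Lemma law_eq_halflines mu nu :
  (forall b, mu `]-oo, b]%classic = nu `]-oo, b]%classic) -> same_law mu nu.
Proof.
move=> H A mA.
have mG : measurable = <<s @RGenOInfty.G R >> by exact: RGenOInfty.measurableE.
have IG : setI_closed (@RGenOInfty.G R).
  move=> _ _ [x ->] [y ->]; exists (Num.max x y); apply/seteqP; split => z /=;
    rewrite !in_itv /= !andbT gt_max.
  - by case=> -> ->.
  - by move=> /andP[].
have M := @measure_unique _ _ (measurableTypeR R) (@RGenOInfty.G R) (fun n : nat => `](- n%:R : R), +oo[%classic) mG IG.
apply: (M R _ _ mu nu) => //.
- by move=> n; exists (- n%:R).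
- apply/seteqP; split => // x _; exists (Num.truncn `|x|).+1 => //=.
  rewrite in_itv /= andbT ltrNl (le_lt_trans (ler_norm _)) // normrN.
  exact: truncnS_gt.
- move=> _ [x ->].
  have P (m : prob R) : m `]x, +oo[%classic = (1 - m `]-oo, x]%classic)%E.
    by rewrite -setCitvl probability_setC.
  by transitivity (1 - mu `]-oo, x]%classic)%E; [exact: P|rewrite H; exact/esym/P].
- by move=> n; rewrite (le_lt_trans (probability_le1 _ _)) // ltry.
Qed.

(** The indicator of a closed half-line is a pointwise limit of trigonometric polynomials with
    values in [0, 1], so dominated convergence carries the equality of integrals over to
    half-lines. *)
Theorem chf_inj mu nu : chf mu =1 chf nu -> same_law mu nu.
Proof.
move=> E; apply: law_eq_halflines => b.
have trig f : trigpoly f -> \int[mu]_x f x = \int[nu]_x f x.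
  elim=> [c a d|f1 f2 t1 IH1 t2 IH2]; last first.
    by rewrite !EcD ?IH1 ?IH2 //; exact: cb_trigpoly.
  have [Ec Es] : \int[mu]_x cos (a * x) = \int[nu]_x cos (a * x) /\
      \int[mu]_x sin (a * x) = \int[nu]_x sin (a * x).
    by have := E a; rewrite /chf /cE /= => -[].
  have [cc cs] := ccb_cis a.
  have F x : c * cos (a * x + d) = (c * cos d) * cos (a * x) - (c * sin d) * sin (a * x).
    by rewrite cosD; ring.
  under eq_Rintegral => x _ do rewrite F.
  under [RHS]eq_Rintegral => x _ do rewrite F.
  rewrite !EcB ?EcZ //; try exact: cbZ.
  by rewrite Ec Es.
have [r r0 sl] := sin_lower.
(* Division by [n.+1] brings every [x] eventually into the range where sine has the sign of its
   argument and at least half its size; the offset puts the endpoint [b] itself on the left. The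
   sine is then at least a constant times [1 / n.+1 ^ 2] in size, so that the exponent [n.+1 ^ 3]
   leaves an error of order [1 / n.+1]. *)
pose th (n : nat) (x : R) := (x - b - n.+1%:R^-1) / n.+1%:R.
pose u n x := (1 + sin (th n x)) / 2.
pose w n x := step (n.+1 ^ 3) (u n x).
have tw n : trigpoly (w n).
  apply: trigpoly_exp.
  apply: (@trigpoly_ext _ (fun x => 1 + (-1) * u n x ^+ (n.+1 ^ 3))).
    by move=> x; rewrite mulN1r.
  apply: trigpoly_add; first exact: trigpoly_cst.
  apply: trigpoly_mul; first exact: trigpoly_cst.
  apply: trigpoly_exp.
  apply: (@trigpoly_ext _ (fun x => 2^-1 + 2^-1 * sin (n.+1%:R^-1 * x + - (b + n.+1%:R^-1) / n.+1%:R))).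
    move=> x; have -> : n.+1%:R^-1 * x + - (b + n.+1%:R^-1) / n.+1%:R = th n x.
      by rewrite /th; ring.
    by rewrite /u; ring.
  by apply: trigpoly_add; [exact: trigpoly_cst|exact: trigpoly_sin].
have u01 n x : 0 <= u n x <= 1.
  have := sin_max (th n x); rewrite ler_norml => /andP[s1 s2].
  by rewrite /u; apply/andP; split; lra.
pose L x : R := \1_(`]-oo, b]%classic) x.
have n0 n : 0 < n.+1%:R :> R by rewrite ltr0n.
have err x c : 0 < c -> (\forall n \near \oo, `|w n x - L x| <= (1 + (n.+1 ^ 3)%:R * (c / n.+1%:R ^+ 2))^-1) ->
    w n x @[n --> \oo] --> L x.
  move=> c0 H; apply/subr_cvg0; apply: norm_cvg0.
  have : c^-1 * n.+1%:R^-1 @[n --> \oo] --> (0 : R).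
    by rewrite -(mulr0 c^-1); apply: cvgM; [exact: cvg_cst|exact: cvg_harmonic].
  apply: (squeeze_cvgr _ (cvg_cst 0)).
  apply: filterS H => n Hn; rewrite normr_ge0 (le_trans Hn) // -invfM lef_pV2 ?posrE.
  - have -> : (n.+1 ^ 3)%:R * (c / n.+1%:R ^+ 2) = c * n.+1%:R :> R.
      by rewrite natrX; field; rewrite gt_eqF.
    by rewrite lerDr.
  - by rewrite ltr_pwDl // mulr_ge0 // divr_ge0 ?sqr_ge0 // ltW.
  - by rewrite mulr_gt0.
have wL x : w n x @[n --> \oo] --> L x.
  have small : \forall n \near \oo, `|th n x| < r.
    have : (`|x - b| + 1) * n.+1%:R^-1 @[n --> \oo] --> (0 : R).
      rewrite -(mulr0 (`|x - b| + 1)); apply: cvgM; [exact: cvg_cst|exact: cvg_harmonic].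
    move=> /cvgr_lt/(_ _ r0); apply: filterS => n; apply: le_lt_trans.
    rewrite /th normrM normfV (gtr0_norm (n0 n)) ler_wpM2r ?invr_ge0 ?(ltW (n0 n)) //.
    rewrite (le_trans (ler_normB _ _)) // lerD2l gtr0_norm ?invr_gt0 //.
    by rewrite invf_le1 // ler1n.
  have [xb|bx] := leP x b.
    have L1 : L x = 1 by rewrite /L indicE mem_set //= in_itv.
    apply: (err x (2^-1)) => //; apply: filterS small => n thr.
    have tn : n.+1%:R^-1 / n.+1%:R <= - th n x.
      rewrite /th -mulNr ler_wpM2r ?invr_ge0 ?(ltW (n0 n)) //.
      by move: (n.+1%:R^-1) => q; lra.
    have tp : 0 <= - th n x by rewrite (le_trans _ tn) // divr_ge0 // ?invr_ge0 ltW.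
    have S := sl (- th n x); rewrite tp -normrN ger0_norm // in thr S.
    have {}S := S thr; rewrite sinN in S.
    set s := - sin (th n x) in S.
    have s1 : s <= 1 by rewrite /s; have := sin_max (th n x); rewrite ler_norml => /andP[? ?]; lra.
    have s0 : 0 <= s by lra.
    have sn : 2^-1 / n.+1%:R ^+ 2 <= s.
      have E2 : 2^-1 / n.+1%:R ^+ 2 = n.+1%:R^-1 / n.+1%:R / 2 :> R by field; rewrite gt_eqF.
      by rewrite E2 (le_trans _ S) // ler_wpM2r.
    have uE : u n x = (1 - s) / 2 by rewrite /u /s opprK.
    have := step_low (n.+1 ^ 3) (introT andP (conj s0 s1)); rewrite -uE -/(w n x) => W.
    have /andP[w0 w1] := step_bounds (n.+1 ^ 3) (u01 n x).
    rewrite L1 distrC ger0_norm ?subr_ge0 //.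
    have : (1 + (n.+1 ^ 3)%:R * s)^-1 <= (1 + (n.+1 ^ 3)%:R * (2^-1 / n.+1%:R ^+ 2))^-1.
      rewrite lef_pV2 ?posrE.
      + by rewrite lerD2l ler_wpM2l.
      + by rewrite ltr_pwDl // mulr_ge0.
      + by rewrite ltr_pwDl // mulr_ge0 // divr_ge0 ?sqr_ge0.
    lra.
  have L0 : L x = 0 by rewrite /L indicE memNset //= in_itv /= leNgt bx.
  have c0 : 0 < (x - b) / 4 by lra.
  have close : \forall n \near \oo, n.+1%:R^-1 <= (x - b) / 2.
    by have := @cvg_harmonic R => /cvgr_le; apply; lra.
  apply: (err x _ c0); apply: filterS2 small close => n thr cl.
  have tn : (x - b) / 2 / n.+1%:R <= th n x.
    rewrite /th ler_wpM2r ?invr_ge0 ?(ltW (n0 n)) //.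
    by move: (n.+1%:R^-1) cl => q cl; lra.
  have tp : 0 <= th n x by rewrite (le_trans _ tn) // divr_ge0 ?(ltW (n0 n)) //; lra.
  have S := sl (th n x); rewrite tp ger0_norm // in thr S.
  have {}S := S thr.
  set s := sin (th n x) in S.
  have s1 : s <= 1 by rewrite /s; have := sin_max (th n x); rewrite ler_norml => /andP[].
  have s0 : 0 <= s by lra.
  have sn : (x - b) / 4 / n.+1%:R ^+ 2 <= s.
    have E2 : (x - b) / 4 / n.+1%:R ^+ 2 = (x - b) / 2 / n.+1%:R / 2 * n.+1%:R^-1.
      by field; rewrite gt_eqF.
    rewrite E2 (le_trans _ (_ : (x - b) / 2 / n.+1%:R / 2 <= s)) //; last first.
      by rewrite (le_trans _ S) // ler_wpM2r.
    rewrite ler_piMr //; last by rewrite invf_le1 // ler1n.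
    by rewrite !divr_ge0 ?(ltW (n0 n)) //; lra.
  have := step_high (n.+1 ^ 3) (introT andP (conj s0 s1)); rewrite -/(u n x) -/(w n x) => W.
  have /andP[w0 w1] := step_bounds (n.+1 ^ 3) (u01 n x).
  rewrite L0 subr0 ger0_norm // (le_trans W) // lef_pV2 ?posrE.
  + by rewrite lerD2l ler_wpM2l.
  + by rewrite ltr_pwDl // mulr_ge0.
  + by rewrite ltr_pwDl // mulr_ge0 // divr_ge0 ?sqr_ge0 // ltW.
have lim (P : prob R) : \int[P]_x w n x @[n --> \oo] --> fine (P `]-oo, b]%classic).
  have -> : fine (P `]-oo, b]%classic) = \int[P]_x L x.
    by rewrite /Rintegral integral_indic // setIT.
  have mw n : measurable_fun [set: measurableTypeR R] (w n).
    exact: cb_measurable (cb_trigpoly (tw n)).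
  have w1 n x : `|w n x| <= 1.
    by have /andP[w0 w1] := step_bounds (n.+1 ^ 3) (u01 n x); rewrite ger0_norm.
  exact: (@Ec_dct R P w L 1 mw w1 wL).
have fe : fine (mu `]-oo, b]%classic) = fine (nu `]-oo, b]%classic).
  have lim' : \int[mu]_x w n x @[n --> \oo] --> fine (nu `]-oo, b]%classic).
    have -> : (fun n => \int[mu]_x w n x) = (fun n => \int[nu]_x w n x).
      by apply/funext => n; exact: trig (tw n).
    exact: lim.
  exact: (cvg_unique _ (lim mu) lim').
rewrite -[LHS]fineK; last exact: fin_num_measure.
by rewrite fe fineK //; exact: fin_num_measure.
Qed.

Lemma classical_stable (S : Prop) nu A B C : 0 < A -> 0 < B -> 0 < C ->
  eqvC S (addC (scC A (chf nu)) (scC B (chf nu))) (scC C (chf nu)) ->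
  exists2 d : R, (S -> d = 0) &
    same_conv Classical (dilation A nu) (dilation B nu) (dilation C nu) (point_mass d).
Proof.
move=> A0 B0 C0 [d Sd H]; exists d => //.
have [rho H1] := conv_exists (dilation A nu) (dilation B nu).
have [rho' H2] := conv_exists (dilation C nu) (point_mass d).
exists rho => // D mD; rewrite -(H2 D mD); apply: chf_inj => // s.
rewrite (chf_conv H1) (chf_conv H2) !chf_dilation chf_point_mass.
exact: H.
Qed.
End Uniqueness.

(** * Boolean translations *)
Section RankOne.
Variable R : realType.
Local Notation C := R[i].
Local Open Scope sesquilinear_scope.

Lemma realC_real (r : R) : (r%:C : C) \is Num.real.
Proof. by rewrite complex_real. Qed.

(** This is the Aronszajn-Krein formula for [H = diag x + d e^T e] with [e = sqrt p]. The row
    [u = e (z - diag x)^-1] satisfies [u (z - H) = (1 - d g) e]. In an eigenbasis of [H] this reads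
    [u'_j (z - D_j) = (1 - d g) e'_j], and pairing with [e'] gives the claim, with weights
    [|e'_j|^2] at the eigenvalues. *)
Lemma rank_one_spectrum n (p x : 'I_n -> R) (d : R) : (forall i, 0 <= p i) ->
  exists w y : 'I_n -> R, [/\ forall j, 0 <= w j, \sum_j w j = \sum_i p i &
  forall z : C, 0 < complex.Im z ->
    (\sum_j (w j)%:C / (z - (y j)%:C)) * (1 - d%:C * (\sum_i (p i)%:C / (z - (x i)%:C)))
      = \sum_i (p i)%:C / (z - (x i)%:C)].
Proof.
move=> p0.
pose e : 'rV[C]_n := \row_i (Num.sqrt (p i))%:C.
pose H : 'M[C]_n := diag_mx (\row_i (x i)%:C) + d%:C *: (e^T *m e).
have er i : e 0 i \is Num.real by rewrite mxE realC_real.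
have Hh : H \is hermsymmx.
  apply/is_hermitianmxP; rewrite expr0 scale1r; apply/matrixP => i j.
  have HE k l : H k l = (x k)%:C *+ (k == l) + d%:C * (e 0 k * e 0 l).
    by rewrite !mxE big_ord1 !mxE; case: eqP.
  rewrite [RHS]mxE [H^T _ _]mxE (CrealP _).
    by rewrite !HE eq_sym [e 0 i * _]mulrC; case: eqP => // ->.
  rewrite HE; apply: rpredD; first by apply: rpredMn; exact: realC_real.
  by apply: rpredM; [exact: realC_real|exact: rpredM].
pose P := spectralmx H; pose D := spectral_diag H.
have PP : P^t* *m P = 1%:M.
  rewrite -invmx_unitary ?spectral_unitarymx // mulVmx //; exact: spectral_unit.
have PP' : P *m P^t* = 1%:M by apply/unitarymxP; exact: spectral_unitarymx.
have HE : H = P^t* *m diag_mx D *m P.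
  rewrite -invmx_unitary ?spectral_unitarymx //.
  exact: (orthomx_spectralP (hermitian_normalmx Hh)).
have Dr j : (complex.Re (D 0 j))%:C = D 0 j.
  have /mxOverP/(_ 0 j) := hermitian_spectral_diag_real Hh.
  exact: RRe_real.
pose e' := e *m P^t*.
have eC : e'^t* = P *m e^T.
  rewrite /e' trmx_mul map_mxM trmxCK; congr (_ *m _); apply/matrixP => i j.
  by rewrite [LHS]mxE [e^T _ _]mxE ord1; exact: CrealP.
exists (fun j => complex.Re (e' 0 j * (e' 0 j)^*)), (fun j => complex.Re (D 0 j)).
have wE j : (complex.Re (e' 0 j * (e' 0 j)^*))%:C = e' 0 j * (e' 0 j)^*.
  by apply: RRe_real; apply: ger0_real; exact: mul_conjC_ge0.
have e'2 : \sum_j e' 0 j * (e' 0 j)^* = (\sum_i p i)%:C.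
  have -> : \sum_j e' 0 j * (e' 0 j)^* = (e' *m e'^t*) 0 0.
    by rewrite mxE; apply: eq_bigr => j _; rewrite !mxE.
  have -> : e' *m e'^t* = e *m e^T by rewrite eC /e' mulmxA -(mulmxA e) PP mulmx1.
  rewrite mxE rmorph_sum; apply: eq_bigr => i _.
  by rewrite !mxE -rmorphM -expr2 sqr_sqrtr.
split.
- by move=> j; have := mul_conjC_ge0 (e' 0 j); rewrite lecE => /andP[].
- by move/(congr1 (@complex.Re R)): e'2; rewrite raddf_sum.
move=> z z0.
have nz (r : R) : z - r%:C != 0.
  by apply/eqP => /(congr1 (@complex.Im R)); rewrite cImB /= subr0 => h; move: z0; rewrite h ltxx.
set g := \sum_i _ / (z - (x i)%:C).
pose u : 'rV[C]_n := \row_i (e 0 i / (z - (x i)%:C)).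
have uH : u *m H = z *: u - (1 - d%:C * g) *: e.
  rewrite mulmxDr -scalemxAr mulmxA.
  have -> : u *m e^T = g%:M.
    rewrite [LHS]mx11_scalar; congr (_%:M); rewrite mxE; apply: eq_bigr => i _.
    by rewrite !mxE mulrAC -rmorphM -expr2 sqr_sqrtr.
  rewrite mul_scalar_mx; apply/rowP => i; rewrite !mxE.
  rewrite (bigD1 i) //= big1 ?addr0 => [|k ki]; last by rewrite !mxE (negbTE ki) mulr0n mulr0.
  rewrite !mxE eqxx mulr1n; field; exact: nz.
pose u' := u *m P^t*.
have u'E j : u' 0 j = (1 - d%:C * g) * e' 0 j / (z - D 0 j).
  have : u *m H *m P^t* = u' *m diag_mx D.
    by rewrite HE !mulmxA -mulmxA PP' mulmx1.
  rewrite uH mulmxBl -!scalemxAl -/u' -/e' => /rowP/(_ j).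
  rewrite [RHS]mxE (bigD1 j) //= big1 ?addr0 => [|k kj]; last by rewrite [diag_mx _ _ _]mxE (negbTE kj) mulr0n mulr0.
  rewrite [diag_mx _ _ _]mxE eqxx mulr1n [LHS]mxE [(z *: u') _ _]mxE => E.
  move: E; rewrite [X in _ + X]mxE [X in _ - X]mxE => E.
  have nD : z - D 0 j != 0 by rewrite -Dr; exact: nz.
  apply: (mulIf nD); rewrite divfK //; rewrite mulrBr -E; ring.
have gE : g = \sum_j u' 0 j * (e' 0 j)^*.
  have -> : \sum_j u' 0 j * (e' 0 j)^* = (u' *m e'^t*) 0 0.
    by rewrite mxE; apply: eq_bigr => j _; rewrite !mxE.
  have -> : u' *m e'^t* = u *m e^T by rewrite eC /u' mulmxA -(mulmxA u) PP mulmx1.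
  rewrite mxE; apply: eq_bigr => i _; rewrite !mxE mulrAC -rmorphM -expr2 sqr_sqrtr //.
rewrite [RHS]gE mulr_suml; apply: eq_bigr => j _; rewrite wE u'E Dr. ring.
Qed.
End RankOne.

(** * Distribution functions and Stieltjes sums *)

Section DistributionFunctions.
Variable R : realType.
Implicit Types (m : prob R) (f : R -> R).

Definition dfun m (x : R) : R := fine (m `]-oo, x]%classic).

Definition halfline (a x : R) : R := (x <= a)%R%:R.

Definition bmeas f := measurable_fun [set: measurableTypeR R] f /\ exists M, forall x, `|f x| <= M.

Lemma bmeas_cb f : cb f -> bmeas f.
Proof. by move=> cf; split; [exact: cb_measurable|case: cf]. Qed.

Lemma bmeas_halfline a : bmeas (halfline a).
Proof.
split; last by exists 1 => x; rewrite /halfline; case: (x <= a); rewrite ?normr0 ?normr1 // ler01.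
have -> : halfline a = \1_(`]-oo, a]%classic).
  by apply/funext => x; rewrite indicE mem_setE in_itv.
exact: measurable_indic.
Qed.

Lemma bmeasD f g : bmeas f -> bmeas g -> bmeas (fun x => f x + g x).
Proof.
move=> [mf [A fA]] [mg [B gB]]; split; first exact: measurable_funD.
by exists (A + B) => x; rewrite (le_trans (ler_normD _ _)) // lerD.
Qed.

Lemma bmeasZ c f : bmeas f -> bmeas (fun x => c * f x).
Proof.
move=> [mf [A fA]]; split; first by apply: measurable_funM => //; exact: measurable_cst.
by exists (`|c| * A) => x; rewrite normrM ler_wpM2l.
Qed.

Lemma bmeasB f g : bmeas f -> bmeas g -> bmeas (fun x => f x - g x).
Proof.
move=> bf bg; have := bmeasD bf (bmeasZ (-1) bg).
by under eq_fun do rewrite mulN1r.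
Qed.

Lemma bmeas_cst c : bmeas (fun=> c).
Proof. exact: bmeas_cb (cb_cst c). Qed.

Lemma bmeas_sum n (F : nat -> R -> R) : (forall i, bmeas (F i)) -> bmeas (fun x => \sum_(i < n) F i x).
Proof.
move=> bF; elim: n => [|n IH].
  by under eq_fun do rewrite big_ord0; exact: bmeas_cst.
by under eq_fun do rewrite big_ord_recr; exact: bmeasD.
Qed.

Lemma bmeas_integrable m f : bmeas f -> m.-integrable setT (EFin \o f).
Proof. by move=> [mf [A fA]]; exact: bounded_integrable mf fA. Qed.

Lemma Eb_sum m n (F : nat -> R -> R) : (forall i, bmeas (F i)) ->
  \int[m]_x (\sum_(i < n) F i x) = \sum_(i < n) \int[m]_x F i x.
Proof.
move=> bF; elim: n => [|n IH].
  by under eq_Rintegral do rewrite big_ord0; rewrite Ec_cst big_ord0.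
under eq_Rintegral do rewrite big_ord_recr.
rewrite RintegralD //=; first by rewrite IH big_ord_recr.
- by apply: bmeas_integrable; exact: bmeas_sum.
- exact: bmeas_integrable.
Qed.

Lemma Eb_halfline m a : \int[m]_x halfline a x = dfun m a.
Proof.
rewrite /Rintegral /dfun; congr fine.
transitivity (\int[m]_x (\1_(`]-oo, a]%classic) x)%:E)%E.
  by apply: eq_integral => x _; rewrite indicE mem_setE in_itv.
by rewrite integral_indic // setIT.
Qed.

Lemma dfunE m a : (dfun m a)%:E = m `]-oo, a]%classic.
Proof. by rewrite /dfun fineK // fin_num_measure. Qed.

Lemma dfun_ge0 m a : 0 <= dfun m a.
Proof. by rewrite fine_ge0. Qed.

Lemma dfun_le1 m a : dfun m a <= 1.
Proof. by rewrite -lee_fin dfunE probability_le1. Qed.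

Lemma dfun_homo m a b : a <= b -> dfun m a <= dfun m b.
Proof.
move=> ab; rewrite -lee_fin !dfunE; apply: le_measure; rewrite ?inE //.
exact: subset_itvl.
Qed.

(** Pointwise comparison with a step function: the error is at most [w] on the cells and [M] outside
    them, where the mass is [dfun m (x 0) + (1 - dfun m (x K))]. *)
Lemma grid_sum m f (x : nat -> R) (M w : R) K : cb f -> (forall t, `|f t| <= M) ->
  (forall i, x i <= x i.+1) ->
  (forall i t, (i < K)%N -> x i < t -> t <= x i.+1 -> `|f t - f (x i.+1)| <= w) ->
  0 <= w ->
  `|\int[m]_t f t - \sum_(i < K) f (x i.+1) * (dfun m (x i.+1) - dfun m (x i))|
    <= w + M * (dfun m (x 0) + (1 - dfun m (x K))).
Proof.
move=> cf fM xS fw w0.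
have M0 : 0 <= M := le_trans (normr_ge0 _) (fM 0).
pose D i t := halfline (x i.+1) t - halfline (x i) t.
have bD i : bmeas (D i) by apply: bmeasB; exact: bmeas_halfline.
pose h t := \sum_(i < K) f (x i.+1) * D i t.
have bh : bmeas h by apply: (@bmeas_sum _ (fun i t => f (x i.+1) * D i t)) => i; exact: bmeasZ.
have bf := bmeas_cb cf.
have -> : \sum_(i < K) f (x i.+1) * (dfun m (x i.+1) - dfun m (x i)) = \int[m]_t h t.
  rewrite (@Eb_sum _ _ (fun i t => f (x i.+1) * D i t)); last by move=> i; exact: bmeasZ.
  apply: eq_bigr => i _; rewrite RintegralZl //=; last exact: bmeas_integrable.
  rewrite RintegralB //=; try by apply: bmeas_integrable; exact: bmeas_halfline.
  by rewrite !Eb_halfline.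
rewrite -RintegralB //; try exact: bmeas_integrable.
pose g t := w + M * (halfline (x 0) t + (1 - halfline (x K) t)).
have bg0 : bmeas (fun t => halfline (x 0) t + (1 - halfline (x K) t)).
  by apply: bmeasD; [exact: bmeas_halfline|apply: bmeasB; [exact: bmeas_cst|exact: bmeas_halfline]].
have bg : bmeas g by apply: bmeasD; [exact: bmeas_cst|exact: bmeasZ].
have -> : w + M * (dfun m (x 0) + (1 - dfun m (x K))) = \int[m]_t g t.
  rewrite RintegralD //=; [|apply: bmeas_integrable..]; last 2 first.
  - exact: bmeas_cst.
  - exact: bmeasZ.
  rewrite Ec_cst RintegralZl //=; last exact: bmeas_integrable.
  rewrite RintegralD //=; [|apply: bmeas_integrable..]; last 2 first.
  - exact: bmeas_halfline.
  - by apply: bmeasB; [exact: bmeas_cst|exact: bmeas_halfline].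
  rewrite RintegralB //=; [|apply: bmeas_integrable..]; last 2 first.
  - exact: bmeas_cst.
  - exact: bmeas_halfline.
  by rewrite Ec_cst !Eb_halfline.
have step t : halfline (x 0) t <= halfline (x K) t /\
    `|f t * (halfline (x K) t - halfline (x 0) t) - h t| <=
      w * (halfline (x K) t - halfline (x 0) t).
  rewrite /h; elim: K fw {h bh g bg0 bg} => [|k IH] fw.
    by rewrite big_ord0 subrr !mulr0 subrr normr0.
  have [|H0 H1] := IH; first by move=> i s ik; apply: fw; exact: ltnW.
  rewrite big_ord_recr /=.
  have D0 : halfline (x k) t <= halfline (x k.+1) t.
    by rewrite /halfline ler_nat; case: (leP t (x k)) => // tk; rewrite (le_trans tk).
  have H2 : `|f t * D k t - f (x k.+1) * D k t| <= w * D k t.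
    rewrite -mulrBl normrM; have D0' : 0 <= D k t by rewrite subr_ge0.
    rewrite (ger0_norm D0').
    have [tk|tk] := leP t (x k).
      by rewrite /D /halfline tk (le_trans tk (xS k)) subrr !mulr0.
    have [tk1|tk1] := leP t (x k.+1); first by rewrite ler_wpM2r // fw.
    by rewrite /D /halfline ![t <= _]leNgt tk tk1 /= subrr !mulr0.
  split; first exact: le_trans H0 D0.
  move: H1 H2; rewrite !ler_norml /D => /andP[a1 a2] /andP[b1 b2].
  apply/andP; split; nra.
apply: le_trans (le_normr_Rintegral _ _) _ => //.
  by apply: bmeas_integrable; exact: bmeasB.
apply: le_Rintegral => //.
- apply: bmeas_integrable; have [mb [B HB]] := bmeasB bf bh; split.
    exact: measurableT_comp.
  by exists B => t; rewrite normr_id.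
- exact: bmeas_integrable.
move=> t _; have [H0 H1] := step t; have fMt := fM t.
have hl a : 0 <= halfline a t <= 1 by rewrite /halfline; case: (t <= a)%R => /=; rewrite ?lexx ?ler01.
have s0 := hl (x 0); have sK := hl (x K).
rewrite /g; move: H1 fMt s0 sK H0; move: (halfline _ _) (halfline _ _) (h t) (f t) => s0 sK ht ft.
rewrite !ler_norml => /andP[a1 a2] /andP[b1 b2] /andP[c1 c2] /andP[d1 d2] e.
(* [q] is the indicator of the complement of []x 0, x K]]. *)
set q := 1 - (sK - s0); have q0 : 0 <= q by rewrite /q; lra.
have Q : - (M * q) <= ft * q <= M * q by rewrite -mulNr !ler_wpM2r.
have W : w * (sK - s0) <= w by rewrite ler_piMr //; lra.
have -> : ft - ht = (ft * (sK - s0) - ht) + ft * q by rewrite /q; ring.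
have -> : s0 + (1 - sK) = q by rewrite /q; ring.
move: Q a1 a2 W; move: (ft * q) (M * q) (w * (sK - s0)) (_ - ht) => A B E G /andP[? ?] *.
apply/andP; split; lra.
Qed.
End DistributionFunctions.

Section DiscreteLaw.
Variables (R : realType) (n : nat) (w : nat -> {nonneg R}) (y : nat -> R).
Hypothesis w1 : \sum_(j < n) (w j)%:num = 1.

Definition discrete_measure : {measure set (measurableTypeR R) -> \bar R} :=
  msum (fun j => mscale (w j) (\d_(y j : measurableTypeR R))) n.

Lemma discrete_measureT : discrete_measure setT = 1%E.
Proof.
rewrite /discrete_measure /= /msum /= -w1 -sumEFin; apply: eq_bigr => j _.
by rewrite /mscale /= diracT mule1.
Qed.

Lemma discrete_law : exists m : prob R, forall f, cb f ->
  \int[m]_x f x = \sum_(j < n) (w j)%:num * f (y j).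
Proof.
pose H := Measure_isProbability.Build _ _ R discrete_measure discrete_measureT.
pose m : prob R := HB.pack (Measure.sort discrete_measure) H.
have pos f : cb f -> (forall x, 0 <= f x) -> \int[m]_x f x = \sum_(j < n) (w j)%:num * f (y j).
  move=> cf f0; apply: EFin_inj; rewrite /Rintegral fineK; last first.
    by apply: integrable_fin_num => //; exact: cb_integrable.
  have mf : measurable_fun [set: measurableTypeR R] (EFin \o f).
    by apply/measurable_EFinP; exact: cb_measurable.
  rewrite -sumEFin.
  transitivity (\int[discrete_measure]_x (f x)%:E)%E => //.
  rewrite ge0_integral_measure_sum //=; last by move=> x _; rewrite lee_fin.
  apply: eq_bigr => j _; rewrite ge0_integral_mscale //=; last by move=> x _; rewrite lee_fin.
  by rewrite integral_dirac //= diracT mul1e.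
(* Adding the bound [M] reduces the general case to non-negative functions. *)
exists m => f cf; have [M fM] := cf.2.
have bM : cb (fun x => f x + M) by apply: cbD => //; exact: cb_cst.
have := pos _ bM; rewrite EcD //; last exact: cb_cst.
rewrite Ec_cst => H'; apply: (@addIr _ M); rewrite H'; last first.
  by move=> x; have := fM x; rewrite ler_norml => /andP[]; rewrite lerNl -subr_ge0 opprK addrC.
under eq_bigr do rewrite mulrDr.
by rewrite big_split -mulr_suml w1 mul1r.
Qed.
End DiscreteLaw.

(** * From a monotone limit to a probability measure *)

Section RightRegularization.
Variables (R : realType) (F0 : R -> R).
Hypothesis F0_homo : forall x y, x <= y -> F0 x <= F0 y.
Hypothesis F0_ge0 : forall x, 0 <= F0 x.
Hypothesis F0_le1 : forall x, F0 x <= 1.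
Hypothesis F0_low : forall eps, 0 < eps -> exists B, F0 B <= eps.
Hypothesis F0_high : forall eps, 0 < eps -> exists B, 1 - eps <= F0 B.

(** A pointwise limit of distribution functions is monotone but may fail to be right-continuous; the
    infimum over later points repairs this. *)
Definition rreg (x : R) : R := inf [set F0 q | q in [set q | x < q]].

Lemma rreg_le x y : x < y -> rreg x <= F0 y.
Proof.
by move=> xy; apply: ge_inf; [exists 0 => _ [q _ <-]|exists y].
Qed.

Lemma rreg_glb x c : (forall y, x < y -> c <= F0 y) -> c <= rreg x.
Proof.
move=> H; apply: lb_le_inf; first by exists (F0 (x + 1)), (x + 1) => //=; rewrite ltrDl.
by move=> _ [q /= xq <-]; exact: H.
Qed.

Lemma rreg_ge x : F0 x <= rreg x.
Proof. by apply: rreg_glb => y /ltW /F0_homo. Qed.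

Lemma rreg_homo : {homo rreg : x y / x <= y}.
Proof. by move=> x y xy; apply: rreg_glb => z yz; apply: rreg_le; exact: le_lt_trans yz. Qed.

Lemma rreg_ge0 x : 0 <= rreg x.
Proof. exact: rreg_glb. Qed.

Lemma rreg_le1 x : rreg x <= 1.
Proof. by apply: (le_trans _ (F0_le1 (x + 1))); apply: rreg_le; rewrite ltrDl. Qed.

Lemma rreg_right : right_continuous rreg.
Proof.
move=> x; apply/cvgrPdist_le => e e0.
have [q xq Hq] : exists2 q, x < q & F0 q < rreg x + e.
  have hi : has_inf [set F0 q | q in [set q | x < q]].
    by split; [exists (F0 (x + 1)), (x + 1) => //=; rewrite ltrDl|exists 0 => _ [q _ <-]].
  by have [_ [q xq <-] H] := inf_adherent e0 hi; exists q.
near=> y; have xy : x < y by near: y; exact: nbhs_right_gt.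
have yq : y < q by near: y; exact: nbhs_right_lt.
have a := rreg_homo (ltW xy); have b := rreg_le yq.
rewrite distrC ger0_norm ?subr_ge0 // lerBlDl; apply: ltW; exact: le_lt_trans b Hq.
Unshelve. all: by end_near. Qed.

Lemma rreg_Ny : rreg @ -oo --> (0 : R).
Proof.
apply/cvgrPdist_le => e e0; have [B HB] := F0_low e0.
near=> x; rewrite sub0r normrN ger0_norm ?rreg_ge0 //.
apply: (le_trans _ HB); apply: rreg_le; near: x; apply: nbhs_ninfty_lt; exact: num_real.
Unshelve. all: by end_near. Qed.

Lemma rreg_y : rreg @ +oo --> (1 : R).
Proof.
apply/cvgrPdist_le => e e0; have [B HB] := F0_high e0.
near=> x; rewrite ger0_norm ?subr_ge0 ?rreg_le1 // lerBlDr -lerBlDl.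
apply: le_trans HB _; apply: le_trans (rreg_ge B) _; apply: rreg_homo.
near: x; apply: nbhs_pinfty_ge; exact: num_real.
Unshelve. all: by end_near. Qed.

HB.instance Definition _ := isCumulative.Build R _ R rreg rreg_homo rreg_right.
HB.instance Definition _ := isCumulativeBounded.Build R 0 1 rreg rreg_Ny rreg_y.

Lemma rreg_law : exists rho : prob R, forall x, dfun rho x = rreg x.
Proof.
exists (lebesgue_stieltjes_measure rreg) => x.
apply: EFin_inj; rewrite dfunE -cdf_lebesgue_stieltjes_id.
by [].
Qed.
End RightRegularization.

(** * Helly's theorem along an ultrafilter *)

Section Helly.
Variables (R : realType) (U : set_system nat).
Context {UU : UltraFilter U}.

(** An ultrafilter makes the distribution functions converge at all points at once, in place of a
    diagonal extraction. *)
Lemma ultra_bounded_cvg (u : nat -> R) (M : R) : (forall n, `|u n| <= M) -> exists l : R, u @ U --> l.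
Proof.
move=> uM.
have := @segment_compact R (- M) M; rewrite compact_ultra => H.
have uU : (u @ U) `[- M, M]%classic.
  suff E : u @^-1` `[- M, M]%classic = setT by rewrite /fmap /= E; exact: filterT.
  by apply/seteqP; split => // n _; rewrite /= in_itv /= -ler_norml.
have FU : UltraFilter (u @ U).
  split=> [|G GP UG]; first exact: fmap_proper_filter.
  rewrite eqEsubset; split => // A GA.
  case: (in_ultra_setVsetC (u @^-1` A) UU) => // UA.
  have GA' : G (~` A) by exact: UG.
  by case: (filter_ex (filterI GA GA')) => x [].
by have [l [_ ul]] := H _ FU uU; exists l.
Qed.

Lemma abel_sum (a D : nat -> R) K :
  \sum_(i < K) a i.+1 * (D i.+1 - D i) =
  a K * D K - a 0 * D 0 - \sum_(i < K) (a i.+1 - a i) * D i.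
Proof.
elim: K => [|K IH]; first by rewrite !big_ord0 subr0 subrr.
by rewrite !big_ord_recr /= IH; ring.
Qed.

(** [G] plays the right-continuous version of [F]; they may differ at grid points. The difference
    [D] is at most the increment of [F] over the next cell, so the [D i] sum to at most 1, and
    summation by parts moves the increments from [D] to [f]. *)
Lemma grid_compare (F G f : R -> R) (x : nat -> R) (M w : R) K :
  (forall t, `|f t| <= M) -> (forall i, x i < x i.+1) ->
  (forall i, `|f (x i.+1) - f (x i)| <= w) ->
  (forall s, 0 <= F s <= 1) -> (forall s, F s <= G s) -> (forall s, G s <= 1) ->
  (forall s t, s < t -> G s <= F t) ->
  `|\sum_(i < K) f (x i.+1) * (G (x i.+1) - G (x i)) -
    \sum_(i < K) f (x i.+1) * (F (x i.+1) - F (x i))| <=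
  w + M * (F (x 1%N) + (1 - F (x K))).
Proof.
move=> fM xS fw F01 FG G1 GF.
pose D i := G (x i) - F (x i).
have D0 i : 0 <= D i by rewrite subr_ge0.
have DF i : D i <= F (x i.+1) - F (x i) by rewrite lerD2r GF.
have w0 : 0 <= w := le_trans (normr_ge0 _) (fw 0).
have M0 : 0 <= M := le_trans (normr_ge0 _) (fM 0).
rewrite -sumrB (eq_bigr (fun i : 'I_K => f (x i.+1) * (D i.+1 - D i))); last first.
  by move=> i _; rewrite /D; ring.
rewrite (@abel_sum (fun i => f (x i))).
have S1 : `|\sum_(i < K) (f (x i.+1) - f (x i)) * D i| <= w.
  apply: le_trans (ler_norm_sum _ _ _) _.
  apply: (@le_trans _ _ (w * \sum_(i < K) (F (x i.+1) - F (x i)))).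
    rewrite mulr_sumr; apply: ler_sum => i _.
    by rewrite normrM (ger0_norm (D0 i)) ler_pM.
  rewrite ler_piMr //.
  have -> : \sum_(i < K) (F (x i.+1) - F (x i)) = F (x K) - F (x 0).
    by rewrite -(big_mkord xpredT (fun i => F (x i.+1) - F (x i))) telescope_sumr.
  by have /andP[] := F01 (x K); have /andP[] := F01 (x 0); lra.
have SK : `|f (x K) * D K| <= M * (1 - F (x K)).
  by rewrite normrM (ger0_norm (D0 K)) ler_pM // lerD2r.
have S0 : `|f (x 0) * D 0| <= M * F (x 1%N).
  rewrite normrM (ger0_norm (D0 0)) ler_pM // (le_trans (DF 0)) // lerBlDr lerDl.
  by have /andP[] := F01 (x 0).
apply: le_trans (ler_normB _ _) _; rewrite [leRHS]addrC; apply: lerD => //.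
apply: le_trans (ler_normB _ _) _; rewrite [leRHS]mulrDr [leRHS]addrC; exact: lerD.
Qed.

(** Lipschitz test functions suffice for Cauchy transforms, and their uniform modulus of continuity
    lets one equidistant grid compare all the integrals through Stieltjes sums. *)
Lemma helly (m : nat -> prob R) :
  (forall eps, 0 < eps -> exists B : R,
     \forall n \near U, dfun (m n) (- B) <= eps /\ 1 - eps <= dfun (m n) B) ->
  exists rho : prob R, forall f, cb f -> (exists L, forall s t, `|f s - f t| <= L * `|s - t|) ->
    \int[m n]_x f x @[n --> U] --> \int[rho]_x f x.
Proof.
move=> tight.
have F0ex x : exists l : R, dfun (m n) x @[n --> U] --> l.
  by apply: (@ultra_bounded_cvg _ 1) => n; rewrite ger0_norm ?dfun_ge0 ?dfun_le1.
pose F0 x := projT1 (cid (F0ex x)).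
have F0P x : dfun (m n) x @[n --> U] --> F0 x by rewrite /F0; case: (cid _).
have F0_homo x y : x <= y -> F0 x <= F0 y.
  move=> xy; apply: (ler_cvg_to (F0P x) (F0P y)); apply: filterE => n; exact: dfun_homo.
have F0_ge0 x : 0 <= F0 x.
  apply: (ler_cvg_to (cvg_cst 0) (F0P x)); apply: filterE => n; exact: dfun_ge0.
have F0_le1 x : F0 x <= 1.
  apply: (@ler_cvg_to _ U _ R (fun n => dfun (m n) x) (fun=> 1) _ _ (F0P x)); [exact: cvg_cst|apply: filterE => n; exact: dfun_le1].
have F0near B eps : (\forall n \near U, dfun (m n) (- B) <= eps /\ 1 - eps <= dfun (m n) B) ->
    F0 (- B) <= eps /\ 1 - eps <= F0 B.
  move=> HB; split.
  - by apply: (@ler_cvg_to _ U _ R (fun n => dfun (m n) (- B)) (fun=> eps) _ _ (F0P _));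
      [exact: cvg_cst|apply: filterS HB => n []].
  - by apply: (@ler_cvg_to _ U _ R (fun=> 1 - eps) (fun n => dfun (m n) B) _ _ _ (F0P _));
      [exact: cvg_cst|apply: filterS HB => n []].
have F0B eps : 0 < eps -> exists B, F0 (- B) <= eps /\ 1 - eps <= F0 B.
  by move=> /tight[B HB]; exists B; exact: F0near.
have F0l eps : 0 < eps -> exists B, F0 B <= eps.
  by move=> /F0B[B [? _]]; exists (- B).
have F0h eps : 0 < eps -> exists B, 1 - eps <= F0 B.
  by move=> /F0B[B [_ ?]]; exists B.
have [rho rhoE] := rreg_law F0_homo F0_ge0 F0_le1 F0l F0h.
exists rho => f cf [L HL]; have [M fM] := cf.2.
have M0 : 0 <= M := le_trans (normr_ge0 _) (fM 0).
have L0 : 0 <= L by have := HL 1 0; rewrite subr0 normr1 mulr1; exact: le_trans.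
apply/cvgrPdist_le => e e0.
(* The two passages from integrals to sums and the one from [F0] to its regularization cost 3/20 of
   [e] each, and the convergence of the sums 1/20. *)
pose e1 := e / (20 * (M + 1)); pose d := e / (20 * (L + 1)).
have e10 : 0 < e1 by rewrite divr_gt0 // mulr_gt0 // ltr_wpDl.
have d0 : 0 < d by rewrite divr_gt0 // mulr_gt0 // ltr_wpDl.
have Me1 : M * e1 <= e / 20.
  have -> : e / 20 = (M + 1) * e1 by rewrite /e1; field; rewrite gt_eqF // ltr_wpDl.
  by rewrite ler_pM2r // lerDl.
have Ld : L * d <= e / 20.
  have -> : e / 20 = (L + 1) * d by rewrite /d; field; rewrite gt_eqF // ltr_wpDl.
  by rewrite ler_pM2r // lerDl.
have Ld0 : 0 <= L * d by rewrite mulr_ge0 // ltW.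
have [B HB] := tight e1 e10; have [F1 F2] := F0near _ _ HB.
(* The grid starts one cell to the left of [- B], because the regularized value at [x 0] is bounded
   by [F0] at [x 1], that is at [- B]. *)
pose x (i : nat) : R := - B - d + i%:R * d.
have x1 : x 1%N = - B by rewrite /x mul1r subrK.
have xSE i : x i.+1 = x i + d by rewrite /x -natr1; ring.
have xS i : x i < x i.+1 by rewrite xSE ltrDl.
have [K xK] : exists K, B <= x K.
  exists (Num.truncn ((B + B + d) / d)).+1.
  have : (B + B + d) / d <= (Num.truncn ((B + B + d) / d)).+1%:R by exact: ltW (truncnS_gt _).
  by rewrite ler_pdivrMr // /x => ?; lra.
have osc i t : x i < t -> t <= x i.+1 -> `|f t - f (x i.+1)| <= L * d.
  move=> t1 t2; apply: le_trans (HL _ _) _; rewrite ler_wpM2l // distrC ger0_norm ?subr_ge0 //.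
  by move: t2 t1; rewrite xSE => *; lra.
pose S (G : R -> R) := \sum_(i < K) f (x i.+1) * (G (x i.+1) - G (x i)).
have near_grid (mu : prob R) : dfun mu (x 0) <= e1 -> 1 - e1 <= dfun mu (x K) ->
    `|\int[mu]_t f t - S (dfun mu)| <= 3 * (e / 20).
  move=> H0 HK.
  have G := @grid_sum R mu f x M (L * d) K cf fM (fun i => ltW (xS i)) (fun i t _ => osc i t) Ld0.
  apply: le_trans G _.
  have : M * (dfun mu (x 0) + (1 - dfun mu (x K))) <= M * (e1 + e1).
    by rewrite ler_wpM2l // lerD // lerBlDl -lerBlDr.
  by rewrite [X in _ <= X]mulrDr => ?; lra.
have rhoS : `|S (dfun rho) - S F0| <= 3 * (e / 20).
  apply: le_trans (@grid_compare F0 (dfun rho) f x M (L * d) K _ _ _ _ _ _ _) _ => //.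
  - move=> i; apply: le_trans (HL _ _) _.
    by rewrite xSE [x i + d]addrC addrK (gtr0_norm d0) lexx.
  - by move=> s; rewrite F0_ge0 F0_le1.
  - by move=> s; rewrite rhoE; exact: rreg_ge.
  - by move=> s; exact: dfun_le1.
  - by move=> s t st; rewrite rhoE; exact: rreg_le.
  - have : M * (F0 (x 1%N) + (1 - F0 (x K))) <= M * (e1 + e1).
      rewrite ler_wpM2l // x1 lerD // lerBlDl -lerBlDr.
      exact: le_trans F2 (F0_homo _ _ xK).
    by rewrite [X in _ <= X]mulrDr => ?; lra.
have rhoI : `|\int[rho]_t f t - S (dfun rho)| <= 3 * (e / 20).
  apply: near_grid; rewrite rhoE.
  - by apply: (le_trans _ F1); rewrite -x1; apply: rreg_le.
  - by apply: le_trans F2 _; apply: le_trans (F0_homo _ _ xK) _; exact: rreg_ge.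
have Scvg : S (dfun (m n)) @[n --> U] --> S F0.
  rewrite /S; elim: K {xK S near_grid rhoS rhoI} => [|k IH].
    by under eq_fun do rewrite big_ord0; rewrite big_ord0; exact: cvg_cst.
  under eq_fun do rewrite big_ord_recr; rewrite big_ord_recr /=.
  apply: cvgD IH _; apply: cvgM; [exact: cvg_cst|apply: cvgB; exact: F0P].
have e4 : 0 < e / 20 by rewrite divr_gt0.
have /cvgrPdist_le/(_ _ e4) HS := Scvg.
apply: filterS2 HB HS => n [B1 B2] HS.
have mI : `|\int[m n]_t f t - S (dfun (m n))| <= 3 * (e / 20).
  apply: near_grid.
  - by apply: (le_trans _ B1); apply: dfun_homo; rewrite -x1 ltW.
  - by apply: le_trans B2 _; exact: dfun_homo.
move: mI rhoI rhoS HS; move: (S _) (S _) (S _) (\int[m n]_t f t) (\int[rho]_t f t) => a b c a' b'.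
rewrite !ler_norml => /andP[? ?] /andP[? ?] /andP[? ?] /andP[? ?]; apply/andP; split; lra.
Qed.
End Helly.

(** * Existence of the Boolean convolution with a point mass *)

Section BooleanShift.
Variable R : realType.
Implicit Types (m nu : prob R) (z : R[i]) (b d x : R).
Local Notation G := (@cauchy_transform R).
Local Notation F := (@recip_cauchy R).
Local Notation res z x := ((z - x%:C)^-1).

Lemma outer_mass_le m b (g : R -> R) : 0 < b -> cb g -> (forall x, 0 <= g x) ->
  (forall x, b <= `|x| -> 1 <= g x) -> dfun m (- b) + (1 - dfun m b) <= \int[m]_x g x.
Proof.
move=> b0 cg g0 g1.
have bh a := bmeas_halfline (a : R).
have -> : dfun m (- b) + (1 - dfun m b) = \int[m]_x (halfline (- b) x + (1 - halfline b x)).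
  rewrite RintegralD //=; [|apply: bmeas_integrable..] => //; last first.
    by apply: bmeasB => //; exact: bmeas_cst.
  rewrite RintegralB //=; [|apply: bmeas_integrable..] => //; last exact: bmeas_cst.
  by rewrite Ec_cst !Eb_halfline.
apply: le_Rintegral => //.
- apply: bmeas_integrable; apply: bmeasD => //; apply: bmeasB => //; exact: bmeas_cst.
- exact: cb_integrable.
move=> x _; rewrite /halfline.
have [xb|xb] := leP x (- b).
  rewrite (le_trans xb) ?subrr ?addr0; last by rewrite (le_trans _ (ltW b0)) // oppr_le0 ltW.
  by apply: g1; rewrite lerNr in xb; rewrite (le_trans xb) // -normrN ler_norm.
have [xb'|xb'] := leP x b; first by rewrite subrr addr0.
by rewrite subr0 add0r; apply: g1; rewrite (le_trans (ltW xb')) // ler_norm.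
Qed.

Lemma outer_mass_tail m b : 0 < b -> dfun m (- b) + (1 - dfun m b) <= tail m b.
Proof.
move=> b0; apply: outer_mass_le => //; first exact: cb_trunc.
  by move=> x; exact: trunc_ge0.
by move=> x bx; rewrite /trunc le_min lexx /= ler_pdivlMr // mul1r.
Qed.

(** At [z = i b] the real part of [x / (z - x)] is [- x^2 / (x^2 + b^2)], at most -1/2 for
    [|x| >= b]. Tightness can thus be read off Cauchy transforms, which is what is known about the
    approximating laws. *)
Lemma outer_mass_cauchy m b : 0 < b ->
  dfun m (- b) + (1 - dfun m b) <= 2 * normc ((0 +i* b) * G m (0 +i* b) - 1).
Proof.
move=> b0; set z := 0 +i* b; have z0 : 0 < complex.Im z by [].
have E : z * G m z - 1 = cE m (fun x => x%:C / (z - x%:C)).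
  rewrite cauchyE -(cEZ _ _ (ccb_res z0)) -[X in _ - X](cE_cst m 1) -cEB; last 2 first.
  - exact/ccbZ/ccb_res.
  - exact: ccb_cst.
  by apply: eq_cE => x; field; exact: subR_neq0.
have ReE x : complex.Re (x%:C / (z - x%:C)) = - (x ^+ 2 / (x ^+ 2 + b ^+ 2)).
  by rewrite cReZ cReV cReB cImB /= sub0r subr0 sqrrN; ring.
have cr := (ccb_ratio z0).1.
apply: (@le_trans _ _ (\int[m]_x ((- 2) * complex.Re (x%:C / (z - x%:C))))).
  apply: outer_mass_le => //; first exact: cbZ.
  - move=> x; rewrite ReE mulrNN mulr_ge0 // divr_ge0 ?sqr_ge0 //.
    by rewrite addr_ge0 ?sqr_ge0.
  move=> x bx; rewrite ReE mulrNN mulrA ler_pdivlMr; last first.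
    by rewrite ltr_wpDl ?sqr_ge0 // exprn_gt0.
  rewrite mul1r mulr2n mulrDl mul1r lerD2l -[leRHS]real_normK ?num_real //.
  by rewrite ler_pXn2r // nnegrE ?normr_ge0 // ltW.
rewrite EcZ // mulNr -mulrN ler_wpM2l // E.
by rewrite (le_trans _ (Re_le_normc _)) // -normrN ler_norm.
Qed.

(** Each cell has its mass moved to its right endpoint, and the mass outside the grid goes to one
    extra atom to keep a probability. That mass enters the error twice: once for the part of the
    integral neglected, once for the extra atom. *)
Lemma discretize nu n : exists K (p x : 'I_K -> R), [/\ forall i, 0 <= p i, \sum_i p i = 1 &
  forall (f : R -> R) M L, cb f -> (forall t, `|f t| <= M) -> (forall s t, `|f s - f t| <= L * `|s - t|) ->
   `|\int[nu]_t f t - \sum_i p i * f (x i)| <= L * n.+1%:R^-1 + M * (2 * tail nu n.+1%:R)].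
Proof.
pose b : R := n.+1%:R; pose dl : R := b^-1.
have b0 : 0 < b by [].
have dl0 : 0 < dl by rewrite invr_gt0.
pose y (i : nat) : R := - b + i%:R * dl.
have ySE i : y i.+1 = y i + dl by rewrite /y -natr1; ring.
have yS i : y i <= y i.+1 by rewrite ySE lerDl ltW.
have [K yK] : exists K, b <= y K.
  exists (Num.truncn ((b + b) / dl)).+1.
  have : (b + b) / dl <= (Num.truncn ((b + b) / dl)).+1%:R by exact: ltW (truncnS_gt _).
  by rewrite ler_pdivrMr // /y => ?; lra.
have y0 : y 0 = - b by rewrite /y mul0r addr0.
pose q := dfun nu (y 0) + (1 - dfun nu (y K)).
have q0 : 0 <= q by rewrite addr_ge0 ?dfun_ge0 // subr_ge0 dfun_le1.
have qT : q <= tail nu b.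
  apply: le_trans (outer_mass_tail nu b0); rewrite /q y0 lerD2l lerD2l lerN2; exact: dfun_homo.
pose p (i : nat) := if (i < K)%N then dfun nu (y i.+1) - dfun nu (y i) else q.
have sumE (h : R -> R) : \sum_(i < K.+1) p i * h (y i.+1) =
    \sum_(i < K) h (y i.+1) * (dfun nu (y i.+1) - dfun nu (y i)) + q * h (y K.+1).
  rewrite big_ord_recr /= {2}/p ltnn; congr (_ + _); apply: eq_bigr => i _.
  by rewrite /p ltn_ord mulrC.
exists K.+1, (fun i => p i), (fun i => y i.+1); split.
- by move=> i; rewrite /p; case: ifP => // _; rewrite subr_ge0 dfun_homo.
- have := sumE (fun=> 1); under eq_bigr do rewrite mulr1; move=> ->.
  under eq_bigr do rewrite mul1r.
  rewrite -(big_mkord xpredT (fun i => dfun nu (y i.+1) - dfun nu (y i))) telescope_sumr //.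
  by rewrite /q; ring.
move=> f M L cf fM HL.
have L0 : 0 <= L by have := HL 1 0; rewrite subr0 normr1 mulr1; exact: le_trans.
have M0 : 0 <= M := le_trans (normr_ge0 _) (fM 0).
have osc i t : (i < K)%N -> y i < t -> t <= y i.+1 -> `|f t - f (y i.+1)| <= L * dl.
  move=> _ t1 t2; apply: le_trans (HL _ _) _; rewrite ler_wpM2l // distrC ger0_norm ?subr_ge0 //.
  by move: t2 t1; rewrite ySE => *; lra.
have := @grid_sum R nu f y M (L * dl) K cf fM yS osc (mulr_ge0 L0 (ltW dl0)).
rewrite sumE -/q; set S := \sum_(_ < _) _; set I := Rintegral _ _ _ => H1.
have H2 : `|q * f (y K.+1)| <= M * q by rewrite normrM (ger0_norm q0) mulrC ler_wpM2r.
rewrite opprD addrA; apply: le_trans (ler_normB _ _) _.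
apply: le_trans (lerD H1 H2) _; rewrite -addrA lerD2l -mulrDr ler_wpM2l //.
by move: qT; rewrite -/b => ?; lra.
Qed.

Lemma resolvent_lipschitz z s t : 0 < complex.Im z ->
  normc (res z s - res z t) <= (complex.Im z)^-1 ^+ 2 * `|s - t|.
Proof.
move=> z0; have -> : res z s - res z t = res z s * res z t * (s - t)%:C.
  by rewrite rmorphB; field; rewrite (subR_neq0 s z0) (subR_neq0 t z0).
rewrite !normcM normcR ler_wpM2r // expr2 ler_pM ?normc_ge0 //; exact: normc_res.
Qed.

Lemma cE_Re m f : complex.Re (cE m f) = \int[m]_x complex.Re (f x).
Proof. by []. Qed.

Lemma cE_Im m f : complex.Im (cE m f) = \int[m]_x complex.Im (f x).
Proof. by []. Qed.

Lemma discretize_cauchy nu n : exists K (p x : 'I_K -> R),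
  [/\ forall i, 0 <= p i, \sum_i p i = 1 & forall z, 0 < complex.Im z ->
   normc (G nu z - \sum_i (p i)%:C / (z - (x i)%:C)) <=
     2 * ((complex.Im z)^-1 ^+ 2 * n.+1%:R^-1 + (complex.Im z)^-1 * (2 * tail nu n.+1%:R))].
Proof.
have [K [p [x [p0 p1 H]]]] := discretize nu n; exists K, p, x; split => // z z0.
have [cr ci] := ccb_res z0.
apply: le_trans (normc_le_ReIm _) _; rewrite mulr2n mulrDl mul1r; apply: lerD.
- rewrite cReB cauchyE cE_Re raddf_sum /=; under eq_bigr do rewrite cReZ.
  apply: H => // [t|s t]; first by rewrite (le_trans (Re_le_normc _)) // normc_res.
  by rewrite -cReB (le_trans (Re_le_normc _)) // resolvent_lipschitz.
- rewrite cImB cauchyE cE_Im raddf_sum /=; under eq_bigr do rewrite cImZ.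
  apply: H => // [t|s t]; first by rewrite (le_trans (Im_le_normc _)) // normc_res.
  by rewrite -cImB (le_trans (Im_le_normc _)) // resolvent_lipschitz.
Qed.

Lemma discrete_law_ord n (w y : 'I_n -> R) : (forall j, 0 <= w j) -> \sum_j w j = 1 ->
  exists m : prob R, forall f, cb f -> \int[m]_x f x = \sum_j w j * f (y j).
Proof.
move=> w0 w1.
pose w' (k : nat) : {nonneg R} := if insub k is Some j then NngNum (w0 j) else NngNum (lexx (0 : R)).
pose y' (k : nat) : R := if insub k is Some j then y j else 0.
have w'E (j : 'I_n) : (w' j)%:num = w j by rewrite /w' valK.
have y'E (j : 'I_n) : y' j = y j by rewrite /y' valK.
have [|m Hm] := @discrete_law R n w' y'.
  by rewrite -w1; apply: eq_bigr => j _; exact: w'E.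
by exists m => f cf; rewrite Hm //; apply: eq_bigr => j _; rewrite w'E y'E.
Qed.

(* [1 / (F nu - d)] is the Cauchy transform of the rank-one perturbation by
   [d 1 1^*] of multiplication by the variable in [L^2(nu)]; discretizing [nu]
   makes this operator a finite matrix. *)
Lemma perturbed_cauchy nu d : exists m : nat -> prob R, forall z, 0 < complex.Im z ->
  ccvg (fun n => G (m n) z) ((F nu z - d%:C)^-1).
Proof.
have H n : exists m : prob R, forall z, 0 < complex.Im z -> exists g : R[i],
   [/\ G m z * (1 - d%:C * g) = g, complex.Im g < 0 & normc (G nu z - g) <=
     2 * ((complex.Im z)^-1 ^+ 2 * n.+1%:R^-1 + (complex.Im z)^-1 * (2 * tail nu n.+1%:R))].
  have [K [p [x [p0 p1 Hp]]]] := discretize_cauchy nu n.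
  have [w [y [w0 w1 Hw]]] := rank_one_spectrum x d p0.
  have [m Hm] := discrete_law_ord y w0 (etrans w1 p1).
  (* [m'] exhibits the discretized sum [g] as a Cauchy transform, whose imaginary part is
     negative. *)
  have [m' Hm'] := discrete_law_ord x p0 p1.
  have GE (a : prob R) k (u v : 'I_k -> R) z : (forall f, cb f -> \int[a]_x f x = \sum_j u j * f (v j)) ->
      0 < complex.Im z -> G a z = \sum_j (u j)%:C / (z - (v j)%:C).
    move=> Ha z0; have [cr ci] := ccb_res z0; apply: complex_ext.
    - by rewrite cauchyE cE_Re Ha // raddf_sum /=; apply: eq_bigr => j _; rewrite cReZ.
    - by rewrite cauchyE cE_Im Ha // raddf_sum /=; apply: eq_bigr => j _; rewrite cImZ.
  exists m => z z0; exists (\sum_i (p i)%:C / (z - (x i)%:C)); split.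
  - by rewrite (GE _ _ _ _ _ Hm) // Hw.
  - by rewrite -(GE _ _ _ _ _ Hm') // Im_cauchy_lt0.
  - exact: Hp.
exists (fun n => projT1 (cid (H n))) => z z0.
set m := fun n => projT1 (cid (H n)).
have mP n := projT2 (cid (H n)) z z0.
pose g n := projT1 (cid (mP n)).
have gP n : [/\ G (m n) z * (1 - d%:C * g n) = g n, complex.Im (g n) < 0 & normc (G nu z - g n) <=
     2 * ((complex.Im z)^-1 ^+ 2 * n.+1%:R^-1 + (complex.Im z)^-1 * (2 * tail nu n.+1%:R))].
  exact: projT2 (cid (mP n)).
have gcvg : ccvg g (G nu z).
  apply: (@ccvg_squeeze _ _ _ (fun n => 2 * ((complex.Im z)^-1 ^+ 2 * n.+1%:R^-1 + (complex.Im z)^-1 * (2 * tail nu n.+1%:R)))).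
    by apply: nearW => n; rewrite normc_distC; case: (gP n).
  have -> : (0 : R) = 2 * ((complex.Im z)^-1 ^+ 2 * 0 + (complex.Im z)^-1 * (2 * 0)).
    by rewrite !mulr0 addr0 mulr0.
  apply: cvgM; [exact: cvg_cst|apply: cvgD; apply: cvgM; try exact: cvg_cst].
  - exact: cvg_harmonic.
  - apply: cvgM; [exact: cvg_cst|exact: tail_cvg0].
have nz (w : R[i]) : complex.Im w < 0 -> w != 0 /\ w^-1 - d%:C != 0.
  move=> w0; have wn : w != 0 by apply: Im_neq0; rewrite lt_eqF.
  split => //; apply: Im_neq0; rewrite cImB subr0 gt_eqF //; exact: Im_inv_gt0.
(* The rank-one formula is solved for [G (m n) z]; the negative imaginary part of [g n] keeps the
   denominators nonzero. *)
have GE : (fun n => G (m n) z) = (fun n => ((g n)^-1 - d%:C)^-1).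
  apply/funext => n; have [E g0 _] := gP n; have [gn gd] := nz _ g0.
  have gd' : 1 - d%:C * g n != 0.
    have -> : 1 - d%:C * g n = g n * ((g n)^-1 - d%:C) by field.
    by rewrite mulf_neq0.
  apply: (mulIf gd'); rewrite E; field. by rewrite gn mulNr.
rewrite GE; have [_ dn] := nz _ (Im_cauchy_lt0 nu z0); apply: ccvgV => //.
apply: ccvgB; last exact: ccvg_cst.
by apply: ccvgV => //; exact: cauchy_neq0.
Qed.

(** This feeds [outer_mass_cauchy] for the approximating laws: at a high point [i b] both the shift
    [d] and the deviation of [F nu] from the identity are at most [eta / 2] times the height. *)
Lemma perturbed_near nu d eta : 0 < eta -> eta <= 2^-1 -> exists2 b, 0 < b &
  normc ((0 +i* b) * (F nu (0 +i* b) - d%:C)^-1 - 1) <= 2 * eta.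
Proof.
move=> e0 e1.
have e3 : 0 < eta / 240 by rewrite divr_gt0.
have [b1 b10 tb] := tail_small nu e3.
pose b := b1 + `|d| * (2 / eta).
have q0 : 0 <= `|d| * (2 / eta) by rewrite mulr_ge0 // divr_ge0 // ltW.
have b0 : 0 < b by rewrite ltr_wpDr.
have tb' : tail nu b < eta / 240 by apply: le_lt_trans tb; apply: tail_antimono => //; rewrite lerDl.
have st : small_tail nu b by split => //; apply: le_trans (ltW tb') _; lra.
have db : `|d| <= eta / 2 * b.
  rewrite /b mulrDr; have -> : eta / 2 * (`|d| * (2 / eta)) = `|d| by field; rewrite gt_eqF.
  by rewrite lerDr mulr_ge0 // ltW // divr_gt0.
exists b => //; set z := 0 +i* b.
have z0 : 0 < complex.Im z by [].
have zn : z != 0 by apply: Im_neq0; rewrite gt_eqF.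
have zN : normc z = b by rewrite /z /normc expr0n /= add0r sqrtr_sqr gtr0_norm.
have sz : sector b z by split; rewrite /= ?lexx // normr0 mulr_ge0 // ltW.
have := recip_near st sz; rewrite zN => Hn.
pose r := (F nu z - d%:C - z) / z.
have rn : normc r <= eta.
  rewrite normcM normcV zN ler_pdivrMr //.
  have -> : F nu z - d%:C - z = (F nu z - z) - d%:C by ring.
  apply: le_trans (normc_leB _ _) _; rewrite normcR.
  apply: le_trans (lerD Hn db) _.
  have : 4 * tail nu b * b <= eta / 2 * b by rewrite ler_pM2r //; lra.
  by move=> ?; lra.
have E : F nu z - d%:C = z * (1 + r) by rewrite /r; field.
have L : 2^-1 <= normc (1 + r).
  have := normc_geB 1 (- r); rewrite opprK normc_opp normc1 => ?; lra.
have rn1 : 1 + r != 0 by rewrite -normc_gt0; lra.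
have -> : z * (F nu z - d%:C)^-1 - 1 = - r / (1 + r) by rewrite E; field; rewrite zn rn1.
rewrite normcM normc_opp normcV ler_pdivrMr; last by lra.
have := normc_ge0 r; nra.
Qed.

(** The laws of [perturbed_cauchy] are tight by [perturbed_near], and a Helly limit has
    [1 / (F nu - d)] as its Cauchy transform because resolvents are bounded and Lipschitz. *)
Theorem boolean_translate_exists nu d : exists rho : prob R,
  forall z, 0 < complex.Im z -> F rho z = F nu z - d%:C.
Proof.
have [m Hm] := perturbed_cauchy nu d.
have [U [UU ooU]] := @ultraFilterLemma nat \oo _.
have near_oo (P : set nat) : (\forall n \near \oo, P n) -> \forall n \near U, P n by exact: ooU.
have [eps e0|rho Hrho] := @helly R U UU m.
  (* [perturbed_near] doubles [eta] and [outer_mass_cauchy] doubles again; the remaining factor 2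
     gives room for passing from the limit to large [n]. *)
  pose eta := Num.min 2^-1 (eps / 8).
  have eta0 : 0 < eta by rewrite lt_min invr_gt0 ltr0n divr_gt0.
  have eta1 : eta <= 2^-1 by rewrite ge_min lexx.
  have eta8 : eta <= eps / 8 by rewrite ge_min lexx orbT.
  have [b b0 Hb] := perturbed_near nu d eta0 eta1.
  exists b; apply: near_oo.
  have z0 : 0 < complex.Im (0 +i* b) by [].
  have := cvg_normc (ccvgB (ccvgM (ccvg_cst (0 +i* b)) (Hm _ z0)) (ccvg_cst 1)).
  have lim : normc ((0 +i* b) * (F nu (0 +i* b) - d%:C)^-1 - 1) < eps / 2 by lra.
  move=> /cvgr_lt/(_ _ lim); apply: filterS => n Hn.
  have := outer_mass_cauchy (m n) b0.
  have := dfun_ge0 (m n) (- b); have := dfun_le1 (m n) b.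
  by move=> *; split; lra.
exists rho => z z0; rewrite -[RHS]invrK; congr (_^-1).
have [cr ci] := ccb_res z0; have [Hr Hi] := Hm _ z0.
have lip (p : R[i] -> R) : (forall u v, p (u - v) = p u - p v) -> (forall u, `|p u| <= normc u) ->
    exists L, forall s t, `|p (res z s) - p (res z t)| <= L * `|s - t|.
  move=> pB pn; exists ((complex.Im z)^-1 ^+ 2) => s t.
  by rewrite -pB (le_trans (pn _)) // resolvent_lipschitz.
have [UF _] := UU.
apply: complex_ext.
- have A := Hrho _ cr (lip _ (@cReB R) (@Re_le_normc R)).
  have B : complex.Re (G (m n) z) @[n --> U] --> complex.Re (F nu z - d%:C)^-1.
    by move=> V HV; exact: (ooU _ (Hr V HV)).
  exact: (cvg_unique _ A B).
- have A := Hrho _ ci (lip _ (@cImB R) (@Im_le_normc R)).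
  have B : complex.Im (G (m n) z) @[n --> U] --> complex.Im (F nu z - d%:C)^-1.
    by move=> V HV; exact: (ooU _ (Hi V HV)).
  exact: (cvg_unique _ A B).
Qed.
End BooleanShift.

(** * Stability of the limit law *)
Section Conclusion.
Variable R : realType.
Implicit Types (mu nu : prob R) (z : R[i]).

(** Boolean convolution is tested on a whole half-plane, so [bool_energy_upper] must first leave the
    cone; the common value of both convolutions is the law given by [boolean_translate_exists]. *)
Lemma boolean_stable (S : Prop) nu (A B C : R) : 0 < A -> 0 < B -> 0 < C ->
  eqvK S (addK (scK A (bool_energy nu)) (scK B (bool_energy nu))) (scK C (bool_energy nu)) ->
  exists2 d : R, (S -> d = 0) &
    same_conv Boolean (dilation A nu) (dilation B nu) (dilation C nu) (point_mass d).
Proof.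
move=> A0 B0 C0 [d Sd H]; exists d => //.
have H' := bool_energy_upper A0 B0 C0 H.
have [rho Hrho] := boolean_translate_exists (dilation C nu) d.
have E z : 0 < complex.Im z ->
    bool_energy rho z = bool_energy (dilation C nu) z + d%:C.
  by move=> z0; rewrite /bool_energy Hrho //; ring.
exists rho; apply/boolean_convP => z z0; rewrite E //; first by rewrite H'.
by rewrite bool_energy_point_mass.
Qed.

Lemma limit_law_same_conv star (S : Prop) (mu rho : R -> prob R) (a b : R -> R) nu :
  conv_semigroup star mu -> (forall t, 0 < t -> 0 < a t) ->
  (forall t, 0 < t -> is_conv star (dilation (a t) (mu t)) (point_mass (b t)) (rho t)) ->
  (S -> forall t, 0 < t -> b t = 0) -> nondegenerate nu ->
  weak_cvg 0^'+ rho nu \/ weak_cvg +oo rho nu ->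
  forall A B : R, 0 < A -> 0 < B -> exists C d : R, [/\ 0 < C, S -> d = 0 &
    same_conv star (dilation A nu) (dilation B nu) (dilation C nu) (point_mass d)].
Proof.
case: star => semi a0 rhoE bS nd lim A B A0 B0.
- have [|||C C0 E] := limit_law_stable (char_domain R S)
    (@chf_cvg R) (@chf_nondeg R) _ _ _ semi a0 rhoE bS nd lim A0 B0.
  + by move=> m n r H; apply: eqC_eqv => s; exact: chf_conv.
  + by move=> l m _; apply: eqC_eqv => s; rewrite chf_dilation.
  + move=> c x Sc; exists c => // s; by rewrite /addC chf_point_mass.
  by have [d Sd H] := classical_stable A0 B0 C0 E; exists C, d.
- have [|||C C0 E] := limit_law_stable (cone_domain R S)
    (@vphi_cvg R) (@vphi_nondeg R) _ _ _ semi a0 rhoE bS nd lim A0 B0.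
  + by move=> m n r; exact: vphi_conv.
  + by move=> l m; exact: vphi_dilation.
  + by move=> c x; exact: vphi_shiftK.
  by have [d Sd H] := free_stable A0 B0 C0 E; exists C, d.
- have [|||C C0 E] := limit_law_stable (cone_domain R S)
    (@bool_energy_cvg R) (@bool_energy_nondeg R) _ _ _ semi a0 rhoE bS nd lim A0 B0.
  + by move=> m n r; exact: bool_energy_conv.
  + by move=> l m; exact: bool_energy_dilation.
  + by move=> c x; exact: bool_energy_shift.
  by have [d Sd H] := boolean_stable A0 B0 C0 E; exists C, d.
Qed.
End Conclusion.

Local Close Scope complex_scope.

Theorem proposition3p2 (R : realType) (star : convolution)
    (mu : R -> prob R)
    (mu_semigroup : conv_semigroup star mu)
    (mu_continuous : weakly_continuous mu)
    (mu0 : same_law (mu 0) (point_mass 0))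
    (a b : R -> R) (a_gt0 : forall t : R, 0 < t -> 0 < a t)
    (rho : R -> prob R)
    (rhoE : forall t : R, 0 < t ->
      is_conv star (dilation (a t) (mu t)) (point_mass (b t)) (rho t))
    (nu : prob R) (nu_nondegenerate : nondegenerate nu)
    (rho_nu : weak_cvg 0^'+ rho nu \/ weak_cvg +oo rho nu) :
  stable star nu /\
  ((forall t : R, 0 < t -> b t = 0) -> strictly_stable star nu).
Proof.
split=> [|b0]; split=> // A B A0 B0.
- have [C [d [C0 _ H]]] := @limit_law_same_conv R star False mu rho a b nu
    mu_semigroup a_gt0 rhoE (@False_rect _) nu_nondegenerate rho_nu A B A0 B0.
  by exists C, d.
- have [C [d [C0 Sd H]]] := @limit_law_same_conv R star True mu rho a b nu
    mu_semigroup a_gt0 rhoE (fun=> b0) nu_nondegenerate rho_nu A B A0 B0.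
  by exists C; split => //; rewrite -(Sd I).
Qed.
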